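(* Let $\Omega=B(0,1)\subset\mathbb{R}^2$ and let $a\in(0,1)$, $\varepsilon_0,M>0$, $N\ge 0$. There exists a positive constant $C=C(a,\varepsilon_0,M,N)$ such that $$\|\Lambda_\alpha-\Lambda_\beta\|_\star\ \ge\ C\big(|\alpha_0-\beta_0|+|\alpha_1-\beta_1|+|\alpha_2-\beta_2|\big)\qquad\text{for all }\gamma_\alpha,\gamma_\beta\in\mu(a,\varepsilon_0,M,N).$$
   Context: For $\alpha=(\alpha_0,\alpha_1,\alpha_2)$ define on $B(0,1)\subset\mathbb{R}^2$ the radial conductivity, with $r=|x|$, $$\gamma_\alpha(x)=\begin{cases}\alpha_1+\alpha_2(a-r) & \text{if } 0\le r<a,\\ \alpha_0 & \text{if } a\le r<1.\end{cases}$$ $\mu(a,\varepsilon_0,M,N)$ is the set of all such $\gamma_\alpha$ with $\varepsilon_0\le\alpha_0,\alpha_1\le M$ and $0\le\alpha_2\le N$. For $f\in H^{1/2}(\partial\Omega)$ let $u\in H^1(\Omega)$ be the unique weak solution of $\nabla\cdot(\gamma_\alpha\nabla u)=0$ in $\Omega$, $u=f$ on $\partial\Omega$. The Dirichlet-to-Neumann map is $\Lambda_\alpha=\Lambda_{\gamma_\alpha}:H^{1/2}(\partial\Omega)\to H^{-1/2}(\partial\Omega)$, $\Lambda_\alpha f=\gamma_\alpha\,\partial_\nu u|_{\partial\Omega}$, where $\nu$ is the exterior unit normal to $\partial\Omega$. The norm is $$\|\Lambda_\alpha-\Lambda_\beta\|_\star=\sup_{f\in H^{1/2}(\partial\Omega),\,f\ne0}\frac{\|(\Lambda_\alpha-\Lambda_\beta)f\|_{H^{-1/2}(\partial\Omega)}}{\|f\|_{H^{1/2}(\partial\Omega)}},$$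 where for $f=\sum_{n\in\mathbb{Z}}\hat f(n)e^{in\theta}$ on the unit circle, $\|f\|_{H^{s}(\partial\Omega)}^2=\sum_{n\in\mathbb{Z}}(1+n^2)^{s}|\hat f(n)|^2$, $s=\pm\frac12$. *)

(* Defs.v *)
From mathcomp Require Import all_boot all_order all_algebra.
From mathcomp Require Import all_classical all_reals all_analysis.
From mathcomp Require Import complex.

Set Implicit Arguments.
Unset Strict Implicit.
Unset Printing Implicit Defensive.

Import Order.TTheory GRing.Theory Num.Theory numFieldNormedType.Exports.

Local Open Scope classical_set_scope.
Local Open Scope ring_scope.
Local Open Scope complex_scope.

Section Dirichlet_to_Neumann.
Context {R : realType}.

(* Functions, Sobolev spaces and Fourier series are complex-valued. Complex
   integrals and limits are taken on real and imaginary parts. *)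
Definition cintegral d (T : measurableType d) (m : {measure set T -> \bar R})
    (D : set T) (F : T -> R[i]) : R[i] :=
  Rintegral m D (fun x => complex.Re (F x))
    +i* Rintegral m D (fun x => complex.Im (F x)).

Definition plane := (measurableTypeR R * measurableTypeR R)%type.

Definition mu2 : {measure set plane -> \bar R} :=
  (@lebesgue_measure R \x @lebesgue_measure R)%E.

Definition radius (p : R * R) : R := Num.sqrt (p.1 ^+ 2 + p.2 ^+ 2).

Definition disk : set (R * R) := [set p | radius p < 1].

Fixpoint Ck (k : nat) (phi : R * R -> R) : Prop :=
  if k is k'.+1 then
    [/\ forall p, differentiable phi p,
        Ck k' (fun p => 'D_((1, 0) : R * R) phi p) &
        Ck k' (fun p => 'D_((0, 1) : R * R) phi p)]
  else continuous phi.

Definition test_function (phi : R * R -> R) : Prop :=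
  [/\ forall k, Ck k phi,
      compact (closure [set p | phi p != 0]) &
      closure [set p | phi p != 0] `<=` disk].

Definition C1 (phi : R * R -> R[i]) : Prop :=
  Ck 1 (fun p => complex.Re (phi p)) /\ Ck 1 (fun p => complex.Im (phi p)).

Definition pderive (e : R * R) (phi : R * R -> R[i]) : R * R -> R[i] :=
  fun p => ('D_e (fun q => complex.Re (phi q)) p)
             +i* ('D_e (fun q => complex.Im (phi q)) p).

Definition grad (phi : R * R -> R[i]) : R * R -> R[i] * R[i] :=
  fun p => (pderive (1, 0) phi p, pderive (0, 1) phi p).

Definition L2normsq (u : R * R -> R[i]) : \bar R :=
  (\int[mu2]_(p in disk) (ComplexField.Normc.normc (u p) ^+ 2)%:E)%E.

Definition L2 (u : R * R -> R[i]) : Prop :=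
  [/\ measurable_fun (disk : set plane) (fun p : plane => complex.Re (u p)),
      measurable_fun (disk : set plane) (fun p : plane => complex.Im (u p)) &
      (L2normsq u < +oo)%E].

Definition weak_pderive (e : R * R) (u w : R * R -> R[i]) : Prop :=
  forall phi, test_function phi ->
    cintegral mu2 disk (fun p => u p * ('D_e phi p)%:C)
    = - cintegral mu2 disk (fun p => w p * (phi p)%:C).

(* [H1 u du]: u belongs to H^1(disk) and du is its weak gradient. *)
Definition H1 (u : R * R -> R[i]) (du : R * R -> R[i] * R[i]) : Prop :=
  [/\ L2 u, L2 (fun p => (du p).1), L2 (fun p => (du p).2),
      weak_pderive (1, 0) u (fun p => (du p).1) &
      weak_pderive (0, 1) u (fun p => (du p).2)].

Definition H1normsq (u : R * R -> R[i]) (du : R * R -> R[i] * R[i]) : \bar R :=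
  (L2normsq u + L2normsq (fun p => (du p).1)
     + L2normsq (fun p => (du p).2))%E.

(* Elements of H^s of the unit circle are represented by their Fourier
   coefficients f : int -> R[i]; for s < 0 they need not be functions. *)
Definition Hsnormsq (s : R) (f : int -> R[i]) : \bar R :=
  (\esum_(n in [set: int])
     (((1 + n%:~R ^+ 2) `^ s) * ComplexField.Normc.normc (f n) ^+ 2)%:E)%E.

Definition Hs (s : R) (f : int -> R[i]) : Prop := (Hsnormsq s f < +oo)%E.

Definition Hsnorm (s : R) (f : int -> R[i]) : R :=
  Num.sqrt (fine (Hsnormsq s f)).

Definition boundary_coef (phi : R * R -> R[i]) (n : int) : R[i] :=
  ((2 * pi)^-1)%:C
  * cintegral (@lebesgue_measure R) `[0, 2 * pi]
      (fun t : R => phi (cos t, sin t)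
                    * (cos (n%:~R * t) -i* sin (n%:~R * t))).

(* The trace is the continuous extension to H^1(disk), with values in H^(1/2)
   of the circle, of the restriction to the circle of C^1 functions. *)
Definition trace (u : R * R -> R[i]) (du : R * R -> R[i] * R[i])
    (f : int -> R[i]) : Prop :=
  exists phi : nat -> R * R -> R[i],
    [/\ forall k, C1 (phi k),
        H1normsq (fun p => phi k p - u p) (fun p => grad (phi k) p - du p)
          @[k --> \oo] --> 0%E &
        Hsnormsq 2^-1 (fun n => boundary_coef (phi k) n - f n)
          @[k --> \oo] --> 0%E].

Definition zsum (c : int -> R[i]) : R[i] :=
  limn (fun N : nat => \sum_(k < N.*2.+1) complex.Re (c (k%:Z - N%:Z)))
    +i* limn (fun N : nat => \sum_(k < N.*2.+1) complex.Im (c (k%:Z - N%:Z))).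

(* The sesquilinear pairing extending the integral of h * g^* in dtheta. *)
Definition pairing (h g : int -> R[i]) : R[i] :=
  (2 * pi)%:C * zsum (fun n => h n * conjc (g n)).

Definition energy (gam : R * R -> R) (du dv : R * R -> R[i] * R[i]) : R[i] :=
  cintegral mu2 disk
    (fun p => (gam p)%:C * ((du p).1 * conjc (dv p).1 + (du p).2 * conjc (dv p).2)).

Definition weak_solution (gam : R * R -> R) (f : int -> R[i])
    (u : R * R -> R[i]) (du : R * R -> R[i] * R[i]) : Prop :=
  [/\ H1 u du, trace u du f &
      forall phi, test_function phi ->
        energy gam du (grad (fun p => (phi p)%:C)) = 0].

(* h is the conormal derivative gam * d_nu u on the circle, which for u in H^1
   is the element of H^(-1/2) given by Green's formula. *)
Definition conormal_derivative (gam : R * R -> R)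
    (du : R * R -> R[i] * R[i]) (h : int -> R[i]) : Prop :=
  Hs (- 2^-1) h /\
  forall v dv g, H1 v dv -> trace v dv g -> energy gam du dv = pairing h g.

Definition DN (gam : R * R -> R) (f : int -> R[i]) : int -> R[i] :=
  xget (0 : int -> R[i])
    [set h | exists u du,
      weak_solution gam f u du /\ conormal_derivative gam du h].

(* The operator norm of A - B from H^(1/2) to H^(-1/2). *)
Definition star_dist (A B : (int -> R[i]) -> int -> R[i]) : \bar R :=
  ereal_sup [set (Hsnorm (- 2^-1) (A f - B f) / Hsnorm 2^-1 f)%:E
            | f in [set f | Hs 2^-1 f /\ f <> 0]].

Record param := Param { par0 : R; par1 : R; par2 : R }.

Definition conductivity (a : R) (al : param) : R * R -> R :=
  fun p => if radius p < a then par1 al + par2 al * (a - radius p)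
           else par0 al.

Definition conductivity_class (a eps0 M N : R) : set (R * R -> R) :=
  [set conductivity a al | al in
    [set al | [/\ eps0 <= par0 al <= M, eps0 <= par1 al <= M &
                  0 <= par2 al <= N]]].

End Dirichlet_to_Neumann.

(* Main.v *)
(* The conductivity is radial, so the n-th Fourier mode of the boundary data is an eigenvector
   of the Dirichlet-to-Neumann map. For a <= r < 1 the radial solution combines r^n and r^-n;
   for r < a it is r^n times a power series in kappa r. Matching the fluxes at r = a gives the
   eigenvalue n alpha_0 (alpha_0 + F_n - q (alpha_0 - F_n)) / (alpha_0 + F_n + q (alpha_0 - F_n))
   with q = a^(2n), F_n = alpha_1 (1 + g_n(kappa a)) and n g_n the logarithmic derivative of the
   power series.
   A distance s between the two maps bounds the difference of the n-th eigenvalues by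
   s (1 + n^2)^(1/2). Dividing by n and letting n go to infinity controls alpha_0; for fixed n
   the Moebius map above is then inverted to control F_n. Since g_1 has derivative bounded below
   while g_n has derivative O(1/n), F_1 and F_n for one large n control kappa, then alpha_1 and
   alpha_2. *)
From HB Require Import structures.
Require Import Defs.
From mathcomp Require Import all_boot all_order all_algebra.
From mathcomp Require Import all_classical all_reals all_analysis.
From mathcomp Require Import measurable_realfun complex ring lra.

Set Implicit Arguments.
Unset Strict Implicit.
Unset Printing Implicit Defensive.

Import Order.TTheory GRing.Theory Num.Theory numFieldNormedType.Exports.

Local Open Scope classical_set_scope.
Local Open Scope ring_scope.

(** The obstacle is regularity: the explicit solution has a gradient that jumps across r = a, while
    traces are defined as limits of C^1 functions and weak derivatives through test functions. Every
    integral identity is therefore proved against C^1 functions, where polar coordinates and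
    integration by parts suffice, and then carried to H^1 by L^2 limits. This rests on explicit C^1
    approximations of the solution that are bounded on the disk together with their gradients,
    converge at every point of it, and have the exact boundary values e^(i n theta). The radial
    equation is used as (r gamma R')' = n^2 gamma R / r: with W = r gamma R' the energy against a
    C^1 function collapses to boundary terms, and those at r = a cancel by continuity of the flux.
    Recovering F_n costs a factor 1/q = a^(-2n). Only alpha_0, whose bound is uniform in n, can thus
    be reached by a limit in n; afterwards n has to stay fixed, and two indices are used because a
    single F_n mixes alpha_1 and kappa. *)

Lemma continuous_compose (S T U : topologicalType) (f : S -> T) (g : T -> U) :
  continuous f -> continuous g -> continuous (fun x => g (f x)).
Proof. by move=> cf cg x; exact: (continuous_comp (cf x) (cg _)). Qed.
Lemma continuous_fst (S T : topologicalType) : continuous (@fst S T).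
Proof. by move=> p; exact: cvg_fst. Qed.
Lemma continuous_snd (S T : topologicalType) : continuous (@snd S T).
Proof. by move=> p; exact: cvg_snd. Qed.
Lemma continuous_funD (R : realType) (T : topologicalType) (f g : T -> R) :
  continuous f -> continuous g -> continuous (fun x => f x + g x).
Proof. by move=> cf cg x; exact: (continuousD (cf x) (cg x)). Qed.
Lemma continuous_funM (R : realType) (T : topologicalType) (f g : T -> R) :
  continuous f -> continuous g -> continuous (fun x => f x * g x).
Proof. by move=> cf cg x; exact: (continuousM (cf x) (cg x)). Qed.
Lemma continuous_funB (R : realType) (T : topologicalType) (f g : T -> R) :
  continuous f -> continuous g -> continuous (fun x => f x - g x).
Proof. by move=> cf cg x; exact: (continuousB (cf x) (cg x)). Qed.
Lemma continuous_funX (R : realType) (T : topologicalType) (f : T -> R) n :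
  continuous f -> continuous (fun x => f x ^+ n).
Proof. by move=> cf; exact: (continuous_compose cf (@exprn_continuous R n)). Qed.
Lemma continuous_funV (R : realType) (T : topologicalType) (f : T -> R) :
  (forall x, f x != 0) -> continuous f -> continuous (fun x => (f x)^-1).
Proof. by move=> f0 cf x; apply: cvgV; [exact: f0|exact: cf]. Qed.
Lemma continuous_cst (S T : topologicalType) (c : T) : continuous (fun _ : S => c).
Proof. by move=> x; exact: cst_continuous. Qed.
Lemma continuous_pair (S T U : topologicalType) (f : S -> T) (g : S -> U) :
  continuous f -> continuous g -> continuous (fun x => (f x, g x)).
Proof. by move=> cf cg x; exact: (cvg_pair (cf x) (cg x)). Qed.
Lemma continuous_idfun (T : topologicalType) : continuous (fun x : T => x).
Proof. by move=> x; exact: cvg_id. Qed.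

(** * Polar coordinates *)

Section plane_measurability.
Context {R : realType}.

(** [plane] carries the product sigma-algebra, whereas continuity refers to the product topology.
    They meet because an open set is the union of the countably many boxes with rational centre and
    radius that it contains. *)
Lemma open_measurable_plane (A : set (R * R)) :
  open A -> measurable (A : set (@plane R)).
Proof.
move=> oA.
pose box (q : rat * rat * rat) : set (R * R) :=
  [set p | `|p.1 - ratr q.1.1| < ratr q.2 /\ `|p.2 - ratr q.1.2| < ratr q.2].
have mbox q : measurable (box q : set (@plane R)).
  have -> : box q =
      `](ratr q.1.1 - ratr q.2), (ratr q.1.1 + ratr q.2)[%classic `*`
      `](ratr q.1.2 - ratr q.2), (ratr q.1.2 + ratr q.2)[%classic.
    by apply/seteqP; split=> -[x y]; rewrite /box/= !in_itv/= !ltr_distl;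
      case=> /andP[-> ->] /andP[-> ->].
  by apply: measurableX; exact: measurable_itv.
rewrite (_ : A = \bigcup_(q in [set q | box q `<=` A]) box q).
  rewrite bigcup_mkcond; apply: countable_bigcupT_measurable => [|q]; first exact: countableP.
  by case: ifP.
apply/seteqP; split=> [[x y] Axy|p [q /=]]; last exact.
have := open_nbhs_nbhs (conj oA Axy).
move=> /nbhs_ballP[e /= e0 eA].
have [d d0] : exists2 d : rat, (0 < ratr d :> R) & (ratr d < e / 2 :> R).
  have [q] := rat_in_itvoo (divr_gt0 e0 (ltr0n R 2)).
  by rewrite in_itv/= => /andP[? ?]; exists q.
move=> de.
have close (z : R) : exists q : rat, `|z - ratr q| < ratr d.
  have [q] := @rat_in_itvoo R (z - ratr d) (z + ratr d) ltac:(lra).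
  by rewrite in_itv/= => /andP[? ?]; exists q; rewrite ltr_norml; lra.
have [q1 h1] := close x; have [q2 h2] := close y.
exists (q1, q2, d) => //= -[u v] /= [k1 k2]; apply: eA; split; rewrite /ball/=.
  by move: h1 k1; rewrite !ltr_norml/= => /andP[? ?] /andP[? ?]; lra.
by move: h2 k2; rewrite !ltr_norml/= => /andP[? ?] /andP[? ?]; lra.
Qed.

Lemma continuous_measurable_plane (f : R * R -> R) : continuous f ->
  measurable_fun [set: @plane R] (f : @plane R -> measurableTypeR R).
Proof.
move=> /continuousP cf; apply: (measurability _ (RGenOpens.measurableE R)).
move=> _ [_ [a [b ->] <-]]; rewrite setTI; apply: open_measurable_plane.
by apply: cf; exact: interval_open.
Qed.

End plane_measurability.

Section affine_substitution.
Context {R : realType}.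
Notation mu := (@lebesgue_measure R).
Local Open Scope ereal_scope.

Lemma measurable_affine (c d : R) :
  measurable_fun [set: measurableTypeR R] ((fun x => c * x + d)%R : _ -> measurableTypeR R).
Proof.
by apply: measurable_funD => //; apply: measurable_funM.
Qed.

(** Both sides are measures that agree on half-open intervals, and these determine Lebesgue
    measure. *)
Lemma lebesgue_measure_affine (c d : R) (A : set (measurableTypeR R)) : (0 < c)%R ->
  measurable A ->
  c%:E * pushforward mu ((fun x => c * x + d)%R : _ -> measurableTypeR R) A = mu A.
Proof.
move=> c0 mA.
pose phi : measurableTypeR R -> measurableTypeR R := (fun x => c * x + d)%R.
pose nu' : {measure set (measurableTypeR R) -> \bar R} := mscale (NngNum (ltW c0)) (pushforward mu phi).
have mphi : measurable_fun setT phi := measurable_affine c d.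
pose nu := nu' mphi.
transitivity (nu A); first by [].
apply/esym/lebesgue_measure_unique => //= _ [[a b]] _ <-.
transitivity (c%:E * mu (phi @^-1` `]a, b]%classic)); last by [].
rewrite (_ : _ @^-1` _ = `](((a - d) / c)%R), (((b - d) / c)%R)]%classic); last first.
  apply/seteqP; split=> x /=; rewrite !in_itv/= ltr_pdivrMr// ler_pdivlMr// mulrC;
   by rewrite -ltrBlDr -lerBrDr.
rewrite !lebesgue_measure_itv/= !lte_fin.
rewrite ltr_pM2r ?invr_gt0// ltrD2r.
case: ifPn => _; last by rewrite mule0.
rewrite -!EFinD -EFinM; congr EFin; field; lra.
Qed.

Lemma ge0_integral_affine (c d : R) (f : R -> \bar R) : (0 < c)%R ->
  measurable_fun [set: measurableTypeR R] (f : measurableTypeR R -> \bar R) ->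
  (forall x, 0 <= f x) ->
  \int[mu]_x f x = c%:E * \int[mu]_x f (c * x + d)%R.
Proof.
move=> c0 mf f0.
pose phi : measurableTypeR R -> measurableTypeR R := (fun x => c * x + d)%R.
pose nu' : {measure set (measurableTypeR R) -> \bar R} := mscale (NngNum (ltW c0)) (pushforward mu phi).
have mphi : measurable_fun setT phi := measurable_affine c d.
pose nu := nu' mphi.
transitivity (\int[nu]_x f x).
  apply: eq_measure_integral => A mA _.
  exact/esym/(lebesgue_measure_affine d c0 mA).
rewrite ge0_integral_mscale//= ge0_integral_pushforward//=.
Qed.

Lemma ge0_integralN (f : R -> \bar R) :
  measurable_fun [set: measurableTypeR R] (f : measurableTypeR R -> \bar R) ->
  (forall x, 0 <= f x) ->
  \int[mu]_x f x = \int[mu]_x f (- x)%R.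
Proof.
move=> mf f0.
transitivity (\int[pushforward mu (-%R : _ -> measurableTypeR R)]_x f x).
  by apply: eq_measure_integral => A mA _; exact/esym/lebesgue_measureN.
by rewrite ge0_integral_pushforward//= preimage_setT.
Qed.

Lemma ge0_integral_scale (c : R) (f : R -> \bar R) : (c != 0)%R ->
  measurable_fun [set: measurableTypeR R] (f : measurableTypeR R -> \bar R) ->
  (forall x, 0 <= f x) ->
  \int[mu]_x f x = `|c|%:E * \int[mu]_x f (x * c)%R.
Proof.
move=> c0 mf f0.
have := c0; rewrite neq_lt => /orP[cneg|cpos].
  rewrite ge0_integralN// (@ge0_integral_affine (- c) 0 (fun x => f (- x)%R)) ?oppr_gt0//.
    rewrite ltr0_norm//; congr (_ * _); apply: eq_integral => x _.
    by rewrite addr0 mulNr opprK mulrC.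
  by apply: measurableT_comp => //; exact: oppr_measurable.
rewrite (@ge0_integral_affine c 0)// gtr0_norm//; congr (_ * _).
by apply: eq_integral => x _; rewrite addr0 mulrC.
Qed.

End affine_substitution.

Section polar.
Context {R : realType}.
Notation mu := (@lebesgue_measure R).
Local Open Scope ereal_scope.

(** The substitution is made on the compact intervals [I n]. Monotone convergence along them and
    along their images [J n] reaches the whole line; the union of the [J n] misses only the two
    endpoints. *)
Lemma ge0_integral_atan (G : R -> R) : continuous G -> (forall x, 0 <= G x)%R ->
  \int[mu]_s ((1 + s ^+ 2)^-1 * G (atan s))%:E =
  \int[mu]_(t in `[(- (pi / 2))%R, (pi / 2)%R]) (G t)%:E.
Proof.
move=> cG G0.
have mG : measurable_fun [set: measurableTypeR R] G by exact: continuous_measurable_fun.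
have cat : continuous (@atan R) by move=> x; exact: continuous_atan.
have cd : continuous (fun s : R => (1 + s ^+ 2)^-1%R).
  exact: continuous_oneDsqrV.
have d1E : (@atan R)^`()%classic = (fun s : R => (1 + s ^+ 2)^-1%R).
  by apply/funext => s; rewrite derive1_atan.
pose I n := `[(- n%:R)%R, (n%:R)%R : R]%classic.
pose J n := `[atan (- n%:R)%R, atan (n%:R : R)]%classic.
have IJ n : \int[mu]_(s in I n) ((1 + s ^+ 2)^-1 * G (atan s))%:E =
            \int[mu]_(t in J n) (G t)%:E.
  rewrite (@integration_by_substitution_increasing _ atan) ?d1E//.
  - by apply: eq_integral => s _; rewrite mulrC.
  - by rewrite (@le_trans _ _ 0%R)// oppr_le0.
  - by move=> x y _ _; exact: lt_atan.
  - by apply/cvg_ex; exists (1 + (- n%:R) ^+ 2)^-1%R; apply: cvg_at_right_filter; exact: cd.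
  - by apply/cvg_ex; exists (1 + n%:R ^+ 2)^-1%R; apply: cvg_at_left_filter; exact: cd.
  - split; first by move=> x _; exact: derivable_atan.
    + by apply: cvg_at_right_filter; exact: cat.
    + by apply: cvg_at_left_filter; exact: cat.
  - exact: continuous_subspaceT.
have IT : \bigcup_n I n = [set: R].
  apply/seteqP; split=> // x _; exists (Num.trunc `|x|).+1 => //=.
  have := truncnS_gt `|x|; rewrite ltr_norml => /andP[h1 h2].
  by rewrite /I/= in_itv/= !ltW.

have JT : \bigcup_n J n = `](- (pi / 2))%R, (pi / 2)%R[%classic.
  apply/seteqP; split=> x /=.
    move=> [n _] /=; rewrite /I /J /= !in_itv/= => /andP[h1 h2].
    by rewrite (lt_le_trans (atan_gtNpi2 _) h1)/= (le_lt_trans h2 (atan_ltpi2 _)).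
  move=> xJ; have xE := tanK xJ.
  have : [set: R] (tan x) by [].
  rewrite -IT => -[n _ /=]; rewrite /I /J /= in_itv/= => /andP[h1 h2].
  by exists n => //=; rewrite /J /= in_itv/= -xE !le_atan.
rewrite integral_itv_bndoo; last first.
  by apply: measurable_funTS; exact/measurable_EFinP.
rewrite -JT -IT.
have c1 : (\int[mu]_(s in I n) ((1 + s ^+ 2)^-1 * G (atan s))%:E) @[n --> \oo] -->
   \int[mu]_(s in \bigcup_n I n) ((1 + s ^+ 2)^-1 * G (atan s))%:E.
  apply: ge0_nondecreasing_set_cvg_integral => //.
  - apply/nondecreasing_seqP => n; apply/subsetPset => x /=; rewrite /I /J /= !in_itv/= => /andP[h1 h2].
    have hn : (n%:R <= n.+1%:R :> R)%R by rewrite ler_nat.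
    by rewrite (le_trans _ h1) ?(le_trans h2) ?lerN2.
  - by move=> n; exact: measurable_itv.
  - move=> n; apply: measurable_funTS; apply/measurable_EFinP; apply: measurable_funM.
      exact: continuous_measurable_fun.
    by apply: measurableT_comp => //; exact: continuous_measurable_fun.
  - by move=> n x _; rewrite lee_fin mulr_ge0// invr_ge0 addr_ge0// sqr_ge0.
have c2 : (\int[mu]_(t in J n) (G t)%:E) @[n --> \oo] --> \int[mu]_(t in \bigcup_n J n) (G t)%:E.
  apply: ge0_nondecreasing_set_cvg_integral => //.
  - apply/nondecreasing_seqP => n; apply/subsetPset => x /=; rewrite /I /J /= !in_itv/= => /andP[h1 h2].
    have hn : (n%:R <= n.+1%:R :> R)%R by rewrite ler_nat.
    by rewrite (le_trans _ h1) ?(le_trans h2) ?le_atan ?lerN2.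
  - by move=> n; exact: measurable_itv.
  - by move=> n; apply: measurable_funTS; exact/measurable_EFinP.
  - by move=> n x _; rewrite lee_fin.
move: c1; under eq_cvg do rewrite IJ.
by move=> c1; exact: (cvg_unique _ c1 c2).
Qed.

End polar.

Section polar.
Context {R : realType}.
Notation mu := (@lebesgue_measure R).
Local Open Scope ereal_scope.

Lemma sin_atan (s : R) : sin (atan s) = (s / Num.sqrt (1 + s ^+ 2))%R.
Proof.
have c0 : (cos (atan s) != 0)%R.
  by apply/lt0r_neq0/cos_gt0_pihalf; rewrite atan_gtNpi2 atan_ltpi2.
by rewrite -[X in (X / _)%R]atanK /tan -cos_atan divfK.
Qed.

(* Polar coordinates come from Tonelli and one-dimensional substitutions only: [y = x * s],
   then [x = t / Num.sqrt (1 + s ^+ 2)] at fixed [s], then [s = tan v]. *)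
Lemma polar_half (F : R * R -> R) :
  measurable_fun [set: @plane R] (F : @plane R -> measurableTypeR R) ->
  (forall p, 0 <= F p)%R ->
  (forall t : R, continuous (fun x => F (t * cos x, t * sin x)%R)) ->
  \int[@mu2 R]_p (F p)%:E =
  \int[mu]_t (`|t|%:E * \int[mu]_(x in `[(- (pi / 2))%R, (pi / 2)%R])
                 (F (t * cos x, t * sin x)%R)%:E).
Proof.
move=> mF F0 cF.
have mEF : measurable_fun [set: @plane R] (EFin \o F : @plane R -> \bar R).
  exact/measurable_EFinP.
have mid : measurable_fun [set: measurableTypeR R] (fun x : measurableTypeR R => x : measurableTypeR R) by [].
have mfst : measurable_fun [set: @plane R] (fun p : @plane R => p.1 : measurableTypeR R).
  exact: measurable_fst.
have msnd : measurable_fun [set: @plane R] (fun p : @plane R => p.2 : measurableTypeR R).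
  exact: measurable_snd.
pose q (s : R) := Num.sqrt (1 + s ^+ 2)%R.
have q0 s : (0 < q s)%R by rewrite sqrtr_gt0 ltr_pwDl// sqr_ge0.
have qc : continuous q.
  move=> s; apply: continuous_comp; last exact: sqrt_continuous.
  by apply: continuousD; [exact: cst_continuous|exact: exprn_continuous].
have mqi : measurable_fun [set: measurableTypeR R] (fun s => (q s)^-1%R : measurableTypeR R).
  apply: continuous_measurable_fun => s.
  by apply: cvgV; [rewrite gt_eqF|exact: qc].
transitivity (\int[mu]_x \int[mu]_y (F (x, y))%:E).
  apply: (@fubini_tonelli1 _ _ _ _ _ mu mu (EFin \o F) mEF).
  by move=> p; rewrite lee_fin.
pose K1 (p : R * R) := (`|p.1| * F (p.1, p.2 * p.1))%R.
have mK1 : measurable_fun [set: @plane R] (K1 : @plane R -> measurableTypeR R).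
  apply: measurable_funM; first exact: measurableT_comp.
  apply: (measurableT_comp mF); apply: measurable_fun_pair => //.
  exact: measurable_funM.
have step1 : \int[mu]_x \int[mu]_y (F (x, y))%:E = \int[mu]_x \int[mu]_s (K1 (x, s))%:E.
  (* At x = 0 the map sending s to x s is constant, so this null line is removed before
     substituting. *)
  have drop0 (f : R -> \bar R) : measurable_fun [set: measurableTypeR R] (f : measurableTypeR R -> \bar R) ->
      \int[mu]_x f x = \int[mu]_(x in [set: R] `\ 0%R) f x.
    move=> mf; rewrite integral_setD1//; last exact: measurable_funTS.
    by apply: measurableD => //; exact: measurable_set1.
  rewrite drop0 ?[RHS]drop0; last 2 first.
  - apply: (@measurable_fun_fubini_tonelli_F _ _ _ _ R mu (EFin \o K1)); first exact/measurable_EFinP.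
    by move=> p; rewrite lee_fin mulr_ge0.
  - apply: (@measurable_fun_fubini_tonelli_F _ _ _ _ R mu (EFin \o F)) => // p; by rewrite lee_fin.
  apply: eq_integral => x; rewrite inE/= => -[_ x0].
  rewrite (@ge0_integral_scale _ x (fun y => (F (x, y))%:E)); last 3 first.
  - exact/eqP.
  - exact: (measurableT_comp mEF).
  - by move=> y; rewrite lee_fin.
  rewrite -ge0_integralZl_EFin//; last 2 first.
  - by move=> y _; rewrite lee_fin.
  - apply: (measurableT_comp mEF); apply: measurable_fun_pair => //.
    exact: measurable_funM.
rewrite step1.
transitivity (\int[mu]_s \int[mu]_x (K1 (x, s))%:E).
  apply: (@fubini_tonelli _ _ _ _ R mu mu (EFin \o K1)); first exact/measurable_EFinP.
  by move=> p; rewrite lee_fin mulr_ge0.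
pose K2 (p : R * R) := (`|p.1| * ((1 + p.2 ^+ 2)^-1 * F (p.1 / q p.2, p.1 * (p.2 / q p.2))))%R.
have mK2 : measurable_fun [set: @plane R] (K2 : @plane R -> measurableTypeR R).
  have mq2 : measurable_fun [set: @plane R] (fun p : @plane R => (q p.2)^-1%R : measurableTypeR R).
    exact: (measurableT_comp mqi msnd).
  apply: measurable_funM; first exact: measurableT_comp.
  apply: measurable_funM.
    exact: (measurableT_comp (continuous_measurable_fun continuous_oneDsqrV) msnd).
  apply: (measurableT_comp mF); apply: measurable_fun_pair; first exact: measurable_funM.
  by apply: measurable_funM => //; exact: measurable_funM.
have step2 s : \int[mu]_x (K1 (x, s))%:E = \int[mu]_t (K2 (t, s))%:E.
  rewrite (@ge0_integral_scale _ (q s)^-1 (fun y => (K1 (y, s))%:E)); last 3 first.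
  - by rewrite invr_eq0 gt_eqF.
  - by apply/measurable_EFinP; exact: (measurable_fun_pair1 s mK1).
  - by move=> y; rewrite lee_fin mulr_ge0.
  rewrite -ge0_integralZl_EFin//; last 2 first.
  - by move=> y _; rewrite lee_fin mulr_ge0.
  - apply/measurable_EFinP; apply: (measurableT_comp (measurable_fun_pair1 s mK1)).
    exact: measurable_funM.
  apply: eq_integral => t _; rewrite -EFinM; congr EFin; rewrite /K1 /K2/=.
  have qs : (q s ^+ 2 = 1 + s ^+ 2)%R by rewrite sqr_sqrtr// addr_ge0// sqr_ge0.
  have -> : (s * (t / q s) = t * (s / q s))%R by rewrite mulrCA.
  have n1 : (`|(q s)^-1| = (q s)^-1)%R by rewrite gtr0_norm// invr_gt0.
  by rewrite normrM n1 -qs -exprVn expr2; ring.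
under eq_integral do rewrite step2.
transitivity (\int[mu]_t \int[mu]_s (K2 (t, s))%:E).
  apply/esym/(@fubini_tonelli _ _ _ _ R mu mu (EFin \o K2)); first exact/measurable_EFinP.
  by move=> p; rewrite lee_fin mulr_ge0// mulr_ge0// invr_ge0 addr_ge0// sqr_ge0.
apply: eq_integral => t _.
rewrite -ge0_integral_atan; [|exact: cF|by move=> x; exact: F0].
rewrite -ge0_integralZl_EFin//; last 2 first.
- by move=> s _; rewrite lee_fin mulr_ge0// invr_ge0 addr_ge0// sqr_ge0.
- apply/measurable_EFinP; apply: measurable_funM.
    by apply: continuous_measurable_fun; exact: continuous_oneDsqrV.
  have mat : measurable_fun [set: measurableTypeR R] (@atan R : _ -> measurableTypeR R).
    by apply: continuous_measurable_fun => x; exact: continuous_atan.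
  apply: (measurableT_comp mF); apply: measurable_fun_pair.
    apply: measurable_funM => //.
    exact: (measurableT_comp (continuous_measurable_fun (@continuous_cos R)) mat).
  apply: measurable_funM => //.
  exact: (measurableT_comp (continuous_measurable_fun (@continuous_sin R)) mat).
apply: eq_integral => s _; rewrite -EFinM; congr EFin; rewrite /K2/=.
by rewrite cos_atan sin_atan.
Qed.

End polar.

Section polar.
Context {R : realType}.
Notation mu := (@lebesgue_measure R).

Lemma ge0_integral_itv_cat (a b c : R) (f : R -> \bar R) : a <= b <= c ->
  measurable_fun [set: measurableTypeR R] (f : measurableTypeR R -> \bar R) ->
  (forall x, 0 <= f x)%E ->
  (\int[mu]_(x in `[a, b]) f x + \int[mu]_(x in `[b, c]) f x =
   \int[mu]_(x in `[a, c]) f x)%E.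
Proof.
move=> /andP[ab bc] mf f0.
rewrite -(@integral_itv_bndo_bndc _ _ b); last exact: measurable_funTS.
rewrite -ge0_integral_setU//=.
- by rewrite -itv_bndbnd_setU ?bnd_simp.
- exact: measurable_funTS.
- by apply/disj_setPS => x /= []; rewrite !in_itv/= => /andP[_ xb] /andP[bx _];
    move: (lt_le_trans xb bx); rewrite ltxx.
Qed.

Lemma ge0_integral_itv_shift (a b c : R) (f : R -> \bar R) :
  measurable_fun [set: measurableTypeR R] (f : measurableTypeR R -> \bar R) ->
  (forall x, 0 <= f x)%E ->
  (\int[mu]_(x in `[a, b]) f (x + c)%R = \int[mu]_(x in `[(a + c)%R, (b + c)%R]) f x)%E.
Proof.
move=> mf f0; rewrite integral_mkcond [RHS]integral_mkcond.
rewrite [RHS](@ge0_integral_affine _ 1 c) ?mul1e//; last 2 first.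
- apply: (measurable_restrictT f (measurable_itv _)).1 => //; exact: measurable_funTS.
- by move=> x; rewrite erestrict_ge0.
apply: eq_integral => x _; rewrite mul1r !patchE.
congr (if _ then _ else _).
by apply/idP/idP; rewrite !inE/= !in_itv/= !lerD2r.
Qed.

(** The half-turn and its translate by pi tile [-pi/2, 3 pi/2]; the part below 0 is moved by one
    period to [3 pi/2, 2 pi]. *)
Lemma ge0_integral_period (g : R -> R) : continuous g -> (forall x, 0 <= g x) ->
  (forall x, g (x + 2 * pi) = g x) ->
  (\int[mu]_(x in `[(- (pi / 2))%R, (pi / 2)%R]) (g x)%:E +
   \int[mu]_(x in `[(- (pi / 2))%R, (pi / 2)%R]) (g (x + pi)%R)%:E =
   \int[mu]_(x in `[0%R, (2 * pi)%R]) (g x)%:E)%E.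
Proof.
move=> cg g0 gp.
have mg : measurable_fun [set: measurableTypeR R] (fun x => (g x)%:E).
  by apply/measurable_EFinP; exact: continuous_measurable_fun.
have g0' x : (0 <= (g x)%:E)%E by rewrite lee_fin.
have p0 := @pi_gt0 R.
rewrite (@ge0_integral_itv_shift _ _ pi (fun x => (g x)%:E))//.
have -> : (- (pi / 2) + pi = pi / 2 :> R) by field.
have -> : (pi / 2 + pi = 3 / 2 * pi :> R) by field.
rewrite -(@ge0_integral_itv_cat _ 0 (pi / 2))//; last by lra.
rewrite -[RHS](@ge0_integral_itv_cat _ (3 / 2 * pi) _)//; last by lra.
rewrite -(@ge0_integral_itv_cat 0 (pi / 2) (3 / 2 * pi))//; last by lra.
rewrite [RHS]addeC addeA; congr (_ + _ + _)%E.
transitivity (\int[mu]_(x in `[(- (pi / 2))%R, 0%R]) (g (x + 2 * pi)%R)%:E)%E.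
  by apply: eq_integral => x _; rewrite gp.
rewrite (@ge0_integral_itv_shift _ _ (2 * pi) (fun x => (g x)%:E))// add0r.
by have -> : - (pi / 2) + 2 * pi = 3 / 2 * pi :> R by field.
Qed.

Lemma measurable_polar_map :
  measurable_fun [set: @plane R] (fun z : @plane R => (z.1 * cos z.2, z.1 * sin z.2) : @plane R).
Proof.
have mfst : measurable_fun [set: @plane R] (fun p : @plane R => p.1 : measurableTypeR R).
  exact: measurable_fst.
have msnd : measurable_fun [set: @plane R] (fun p : @plane R => p.2 : measurableTypeR R).
  exact: measurable_snd.
apply: measurable_fun_pair; apply: measurable_funM => //.
  exact: (measurableT_comp (continuous_measurable_fun (@continuous_cos R)) msnd).
exact: (measurableT_comp (continuous_measurable_fun (@continuous_sin R)) msnd).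
Qed.

Lemma measurable_arc_integral (F : R * R -> R) (a b : R) :
  measurable_fun [set: @plane R] (F : @plane R -> measurableTypeR R) ->
  (forall p, 0 <= F p) ->
  measurable_fun [set: measurableTypeR R] (fun t : R =>
    (\int[mu]_(x in `[a, b]) (F (t * cos x, t * sin x)%R)%:E)%E).
Proof.
move=> mF F0.
pose K (z : R * R) := F (z.1 * cos z.2, z.1 * sin z.2) * \1_`[a, b] z.2.
have mK : measurable_fun [set: @plane R] (K : @plane R -> measurableTypeR R).
  apply: measurable_funM; first exact: (measurableT_comp mF measurable_polar_map).
  have msnd : measurable_fun [set: @plane R] (fun p : @plane R => p.2 : measurableTypeR R).
    exact: measurable_snd.
  apply: (measurableT_comp _ msnd); exact: measurable_indic.
rewrite (_ : (fun t => _) = (fun t => \int[mu]_x (K (t, x))%:E)%E); last first.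
  apply/funext => t; rewrite integral_mkcond; apply: eq_integral => x _.
  rewrite patchE /K/= indicE; case: (x \in _); by rewrite ?mulr1 ?mulr0.
apply: (@measurable_fun_fubini_tonelli_F _ _ _ _ R mu (EFin \o K)).
  exact/measurable_EFinP.
by move=> p; rewrite lee_fin mulr_ge0.
Qed.

(** [polar_half] describes points by a signed [t] and an angle in a half-turn. A negative [t] is the
    radius [|t|] with the angle increased by pi, so folding the line of [t] completes the circle of
    angles. *)
Lemma polar (F : R * R -> R) :
  measurable_fun [set: @plane R] (F : @plane R -> measurableTypeR R) ->
  (forall p, 0 <= F p) ->
  (forall t : R, continuous (fun x => F (t * cos x, t * sin x))) ->
  (\int[@mu2 R]_p (F p)%:E =
  \int[mu]_(t in `[0%R, +oo[) (t%:E * \int[mu]_(x in `[0%R, (2 * pi)%R])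
                 (F (t * cos x, t * sin x)%R)%:E))%E.
Proof.
move=> mF F0 cF.
have mEF : measurable_fun [set: @plane R] (EFin \o F : @plane R -> \bar R).
  exact/measurable_EFinP.
rewrite (polar_half mF F0 cF).
pose G t := (\int[mu]_(x in `[(- (pi / 2))%R, (pi / 2)%R]) (F (t * cos x, t * sin x)%R)%:E)%E.
have mG : measurable_fun [set: measurableTypeR R] (G : measurableTypeR R -> \bar R).
  exact: measurable_arc_integral.
have G0 t : (0 <= G t)%E by apply: integral_ge0 => x _; rewrite lee_fin.
have mGN : measurable_fun [set: measurableTypeR R] (fun t : R => G (- t)).
  exact: (measurableT_comp mG).
have mabs (H : R -> \bar R) : measurable_fun [set: measurableTypeR R] H ->
    measurable_fun [set: measurableTypeR R] (fun t : R => `|t|%:E * H t)%E.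
  by move=> mH; apply: emeasurable_funM => //; apply/measurable_EFinP; exact: normr_measurable.
have abs0 t s : (0 <= `|t|%:E * G s)%E by rewrite mule_ge0// lee_fin.
transitivity (\int[mu]_(t in `[0%R, +oo[) (`|t|%:E * G t) +
              \int[mu]_(t in `[0%R, +oo[) (`|t|%:E * G (- t)%R))%E.
  rewrite [X in (_ + X)%E]ge0_integration_by_substitution0; last 2 first.
  - exact: mabs.
  - by move=> r; exact: abs0.
  under [X in (_ + X)%E]eq_integral do rewrite normrN opprK.
  have mA : measurable (`]-oo, 0%R] `\ 0%R : set (measurableTypeR R)).
    by apply: measurableD => //; exact: measurable_set1.
  rewrite -(@integral_setD1 _ _ 0%R `]-oo, 0%R])//; last first.
    by apply: measurable_funTS; exact: mabs.
  rewrite -ge0_integral_setU//=.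
  - congr (integral mu _ _); apply/seteqP; split => // x _.
    have [x0|x0] := leP 0 x; first by left; rewrite /= in_itv/= x0.
    right; split; first by rewrite /= in_itv/= ltW.
    by move=> /= x0'; move: x0; rewrite x0' ltxx.
  - by apply: measurable_funTS; exact: mabs.
  - apply/disj_setPS => x /= [] ; rewrite !in_itv/= andbT => x0 [x0' nx0].
    by apply: nx0; apply/eqP; rewrite eq_le x0 x0'.
rewrite -ge0_integralD//; last 2 first.
- by apply: measurable_funTS; exact: mabs.
- by apply: measurable_funTS; exact: mabs.
apply: eq_integral => t; rewrite inE/= in_itv/= andbT => t0.
rewrite ger0_norm// -muleDr//; last by rewrite ge0_adde_def// inE.

congr (_ * _)%E.
rewrite -(@ge0_integral_period (fun x => F (t * cos x, t * sin x)))//; last first.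
  by move=> x; rewrite mulr_natl cosD2pi sinD2pi.
congr (_ + _)%E; rewrite /G; apply: eq_integral => x _.
by rewrite cosDpi sinDpi !mulrN !mulNr.
Qed.

End polar.

Section polar_disk.
Context {R : realType}.
Notation mu := (@lebesgue_measure R).

Lemma radius_continuous : continuous (@Defs.radius R).
Proof.
apply: (continuous_compose _ (@sqrt_continuous R)).
by apply: continuous_funD; apply: continuous_funX; [exact: continuous_fst|exact: continuous_snd].
Qed.

Lemma radius_ge0 (p : R * R) : 0 <= Defs.radius p.
Proof. exact: sqrtr_ge0. Qed.

Lemma radius_polar (t x : R) : Defs.radius (t * cos x, t * sin x) = `|t|.
Proof.
by rewrite /Defs.radius/= !exprMn -mulrDr cos2Dsin2 mulr1 sqrtr_sqr.
Qed.

Lemma measurable_radius :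
  measurable_fun [set: @plane R] (@Defs.radius R : @plane R -> measurableTypeR R).
Proof. exact: (continuous_measurable_plane radius_continuous). Qed.

Lemma measurable_disk : measurable (@disk R : set (@plane R)).
Proof.
rewrite (_ : @disk R = [set: @plane R] `&` (@Defs.radius R) @^-1` `]-oo, 1[%classic).
  by apply: measurable_radius => //; exact: measurable_itv.
by rewrite setTI; apply/seteqP; split=> p /=; rewrite in_itv.
Qed.

Lemma disk_le1 (p : R * R) : disk p -> `|p.1| <= 1 /\ `|p.2| <= 1.
Proof.
rewrite /disk /= => p1.
have h (a b : R) : Num.sqrt (a ^+ 2 + b ^+ 2) < 1 -> `|a| <= 1.
  move=> ab; apply: le_trans (ltW ab); rewrite -sqrtr_sqr ler_sqrt ?lerDl ?sqr_ge0//.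
  by rewrite addr_ge0// sqr_ge0.
by split; [exact: h p1|apply: (h _ p.1); rewrite addrC].
Qed.

Lemma mu2_disk_fin : (@mu2 R (@disk R) < +oo)%E.
Proof.
pose B : set (@plane R) := (`[(-1)%R, 1%R] : set (measurableTypeR R)) `*` (`[(-1)%R, 1%R] : set (measurableTypeR R)).
have mB : measurable B by apply: measurableX; exact: measurable_itv.
apply: (@le_lt_trans _ _ (@mu2 R B)).
  apply: le_measure; rewrite ?inE//; first exact: measurable_disk.
  move=> p /disk_le1[h1 h2]; split=> /=; rewrite in_itv/= -ler_norml//.
have -> : (@mu2 R B = mu `[(-1)%R, 1%R]%classic * mu `[(-1)%R, 1%R]%classic)%E.
  by apply: product_measure1E; exact: measurable_itv.
rewrite !lebesgue_measure_itv/= lte_fin; case: ifP => _; last by rewrite mul0e ltry.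
by rewrite -EFinD -EFinM ltry.
Qed.

Lemma bounded_integrable_disk (F : R * R -> R) (K : R) :
  measurable_fun (@disk R : set (@plane R)) (F : @plane R -> measurableTypeR R) ->
  (forall p, disk p -> `|F p| <= K) ->
  (@mu2 R).-integrable (@disk R : set (@plane R)) (EFin \o F).
Proof.
move=> mF FK; apply: measurable_bounded_integrable => //.
- exact: measurable_disk.
- exact: mu2_disk_fin.
- by exists K; split; [exact: num_real|move=> x Kx p /FK /le_trans; apply; exact: ltW].
Qed.

(** Continuity is asked along circles only, because the densities in view jump across r = a.
    Integrability of the radial density belongs to the conclusion so that [polar_disk] can
    subtract. *)
Lemma polar_disk_ge0 (F : R * R -> R) (K : R) :
  measurable_fun [set: @plane R] (F : @plane R -> measurableTypeR R) ->
  (forall p, disk p -> 0 <= F p <= K) ->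
  (forall t : R, `|t| < 1 -> continuous (fun x => F (t * cos x, t * sin x))) ->
  (@mu2 R).-integrable (@disk R : set (@plane R)) (EFin \o F) /\
  mu.-integrable `[0, 1[ (fun t => (t * \int[mu]_(x in `[0, 2 * pi]) F (t * cos x, t * sin x))%:E) /\
  \int[@mu2 R]_(p in @disk R) F p =
  \int[mu]_(t in `[0, 1[) (t * \int[mu]_(x in `[0, 2 * pi]) F (t * cos x, t * sin x)).
Proof.
move=> mF F0 cF.
have iF : (@mu2 R).-integrable (@disk R : set (@plane R)) (EFin \o F).
  apply: (@bounded_integrable_disk F K); first exact: measurable_funTS.
  by move=> p /F0 /andP[Fp0 FpK]; rewrite ger0_norm.
split=> //.
pose F' (p : R * R) := F p * \1_(@disk R) p.
have mF' : measurable_fun [set: @plane R] (F' : @plane R -> measurableTypeR R).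
  by apply: measurable_funM => //; apply: measurable_indic; exact: measurable_disk.
have F'0 p : 0 <= F' p.
  rewrite /F' indicE; case: (boolP (p \in _)); rewrite ?mulr0// inE mulr1.
  by move=> /F0/andP[].
have F'E t x : F' (t * cos x, t * sin x) = F (t * cos x, t * sin x) * (nat_of_bool (`|t| < 1)%R)%:R.
  rewrite /F' indicE; congr (_ * (nat_of_bool _)%:R).
  by apply/idP/idP; rewrite inE /disk/= radius_polar.
have cF' t : continuous (fun x => F' (t * cos x, t * sin x)).
  have -> : (fun x => F' (t * cos x, t * sin x)) =
      (fun x => F (t * cos x, t * sin x) * (nat_of_bool (`|t| < 1)%R)%:R).
    by apply/funext => x; rewrite F'E.
  have [t1|t1] := ltP `|t| 1.
    by apply: continuous_funM; [exact: cF|exact: continuous_cst].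
  by under eq_fun do rewrite mulr0; exact: continuous_cst.
have inner t : 0 <= t < 1 -> (\int[mu]_(x in `[0%R, (2 * pi)%R]) (F' (t * cos x, t * sin x))%:E =
    (\int[mu]_(x in `[0, 2 * pi]) F (t * cos x, t * sin x))%:E)%E.
  move=> /andP[t0 t1]; have t1' : `|t| < 1 by rewrite ger0_norm.
  rewrite /Rintegral fineK; first by apply: eq_integral => x _; rewrite F'E t1' mulr1.
  apply: integrable_fin_num => //.
  apply: continuous_compact_integrable; first exact: segment_compact.
  by apply: continuous_subspaceT; exact: cF.
have E : (\int[@mu2 R]_(p in @disk R) (F p)%:E =
  \int[mu]_(t in `[0%R, 1%R[)
     (t * \int[mu]_(x in `[0, 2 * pi]) F (t * cos x, t * sin x))%:E)%E.
  transitivity (\int[@mu2 R]_p (F' p)%:E)%E.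
    rewrite integral_mkcond; apply: eq_integral => p _; rewrite patchE /F' indicE.
    by case: (p \in _); rewrite ?mulr1 ?mulr0.
  rewrite polar// integral_mkcond [RHS]integral_mkcond; apply: eq_integral => t _.
  rewrite !patchE !mem_setE !in_itv/= andbT.
  have [t0|//] := leP 0 t; have [t1|t1] := ltP t 1.
    by rewrite inner ?t0// EFinM.
  under eq_integral do rewrite F'E ger0_norm// ltNge t1/= mulr0.
  by rewrite integral0 mule0.
split; last by rewrite /Rintegral E.
apply/integrableP; split.
  apply/measurable_EFinP; apply: measurable_funM => //.
  pose J (t : R) := (\int[mu]_(x in `[0%R, (2 * pi)%R]) (F' (t * cos x, t * sin x))%:E)%E.
  have mJ : measurable_fun [set: measurableTypeR R] (fun t => fine (J t) : measurableTypeR R).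
    by apply: measurableT_comp => //; exact: measurable_arc_integral.
  apply: (@eq_measurable_fun _ _ _ _ _ (fun t : measurableTypeR R => fine (J t) : measurableTypeR R)).
    by move=> t; rewrite inE/= in_itv/= => t01; rewrite /J inner.
  exact: measurable_funTS.
apply: (@le_lt_trans _ _ (\int[mu]_(t in `[0%R, 1%R[) (t * \int[mu]_(x in `[0, 2 * pi]) F (t * cos x, t * sin x))%:E)%E).
  rewrite le_eqVlt; apply/orP; left; apply/eqP; apply: eq_integral.
  move=> t; rewrite inE/= in_itv/= => /andP[t0 t1].
  rewrite /=; congr EFin; apply: ger0_norm; rewrite mulr_ge0//; apply: Rintegral_ge0 => x _.
  by have /andP[] := F0 (t * cos x, t * sin x) ltac:(by rewrite /disk/= radius_polar ger0_norm).
by rewrite -E; have := integrable_fin_num measurable_disk iF; rewrite ge0_fin_numE//;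
  apply: integral_ge0 => p /F0/andP[? _]; rewrite lee_fin.
Qed.

Lemma polar_disk (F : R * R -> R) (K : R) :
  measurable_fun [set: @plane R] (F : @plane R -> measurableTypeR R) ->
  (forall p, disk p -> `|F p| <= K) ->
  (forall t : R, `|t| < 1 -> continuous (fun x => F (t * cos x, t * sin x))) ->
  \int[@mu2 R]_(p in @disk R) F p =
  \int[mu]_(t in `[0, 1[) (t * \int[mu]_(x in `[0, 2 * pi]) F (t * cos x, t * sin x)).
Proof.
move=> mF FK cF.
have K0 : 0 <= K.
  apply: le_trans (FK (0, 0) _); first exact: normr_ge0.
  by rewrite /disk/= /Defs.radius/= expr0n/= addr0 sqrtr0.
(* Adding the bound [K] makes the density nonnegative; the constant is treated by the same lemma and
   subtracted again. *)
have [i1 [j1 e1]] := @polar_disk_ge0 (fun p => F p + K) (K + K) ltac:(exact: measurable_funD)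
   ltac:(by move=> p /FK; rewrite ler_norml; lra)
   ltac:(by move=> t t1; apply: continuous_funD; [exact: cF|exact: continuous_cst]).
have [i2 [j2 e2]] := @polar_disk_ge0 (fun p => K) K ltac:(by [])
   ltac:(by move=> p _; rewrite K0 lexx) ltac:(by move=> t t1; exact: continuous_cst).
have -> : \int[@mu2 R]_(p in @disk R) F p =
    \int[@mu2 R]_(p in @disk R) (F p + K) - \int[@mu2 R]_(p in @disk R) K.
  rewrite -RintegralB//; last exact: measurable_disk.
  by apply: eq_Rintegral => p _; rewrite addrK.
rewrite e1 e2 -RintegralB//.
apply: eq_Rintegral => t; rewrite inE/= in_itv/= => /andP[t0 t1].
rewrite -mulrBr; congr (_ * _).
have ci (g : R -> R) : continuous g -> mu.-integrable `[0, 2 * pi] (EFin \o g).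
  move=> cg; apply: continuous_compact_integrable; first exact: segment_compact.
  exact: continuous_subspaceT.
have t1' : `|t| < 1 by rewrite ger0_norm.
rewrite -RintegralB//; [|apply: ci..].
- by apply: eq_Rintegral => x _; rewrite addrK.
- by apply: continuous_funD; [exact: cF|exact: continuous_cst].
- exact: continuous_cst.
Qed.

(** The gradient of the solution is a pointwise limit whose measurability is known on the disk only,
    hence the extension by zero. *)
Lemma polar_disk_on (F : R * R -> R) (K : R) :
  measurable_fun (@disk R : set (@plane R)) (F : @plane R -> measurableTypeR R) ->
  (forall p, disk p -> `|F p| <= K) ->
  (forall t : R, `|t| < 1 -> continuous (fun x => F (t * cos x, t * sin x))) ->
  \int[@mu2 R]_(p in @disk R) F p =
  \int[mu]_(t in `[0, 1[) (t * \int[mu]_(x in `[0, 2 * pi]) F (t * cos x, t * sin x)).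
Proof.
move=> mF FK cF; pose F' := F \_ (@disk R).
have F'E p : disk p -> F' p = F p by move=> dp; rewrite /F' patchE mem_set.
have circ (t x : R) : `|t| < 1 -> F' (t * cos x, t * sin x) = F (t * cos x, t * sin x).
  by move=> t1; rewrite F'E// /disk/= radius_polar.
transitivity (\int[@mu2 R]_(p in @disk R) F' p).
  by apply: eq_Rintegral => p /set_mem dp; rewrite F'E.
rewrite (@polar_disk F' K).
- apply: eq_Rintegral => t; rewrite inE/= in_itv/= => /andP[t0 t1]; congr (_ * _).
  by apply: eq_Rintegral => x _; rewrite circ// ger0_norm.
- exact: (measurable_restrictT F measurable_disk).1.
- by move=> p dp; rewrite F'E// FK.
- move=> t t1; have -> : (fun x => F' (t * cos x, t * sin x)) = (fun x => F (t * cos x, t * sin x)).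
    by apply/funext => x; rewrite circ.
  exact: cF.
Qed.

End polar_disk.

(** * Integration by parts, and Fubini for continuous functions on rectangles *)

Section tools.
Context {R : realType}.
Notation mu := (@lebesgue_measure R).

Lemma is_derive_continuous (f : R -> R) (x f' : R) : is_derive x 1 f f' -> {for x, continuous f}.
Proof.
by move=> [df _]; apply: differentiable_continuous; exact/derivable1_diffP.
Qed.

Lemma Rintegration_by_parts_closed (F G f g : R -> R) (a b : R) : a < b ->
  (forall t, a <= t <= b -> is_derive t 1 F (f t)) ->
  (forall t, a <= t <= b -> is_derive t 1 G (g t)) ->
  (forall t, a <= t <= b -> {for t, continuous f}) ->
  (forall t, a <= t <= b -> {for t, continuous g}) ->
  \int[mu]_(t in `[a, b]) (F t * g t) =
  (F b * G b - F a * G a) - \int[mu]_(t in `[a, b]) (f t * G t).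
Proof.
move=> ab dF dG cf cg.
have within (h : R -> R) : (forall t, a <= t <= b -> {for t, continuous h}) ->
    {within `[a, b], continuous h}.
  by move=> ch; apply: continuous_in_subspaceT => t; rewrite inE/= in_itv/=; exact: ch.
have LR (H h : R -> R) : (forall t, a <= t <= b -> is_derive t 1 H (h t)) ->
    derivable_oo_LRcontinuous H a b.
  move=> dH; split.
  - move=> t; rewrite in_itv/= => /andP[t1 t2].
    by have [] := dH t; rewrite ?(ltW t1) ?(ltW t2).
  - by apply: cvg_at_right_filter; apply: (is_derive_continuous (dH a _)); rewrite lexx ltW.
  - by apply: cvg_at_left_filter; apply: (is_derive_continuous (dH b _)); rewrite lexx ltW.
have D1 (H h : R -> R) : (forall t, a <= t <= b -> is_derive t 1 H (h t)) ->
    {in `]a, b[, H^`()%classic =1 h}.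
  move=> dH t; rewrite in_itv/= => /andP[t1 t2]; rewrite derive1E.
  by have [_ ->] := dH t ltac:(by rewrite (ltW t1) (ltW t2)).
apply: Rintegration_by_parts => //.
- exact: within.
- exact: LR.
- exact: D1.
- exact: within.
- exact: LR.
- exact: D1.
Qed.

Lemma continuous_integrable_itv (g : R -> R) (a b : R) : continuous g ->
  mu.-integrable `[a, b] (EFin \o g).
Proof.
move=> cg; apply: continuous_compact_integrable; first exact: segment_compact.
exact: continuous_subspaceT.
Qed.

Section rectangle.
Variables (a b c d : R) (G : R * R -> R).
Hypothesis cG : continuous G.

Let rect : set (@plane R) :=
  (`[a, b] : set (measurableTypeR R)) `*` (`[c, d] : set (measurableTypeR R)).

Let mrect : measurable rect.
Proof. by apply: measurableX; exact: measurable_itv. Qed.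

Let H (p : R * R) := G p * \1_rect p.

Let mH : measurable_fun [set: @plane R] (H : @plane R -> measurableTypeR R).
Proof.
apply: measurable_funM; first exact: continuous_measurable_plane.
exact: measurable_indic.
Qed.

Let HE (t x : R) : H (t, x) = G (t, x) * \1_`[a, b] t * \1_`[c, d] x.
Proof.
rewrite /H -mulrA; congr (_ * _); rewrite !indicE -natrM mulnb; congr (nat_of_bool _)%:R.
by apply/idP/andP; rewrite !inE.
Qed.

Let iH : (@mu2 R).-integrable [set: @plane R] (EFin \o H).
Proof.
have crect : compact (`[a, b] `*` `[c, d] : set (R * R)).
  by apply: compact_setX; exact: segment_compact.
have [K [_ KG]] : bounded_set (G @` (`[a, b] `*` `[c, d])).
  apply: compact_bounded; apply: continuous_compact crect.
  exact: continuous_subspaceT.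
have {}KG p : rect p -> `|G p| <= K + 1.
  by move=> rp; apply: (KG (K + 1)); rewrite ?ltrDl//; exists p.
have -> : EFin \o H = (EFin \o G) \_ rect.
  apply/funext => p; rewrite patchE /= /H indicE.
  by case: (p \in _); rewrite ?mulr1 ?mulr0.
rewrite -integrable_mkcond//.
apply: measurable_bounded_integrable => //.
- rewrite (_ : @mu2 R rect = mu `[a, b]%classic * mu `[c, d]%classic)%E; last first.
    by apply: product_measure1E; exact: measurable_itv.
  by rewrite !lebesgue_measure_itv/=; case: ifP; case: ifP => _ _;
    rewrite ?mul0e ?mule0 ?ltry// -!EFinD -EFinM ltry.
- by apply: measurable_funTS; exact: continuous_measurable_plane.
- by exists (K + 1); split; [exact: num_real|move=> x Kx p /KG /le_trans; apply; exact: ltW].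
Qed.

Let sec1 : (fun t : R => \int[mu]_x (H (t, x))%:E)%E =
   (fun t : R => (\int[mu]_(x in `[c, d]) G (t, x))%:E) \_ `[a, b].
Proof.
apply/funext => t; rewrite patchE; case: ifPn => tab.
  rewrite /Rintegral fineK.
    rewrite [RHS]integral_mkcond; apply: eq_integral => x _.
    by rewrite patchE HE [\1_`[a, b] _]indicE tab mulr1 indicE; case: (x \in _); rewrite ?mulr1 ?mulr0.
  apply: integrable_fin_num => //; apply: continuous_integrable_itv.
  apply: (continuous_compose _ cG).
  exact: (continuous_pair (@continuous_cst _ _ t) (@continuous_idfun _)).
rewrite integral0_eq// => x _; rewrite HE [\1_`[a, b] _]indicE (negbTE tab).
by rewrite mulr0 mul0r.
Qed.

Let sec2 : (fun x : R => \int[mu]_t (H (t, x))%:E)%E =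
   (fun x : R => (\int[mu]_(t in `[a, b]) G (t, x))%:E) \_ `[c, d].
Proof.
apply/funext => x; rewrite patchE; case: ifPn => xcd.
  rewrite /Rintegral fineK.
    rewrite [RHS]integral_mkcond; apply: eq_integral => t _.
    by rewrite patchE HE [\1_`[c, d] _]indicE xcd mulr1 indicE; case: (t \in _); rewrite ?mulr1 ?mulr0.
  apply: integrable_fin_num => //; apply: continuous_integrable_itv.
  apply: (continuous_compose _ cG).
  exact: (continuous_pair (@continuous_idfun _) (@continuous_cst _ _ x)).
rewrite integral0_eq// => t _; rewrite HE [\1_`[c, d] _]indicE (negbTE xcd).
by rewrite mulr0.
Qed.

Lemma continuous_integrable_Rintegral :
  mu.-integrable `[a, b] (fun t => (\int[mu]_(x in `[c, d]) G (t, x))%:E).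
Proof.
rewrite integrable_mkcond// -sec1.
exact: (@integrable_fubini_F _ _ _ _ _ mu mu (EFin \o H) iH).
Qed.

Lemma continuous_Fubini :
  \int[mu]_(t in `[a, b]) \int[mu]_(x in `[c, d]) G (t, x) =
  \int[mu]_(x in `[c, d]) \int[mu]_(t in `[a, b]) G (t, x).
Proof.
rewrite [LHS]/Rintegral [RHS]/Rintegral; congr fine.
rewrite integral_mkcond [RHS]integral_mkcond -sec1 -sec2.
exact: (@Fubini _ _ _ _ _ mu mu (EFin \o H) iH).
Qed.

End rectangle.

End tools.

(** * Green's formula *)

Section green.
Context {R : realType}.
Notation mu := (@lebesgue_measure R).

Lemma diff_gradE (f : R * R -> R) (p v : R * R) : differentiable f p ->
  'd f p v = v.1 * 'D_((1, 0) : R * R) f p + v.2 * 'D_((0, 1) : R * R) f p.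
Proof.
move=> df; rewrite !deriveE//.
have vE : v = v.1 *: (1, 0) + v.2 *: (0, 1).
  case: v => a b /=; transitivity (a * 1 + b * 0, a * 0 + b * 1); last by [].
  by congr pair; ring.
by rewrite {1}vE linearD !linearZ.
Qed.

Lemma is_derive_along (f : R * R -> R) (u v : R -> R) (t du dv : R) :
  differentiable f (u t, v t) -> is_derive t 1 u du -> is_derive t 1 v dv ->
  is_derive t 1 (fun s => f (u s, v s))
    (du * 'D_((1, 0) : R * R) f (u t, v t) + dv * 'D_((0, 1) : R * R) f (u t, v t)).
Proof.
move=> df [du1 duE] [dv1 dvE].
have du' : differentiable u t := (derivable1_diffP u t).1 du1.
have dv' : differentiable v t := (derivable1_diffP v t).1 dv1.
have dp : differentiable (fun s => (u s, v s)) t by exact: differentiable_pair.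
have dc : differentiable (f \o (fun s => (u s, v s))) t by exact: differentiable_comp.
have -> : (fun s => f (u s, v s)) = f \o (fun s => (u s, v s)) by [].
split; first exact/derivable1_diffP.
rewrite deriveE// diff_comp//= diff_pair//= diff_gradE//=.
by rewrite -!deriveE// duE dvE.
Qed.

(** Real and imaginary part of (A - i B) e^(i n x). With [A] and [B] free, one computation serves
    both the cosine and the sine mode. *)
Definition trigc (A B : R) (n : nat) (x : R) := A * cos (n%:R * x) + B * sin (n%:R * x).
Definition trigs (A B : R) (n : nat) (x : R) := A * sin (n%:R * x) - B * cos (n%:R * x).

Lemma is_derive_mul_natr (n : nat) (x : R) : is_derive x 1 (fun y : R => n%:R * y) n%:R.
Proof.
have -> : (fun y : R => n%:R * y) = n%:R *: (@idfun R) by [].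
by apply: is_derive_eq; rewrite /GRing.scale/= mulr1.
Qed.

Lemma is_derive_trigc (A B : R) n (x : R) : is_derive x 1 (trigc A B n) (- (n%:R * trigs A B n x)).
Proof.
have h := is_derive_mul_natr n x.
have hc := is_derive1_comp (is_derive_cos (n%:R * x)) h.
have hs := is_derive1_comp (is_derive_sin (n%:R * x)) h.
have -> : trigc A B n = A *: (cos \o (fun y => n%:R * y)) + B *: (sin \o (fun y => n%:R * y)) by [].
apply: is_derive_eq (is_deriveD (is_deriveZ A hc) (is_deriveZ B hs)) _.
by rewrite /trigs /GRing.scale/=; ring.
Qed.

Lemma is_derive_trigs (A B : R) n (x : R) : is_derive x 1 (trigs A B n) (n%:R * trigc A B n x).
Proof.
have h := is_derive_mul_natr n x.
have hc := is_derive1_comp (is_derive_cos (n%:R * x)) h.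
have hs := is_derive1_comp (is_derive_sin (n%:R * x)) h.
have -> : trigs A B n = A *: (sin \o (fun y => n%:R * y)) - B *: (cos \o (fun y => n%:R * y)) by [].
apply: is_derive_eq (is_deriveB (is_deriveZ A hs) (is_deriveZ B hc)) _.
by rewrite /trigc /GRing.scale/=; ring.
Qed.

Lemma continuous_trigc A B n : continuous (trigc A B n).
Proof. by move=> x; exact: (is_derive_continuous (is_derive_trigc A B n x)). Qed.

Lemma continuous_trigs A B n : continuous (trigs A B n).
Proof. by move=> x; exact: (is_derive_continuous (is_derive_trigs A B n x)). Qed.

Lemma natr_mul2pi (n : nat) : n%:R * (2 * pi) = 0 + (pi *+ 2) *+ n :> R.
Proof. by rewrite add0r -[pi *+ 2]mulr_natl -[RHS]mulr_natl. Qed.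

Lemma trigs_2pi A B n : trigs A B n (2 * pi) = trigs A B n 0.
Proof.
by rewrite /trigs natr_mul2pi mulr0 (periodicn (@sinD2pi R)) (periodicn (@cosD2pi R)).
Qed.

Section annulus.
Variables (f : R * R -> R) (cf : Ck 1 f) (A B : R) (n : nat) (n0 : (0 < n)%N).
Variables (W W' : R -> R) (b d : R) (bd : b < d).
Hypothesis dW : forall t, b <= t <= d -> is_derive t 1 W (W' t).
Hypothesis cW' : forall t, b <= t <= d -> {for t, continuous W'}.

Let fx := 'D_((1, 0) : R * R) f.
Let fy := 'D_((0, 1) : R * R) f.
Let pt (t x : R) := (t * cos x, t * sin x).

(** [W] and [W'] are controlled on [b, d] only. Composed with the clamp they become continuous on
    the whole line with the same values on [b, d], so that Fubini for continuous integrands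
    applies. *)
Let clamp (t : R) := Num.max b (Num.min t d).

Let clamp_continuous : continuous clamp.
Proof.
move=> t; have cb (c : R) : {for t, continuous (cst c : R -> R^o)} by exact: cst_continuous.
have ci : {for t, continuous (idfun : R -> R^o)} by exact: cvg_id.
exact: (continuous_max (cb b) (continuous_min ci (cb d))).
Qed.

Let clampP t : b <= clamp t <= d.
Proof. by rewrite /clamp le_max lexx/= ge_max ltW//= ge_min lexx orbT. Qed.

Let clampE t : b <= t <= d -> clamp t = t.
Proof. by move=> /andP[bt td]; rewrite /clamp; rewrite (min_idPl td) (max_idPr bt). Qed.

Let cWc : continuous (fun t => W (clamp t)).
Proof.
move=> t; apply: (@continuous_comp _ _ _ clamp W); first exact: clamp_continuous.
exact: (is_derive_continuous (dW (clampP t))).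
Qed.

Let cW'c : continuous (fun t => W' (clamp t)).
Proof.
move=> t; apply: (@continuous_comp _ _ _ clamp W'); first exact: clamp_continuous.
exact: cW' (clampP t).
Qed.

Let cpt : continuous (fun z : R * R => pt z.1 z.2).
Proof.
have c1 := @continuous_fst R R; have c2 := @continuous_snd R R.
apply: continuous_pair; apply: continuous_funM => //.
  exact: (continuous_compose c2 (@continuous_cos R)).
exact: (continuous_compose c2 (@continuous_sin R)).
Qed.

Let fdiff p : differentiable f p. Proof. by case: cf => h _ _; exact: h. Qed.

Let cfx : continuous fx. Proof. by case: cf => _ h _; exact: h. Qed.

Let cfy : continuous fy. Proof. by case: cf => _ _ h; exact: h. Qed.

Let cff : continuous f. Proof. by move=> p; exact: differentiable_continuous. Qed.

Let compt (h : R * R -> R) : continuous h -> continuous (fun z : R * R => h (pt z.1 z.2)).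
Proof. by move=> ch; exact: (continuous_compose cpt ch). Qed.

Let comp1 (h : R -> R) : continuous h -> continuous (fun z : R * R => h z.1).
Proof. by move=> ch; exact: (continuous_compose (@continuous_fst R R) ch). Qed.

Let comp2 (h : R -> R) : continuous h -> continuous (fun z : R * R => h z.2).
Proof. by move=> ch; exact: (continuous_compose (@continuous_snd R R) ch). Qed.

Let fr (z : R * R) := cos z.2 * fx (pt z.1 z.2) + sin z.2 * fy (pt z.1 z.2).
Let ft (z : R * R) := z.1 * (cos z.2 * fy (pt z.1 z.2) - sin z.2 * fx (pt z.1 z.2)).

Let cfr : continuous fr.
Proof.
apply: continuous_funD; apply: continuous_funM.
- exact: (comp2 (@continuous_cos R)).
- exact: (compt cfx).
- exact: (comp2 (@continuous_sin R)).
- exact: (compt cfy).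
Qed.

Let cft : continuous ft.
Proof.
apply: continuous_funM; first exact: continuous_fst.
apply: continuous_funB; apply: continuous_funM.
- exact: (comp2 (@continuous_cos R)).
- exact: (compt cfy).
- exact: (comp2 (@continuous_sin R)).
- exact: (compt cfx).
Qed.

Let dfr (t x : R) : is_derive t 1 (fun t : R => f (pt t x)) (fr (t, x)).
Proof.
have dl (c : R) : is_derive t 1 (fun s : R => s * c) c.
  by apply: is_derive_eq; rewrite /GRing.scale/= mulr1 mulr0 add0r.
exact: (is_derive_along (fdiff _) (dl (cos x)) (dl (sin x))).
Qed.

Let dft (t x : R) : is_derive x 1 (fun x : R => f (pt t x)) (ft (t, x)).
Proof.
have d1 : is_derive x 1 (fun s : R => t * cos s) (- (t * sin x)).
  by apply: is_derive_eq; rewrite /GRing.scale/=; ring.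
have d2 : is_derive x 1 (fun s : R => t * sin s) (t * cos x).
  by apply: is_derive_eq; rewrite /GRing.scale/=; ring.
apply: is_derive_eq (is_derive_along (fdiff _) d1 d2) _.
by rewrite /ft/= /pt/= /fx /fy; ring.
Qed.

Let G1 (z : R * R) := W (clamp z.1) * trigc A B n z.2 * fr z.
Let G2 (z : R * R) := W' (clamp z.1) / n%:R * trigs A B n z.2 * ft z.
Let G3 (z : R * R) := W' (clamp z.1) * (trigc A B n z.2 * f (pt z.1 z.2)).

Let cG1 : continuous G1.
Proof.
apply: continuous_funM => //; apply: continuous_funM; first exact: comp1 cWc.
exact: comp2 (@continuous_trigc _ _ _).
Qed.

Let cG2 : continuous G2.
Proof.
apply: continuous_funM => //; apply: continuous_funM; last exact: comp2 (@continuous_trigs _ _ _).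
by apply: continuous_funM; [exact: comp1 cW'c|exact: continuous_cst].
Qed.

Let cG3 : continuous G3.
Proof.
apply: continuous_funM; first exact: comp1 cW'c.
by apply: continuous_funM; [exact: comp2 (@continuous_trigc _ _ _)|exact: compt].
Qed.

Let csec1 (G : R * R -> R) (t : R) : continuous G -> continuous (fun x => G (t, x)).
Proof.
by move=> cG; exact: (continuous_compose (continuous_pair (@continuous_cst _ _ t) (@continuous_idfun _)) cG).
Qed.

Let csec2 (G : R * R -> R) (x : R) : continuous G -> continuous (fun t => G (t, x)).
Proof.
by move=> cG; exact: (continuous_compose (continuous_pair (@continuous_idfun _) (@continuous_cst _ _ x)) cG).
Qed.

Let radial (x : R) : \int[mu]_(t in `[b, d]) G1 (t, x) =
  W d * (trigc A B n x * f (pt d x)) - W b * (trigc A B n x * f (pt b x))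
  - \int[mu]_(t in `[b, d]) G3 (t, x).
Proof.
transitivity (trigc A B n x * \int[mu]_(t in `[b, d]) (W t * fr (t, x))).
  rewrite -RintegralZl//; last first.
    apply: (@eq_integrable _ _ _ mu _ _ (EFin \o (fun t => W (clamp t) * fr (t, x)))) => //.
      by move=> t; rewrite inE/= in_itv/= => tbd; rewrite clampE.
    apply: continuous_integrable_itv; apply: continuous_funM => //; exact: csec2.
  apply: eq_Rintegral => t; rewrite inE/= in_itv/= => tbd.
  by rewrite /G1/= clampE//; ring.
have -> := @Rintegration_by_parts_closed _ W (fun t => f (pt t x)) W' (fun t => fr (t, x)) b d bd
  dW (fun t _ => dfr t x) cW' (fun t _ => @csec2 fr x cfr t).
have -> : \int[mu]_(t in `[b, d]) G3 (t, x) =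
    trigc A B n x * \int[mu]_(t in `[b, d]) (W' t * f (pt t x)).
  rewrite -RintegralZl//; last first.
    apply: (@eq_integrable _ _ _ mu _ _ (EFin \o (fun t => W' (clamp t) * f (pt t x)))) => //.
      by move=> t; rewrite inE/= in_itv/= => tbd; rewrite clampE.
    apply: continuous_integrable_itv; apply: continuous_funM => //.
    exact: (@csec2 (fun z => f (pt z.1 z.2)) x (compt cff)).
  apply: eq_Rintegral => t; rewrite inE/= in_itv/= => tbd.
  by rewrite /G3/= clampE//; ring.
by ring.
Qed.

Let angular (t : R) : b <= t <= d ->
  \int[mu]_(x in `[0, 2 * pi]) G2 (t, x) = - \int[mu]_(x in `[0, 2 * pi]) G3 (t, x).
Proof.
move=> tbd; have p0 : 0 < 2 * pi :> R by rewrite mulr_gt0// pi_gt0.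
have nn0 : n%:R != 0 :> R by rewrite pnatr_eq0 -lt0n.
have cfs := @csec1 (fun z => f (pt z.1 z.2)) t (compt cff).
have cft' := @csec1 ft t cft.
transitivity (W' t / n%:R * \int[mu]_(x in `[0, 2 * pi]) (trigs A B n x * ft (t, x))).
  rewrite -RintegralZl//; last first.
    by apply: continuous_integrable_itv; apply: continuous_funM => //; exact: continuous_trigs.
  by apply: eq_Rintegral => x _; rewrite /G2/= clampE//; ring.
have cc : continuous (fun x => n%:R * trigc A B n x).
  by apply: (@continuous_funM _ _ (fun _ => n%:R)); [exact: continuous_cst|exact: continuous_trigc].
have -> := @Rintegration_by_parts_closed _ (trigs A B n) (fun x => f (pt t x))
   (fun x => n%:R * trigc A B n x) (fun x => ft (t, x)) 0 (2 * pi) p0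
   (fun x _ => is_derive_trigs A B n x) (fun x _ => dft t x) (fun x _ => cc x) (fun x _ => cft' x).
have -> : pt t (2 * pi) = pt t 0.
  by rewrite /pt mulr_natl cos2pi sin2pi cos0 sin0.
rewrite trigs_2pi subrr sub0r.
have -> : \int[mu]_(x in `[0, 2 * pi]) (n%:R * trigc A B n x * f (pt t x)) =
   n%:R * \int[mu]_(x in `[0, 2 * pi]) (trigc A B n x * f (pt t x)).
  rewrite -RintegralZl//; last first.
    by apply: continuous_integrable_itv; apply: continuous_funM => //; exact: continuous_trigc.
  by apply: eq_Rintegral => x _; rewrite mulrA.
have -> : \int[mu]_(x in `[0, 2 * pi]) G3 (t, x) =
   W' t * \int[mu]_(x in `[0, 2 * pi]) (trigc A B n x * f (pt t x)).
  rewrite -RintegralZl//; last first.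
    by apply: continuous_integrable_itv; apply: continuous_funM => //; exact: continuous_trigc.
  by apply: eq_Rintegral => x _; rewrite /G3/= clampE.
by field.
Qed.

Let inner (t : R) := \int[mu]_(x in `[0, 2 * pi])
    (W t * trigc A B n x * (cos x * fx (pt t x) + sin x * fy (pt t x))
     - W' t / n%:R * trigs A B n x * (t * (cos x * fy (pt t x) - sin x * fx (pt t x)))).

Let iG (G : R * R -> R) (t : R) : continuous G ->
  mu.-integrable `[0, 2 * pi] (EFin \o (fun x => G (t, x))).
Proof. by move=> cG; apply: continuous_integrable_itv; exact: csec1. Qed.

Let innerE (t : R) : b <= t <= d -> inner t =
  \int[mu]_(x in `[0, 2 * pi]) G1 (t, x) + \int[mu]_(x in `[0, 2 * pi]) G3 (t, x).
Proof.
move=> tbd; rewrite -[X in _ + X]opprK -angular// -RintegralB//; [|exact: iG..].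
by apply: eq_Rintegral => x _; rewrite /G1 /G2/= clampE.
Qed.

Lemma green_annulus_integrable : mu.-integrable `[b, d] (EFin \o inner).
Proof.
have -> : EFin \o inner = (fun t => (inner t)%:E) by [].
apply: (@eq_integrable _ _ _ mu `[b, d] _ (fun t : R => (\int[mu]_(x in `[0, 2 * pi]) G1 (t, x))%:E
    + (\int[mu]_(x in `[0, 2 * pi]) G3 (t, x))%:E)%E) => //.
  by move=> t; rewrite inE/= in_itv/= => tbd; rewrite innerE// EFinD.
by apply: integrableD => //; exact: continuous_integrable_Rintegral.
Qed.

(** The bracketed factors are the radial and the angular derivative of [f]. Integration by parts in
    r yields the boundary terms minus the integral of W' [trigc] f; integration by parts in the
    angle, free of boundary terms by periodicity, yields the same integral with the opposite sign.
    The radial equation enters later, through the choice W = r gamma R' with W' = n^2 gamma R /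
    r. *)
Lemma green_annulus :
  \int[mu]_(t in `[b, d]) \int[mu]_(x in `[0, 2 * pi])
    (W t * trigc A B n x * (cos x * fx (pt t x) + sin x * fy (pt t x))
     - W' t / n%:R * trigs A B n x * (t * (cos x * fy (pt t x) - sin x * fx (pt t x)))) =
  W d * \int[mu]_(x in `[0, 2 * pi]) (trigc A B n x * f (pt d x))
  - W b * \int[mu]_(x in `[0, 2 * pi]) (trigc A B n x * f (pt b x)).
Proof.
have cb (t : R) : continuous (fun x => trigc A B n x * f (pt t x)).
  apply: continuous_funM; first exact: continuous_trigc.
  exact: (@csec1 (fun z => f (pt z.1 z.2)) t (compt cff)).
have cswap (G : R * R -> R) : continuous G -> continuous (fun z : R * R => G (z.2, z.1)).
  by move=> cG; exact: (continuous_compose (continuous_pair (@continuous_snd _ _) (@continuous_fst _ _)) cG).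
transitivity (\int[mu]_(t in `[b, d]) (\int[mu]_(x in `[0, 2 * pi]) G1 (t, x)
     + \int[mu]_(x in `[0, 2 * pi]) G3 (t, x))).
  apply: eq_Rintegral => t; rewrite inE/= in_itv/= => tbd.
  exact: innerE.
rewrite RintegralD//; [|exact: continuous_integrable_Rintegral..].
rewrite continuous_Fubini//.
under eq_Rintegral do rewrite radial.
have cWb (w t : R) : continuous (fun x => w * (trigc A B n x * f (pt t x))).
  by apply: continuous_funM; [exact: continuous_cst|exact: cb].
rewrite RintegralB//; last 2 first.
- by apply: continuous_integrable_itv; apply: continuous_funB; exact: cWb.
- exact: (@continuous_integrable_Rintegral _ _ _ _ _ _ (cswap _ cG3)).
rewrite RintegralB//; [|apply: continuous_integrable_itv; exact: cWb..].
rewrite !RintegralZl//; [|apply: continuous_integrable_itv; exact: cb..].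
by rewrite -continuous_Fubini// subrK.
Qed.

End annulus.

End green.

(** * The inner radial solution *)

Section series.
Context {R : realType}.

Section sums.
Variable x : R.
Hypothesis x01 : 0 <= x < 1.

Let gsum (c : nat -> R) N := \sum_(0 <= k < N) c k * x ^+ k.

(** Multiplication by 1 - x lowers the degree of the polynomial weight by one, up to a term in x^N.
    The resulting bounds dominate a power series with coefficients in [0, 1] and its derivatives. *)
Lemma sum_geom1 N : (1 - x) * gsum (fun _ => 1) N = 1 - x ^+ N.
Proof.
elim: N => [|N IH]; first by rewrite /gsum big_geq// mulr0 expr0 subrr.
by rewrite /gsum big_nat_recr//= mulrDr IH exprS; ring.
Qed.

Lemma sum_geom2 N : (1 - x) * gsum (fun k => k.+1%:R) N = gsum (fun _ => 1) N - N%:R * x ^+ N.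
Proof.
elim: N => [|N IH]; first by rewrite /gsum !big_geq// mulr0 mul0r subrr.
by rewrite /gsum !big_nat_recr//= mulrDr IH exprS /gsum -!natr1; ring.
Qed.

Lemma sum_geom3 N : (1 - x) * gsum (fun k => k.+1%:R * k.+2%:R) N =
  2 * gsum (fun k => k.+1%:R) N - N%:R * N.+1%:R * x ^+ N.
Proof.
elim: N => [|N IH]; first by rewrite /gsum !big_geq// mulr0 !mul0r mulr0 subrr.
by rewrite /gsum !big_nat_recr//= mulrDr IH exprS /gsum -!natr1; ring.
Qed.

Lemma sum_geom4 N : (1 - x) * gsum (fun k => k.+1%:R * (k.+2%:R * k.+3%:R)) N =
  3 * gsum (fun k => k.+1%:R * k.+2%:R) N - N%:R * N.+1%:R * N.+2%:R * x ^+ N.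
Proof.
elim: N => [|N IH]; first by rewrite /gsum !big_geq// mulr0 !mul0r mulr0 subrr.
by rewrite /gsum !big_nat_recr//= mulrDr IH exprS /gsum -!natr1; ring.
Qed.

Let x1 : 0 < 1 - x. Proof. by case/andP: x01; lra. Qed.

Let x0 : 0 <= x. Proof. by case/andP: x01. Qed.

Lemma sum_geom1_le N : gsum (fun _ => 1) N <= (1 - x)^-1.
Proof.
rewrite -(ler_pM2l x1) sum_geom1 divff ?gt_eqF//.
by rewrite gerBl exprn_ge0.
Qed.

Lemma sum_geom2_le N : gsum (fun k => k.+1%:R) N <= (1 - x) ^- 2.
Proof.
rewrite -(ler_pM2l x1) sum_geom2 expr2 invfM mulVKf ?gt_eqF//.
by rewrite lerBlDr (le_trans (sum_geom1_le _))// lerDl mulr_ge0// exprn_ge0.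
Qed.

Lemma sum_geom3_le N : gsum (fun k => k.+1%:R * k.+2%:R) N <= 2 * (1 - x) ^- 3.
Proof.
rewrite -(ler_pM2l x1) sum_geom3 mulrCA exprS invfM mulVKf ?gt_eqF//.
rewrite lerBlDr (@le_trans _ _ (2 * (1 - x) ^- 2))//; last first.
  by rewrite lerDl !mulr_ge0// exprn_ge0.
by rewrite ler_pM2l// sum_geom2_le.
Qed.

Lemma sum_geom4_le N : gsum (fun k => k.+1%:R * (k.+2%:R * k.+3%:R)) N <= 6 * (1 - x) ^- 4.
Proof.
rewrite -(ler_pM2l x1) sum_geom4 mulrCA exprS invfM mulVKf ?gt_eqF//.
rewrite lerBlDr (@le_trans _ _ (6 * (1 - x) ^- 3))//; last first.
  by rewrite lerDl !mulr_ge0// exprn_ge0.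
have := sum_geom3_le N; lra.
Qed.

Lemma pseries_le_cvg (c e : nat -> R) (B : R) :
  (forall k, 0 <= c k <= e k) -> (forall N, gsum e N <= B) ->
  cvgn (pseries c x) /\ limn (pseries c x) <= B.
Proof.
move=> ce eB.
have le N : pseries c x N <= B.
  apply: le_trans (eB N); rewrite /pseries /series/=; apply: ler_sum => k _.
  by apply: ler_wpM2r; [exact: exprn_ge0|case/andP: (ce k)].
have cv : cvgn (pseries c x).
  apply: nondecreasing_is_cvgn.
    apply/nondecreasing_seqP => N; rewrite /pseries /series/= big_nat_recr//= lerDl.
    by rewrite mulr_ge0// ?exprn_ge0//; case/andP: (ce N).
  by exists B => _ [N _ <-]; exact: le.
by split=> //; apply: limr_le => //; apply: nearW.
Qed.

End sums.

Section hseries.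
Variable n : nat.
Hypothesis n0 : (0 < n)%N.

(* Frobenius recurrence: up to a constant, [r ^+ n * hser (kappa * r)] is the bounded
   solution of the radial equation for the conductivity [1 - kappa * r]. *)
Fixpoint hcoef (k : nat) : R :=
  if k is j.+1 then
    hcoef j * ((j%:R ^+ 2 + 2 * n%:R * j%:R + j%:R + n%:R) / (j.+1%:R * (j + (2 * n).+1)%:R))
  else 1.

Lemma hcoefS j : j.+1%:R * (j + (2 * n).+1)%:R * hcoef j.+1 =
  (j%:R ^+ 2 + 2 * n%:R * j%:R + j%:R + n%:R) * hcoef j.
Proof.
have h1 : j.+1%:R != 0 :> R by rewrite pnatr_eq0.
have h2 : (j + (2 * n).+1)%:R != 0 :> R by rewrite addnS pnatr_eq0.
by rewrite /= mulrCA [X in _ * X]mulrC divfK ?mulf_neq0// mulrC.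
Qed.

Arguments hcoef : simpl never.

(** The ratio of consecutive coefficients is below 1, since (j + 1)(j + 2n + 1) exceeds j^2 + 2nj +
    j + n by j + n + 1. The comparison with the geometric series is uniform in [n], and so are the
    bounds drawn from it. *)
Lemma hcoef_itv k : 0 < hcoef k <= 1.
Proof.
elim: k => [|j /andP[IH0 IH1]]; first by rewrite /= ltr01 lexx.
have h : 0 < (j.+1%:R * (j + (2 * n).+1)%:R) :> R by rewrite mulr_gt0// addnS ltr0n.
have nr : 1 <= n%:R :> R by rewrite ler1n.
have j0 : 0 <= j%:R :> R by rewrite ler0n.
have q0 : 0 < (j%:R ^+ 2 + 2 * n%:R * j%:R + j%:R + n%:R) / (j.+1%:R * (j + (2 * n).+1)%:R) :> R.
  by rewrite divr_gt0//; nra.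
apply/andP; split; first exact: mulr_gt0.
apply: mulr_ile1 => //; try exact: ltW.
have e1 : (2 * n).+1%:R = 2 * n%:R + 1 :> R by rewrite -natr1 natrM.
have e2 : j.+1%:R = j%:R + 1 :> R by rewrite -natr1.
by rewrite ler_pdivrMr// mul1r natrD e1 e2; nra.
Qed.

Definition hser (x : R) := limn (pseries hcoef x).
Definition hser1 (x : R) := limn (pseries (pseries_diffs hcoef) x).
Definition hser2 (x : R) := limn (pseries (pseries_diffs (pseries_diffs hcoef)) x).

Let hc0 k : 0 <= hcoef k <= 1. Proof. by have /andP[/ltW -> ->] := hcoef_itv k. Qed.

Lemma hser_cvg (x : R) : 0 <= x < 1 -> cvgn (pseries hcoef x) /\ hser x <= (1 - x)^-1.
Proof. by move=> x01; apply: (pseries_le_cvg x01 hc0); exact: sum_geom1_le. Qed.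

Lemma hser1_cvg (x : R) : 0 <= x < 1 ->
  cvgn (pseries (pseries_diffs hcoef) x) /\ hser1 x <= (1 - x) ^- 2.
Proof.
move=> x01; apply: (pseries_le_cvg x01 _ (sum_geom2_le x01)) => k.
rewrite /pseries_diffs; have /andP[h0 h1] := hc0 k.+1.
by rewrite mulr_ge0// ler_piMr.
Qed.

Lemma hser2_cvg (x : R) : 0 <= x < 1 ->
  cvgn (pseries (pseries_diffs (pseries_diffs hcoef)) x) /\ hser2 x <= 2 * (1 - x) ^- 3.
Proof.
move=> x01; apply: (pseries_le_cvg x01 _ (sum_geom3_le x01)) => k.
rewrite /pseries_diffs; have /andP[h0 h1] := hc0 k.+2.
apply/andP; split; first by do 2!apply: mulr_ge0 => //.
by apply: ler_wpM2l => //; rewrite ler_piMr.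
Qed.

Lemma hser3_cvg (x : R) : 0 <= x < 1 ->
  cvgn (pseries (pseries_diffs (pseries_diffs (pseries_diffs hcoef))) x).
Proof.
move=> x01; apply: (proj1 (pseries_le_cvg x01 _ (sum_geom4_le x01))) => k.
rewrite /pseries_diffs; have /andP[h0 h1] := hc0 k.+3.
apply/andP; split; first by do 3!apply: mulr_ge0 => //.
by do 2!apply: ler_wpM2l => //; rewrite ler_piMr.
Qed.

Let lim_pseries_ge0 (c : nat -> R) (x : R) : 0 <= x -> (forall k, 0 <= c k) ->
  cvgn (pseries c x) -> 0 <= limn (pseries c x).
Proof.
move=> x0 c0 cv; apply: limr_ge => //; apply: nearW => N.
by rewrite /pseries /series/=; apply: sumr_ge0 => k _; rewrite mulr_ge0// exprn_ge0.
Qed.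

Lemma hser_ge1 (x : R) : 0 <= x < 1 -> 1 <= hser x.
Proof.
move=> x01; have [cv _] := hser_cvg x01; rewrite /hser.
apply: limr_ge => //; exists 1%N => // -[//|N] _ /=; rewrite /pseries /series/= big_nat_recl//= expr0 mulr1 lerDl.
apply: sumr_ge0 => k _; rewrite mulr_ge0//; last by rewrite exprn_ge0//; case/andP: x01.
by case/andP: (hc0 k.+1).
Qed.

Lemma hser1_ge0 (x : R) : 0 <= x < 1 -> 0 <= hser1 x.
Proof.
move=> x01; apply: (lim_pseries_ge0 _ _ (hser1_cvg x01).1); first by case/andP: x01.
by move=> k; rewrite /pseries_diffs mulr_ge0//; case/andP: (hc0 k.+1).
Qed.

Lemma hser2_ge0 (x : R) : 0 <= x < 1 -> 0 <= hser2 x.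
Proof.
move=> x01; apply: (lim_pseries_ge0 _ _ (hser2_cvg x01).1); first by case/andP: x01.
move=> k; rewrite /pseries_diffs; apply: mulr_ge0 => //; apply: mulr_ge0 => //.
by case/andP: (hc0 k.+2).
Qed.

Let mid (x : R) : `|x| < 1 -> exists2 K : R, 0 <= K < 1 & `|x| < `|K|.
Proof.
move=> x1; exists ((1 + `|x|) / 2); first by have := normr_ge0 x; lra.
by rewrite [ltRHS]ger0_norm; have := normr_ge0 x; lra.
Qed.

Lemma is_derive_hser (x : R) : `|x| < 1 -> is_derive x 1 hser (hser1 x).
Proof.
move=> /mid[K K01 xK]; apply: (pseries_snd_diffs _ _ _ xK).
- exact: (hser_cvg K01).1.
- exact: (hser1_cvg K01).1.
- exact: (hser2_cvg K01).1.
Qed.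

Lemma is_derive_hser1 (x : R) : `|x| < 1 -> is_derive x 1 hser1 (hser2 x).
Proof.
move=> /mid[K K01 xK]; apply: (pseries_snd_diffs _ _ _ xK).
- exact: (hser1_cvg K01).1.
- exact: (hser2_cvg K01).1.
- exact: (hser3_cvg K01).
Qed.

(** By the recurrence the partial sums satisfy the equation up to the single term [x ^+ 2 * t2 N],
    which tends to 0 because [t2] is the general term of a convergent series. *)
Lemma hser_ode (x : R) : `|x| < 1 ->
  (1 - x) * (x * hser2 x + (2 * n%:R + 1) * hser1 x) = x * hser1 x + n%:R * hser x.
Proof.
move=> x1; have [K K01 xK] := mid x1.
pose S0 := pseries hcoef x; pose S1 := pseries (pseries_diffs hcoef) x.
pose S2 := pseries (pseries_diffs (pseries_diffs hcoef)) x.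
have c0 : S0 @ \oo --> hser x by apply: (is_cvg_pseries_inside (hser_cvg K01).1 xK).
have c1 : S1 @ \oo --> hser1 x by apply: (is_cvg_pseries_inside (hser1_cvg K01).1 xK).
have c2 : S2 @ \oo --> hser2 x by apply: (is_cvg_pseries_inside (hser2_cvg K01).1 xK).
pose t2 N := pseries_diffs (pseries_diffs hcoef) N * x ^+ N.
have ct : t2 @ \oo --> 0.
  by apply: (@cvg_series_cvg_0 _ _ t2); apply/cvg_ex; exists (hser2 x); exact: c2.
have D N : x * S2 N.+1 + (2 * n%:R + 1) * S1 N.+2 - x ^+ 2 * S2 N.+1
    - (2 * n%:R + 2) * (x * S1 N.+1) - n%:R * S0 N.+2 = - (x ^+ 2 * t2 N).
  have S0E M : S0 M.+1 = S0 M + hcoef M * x ^+ M.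
    by rewrite /S0 /pseries /series/= big_nat_recr.
  have S1E M : S1 M.+1 = S1 M + M.+1%:R * hcoef M.+1 * x ^+ M.
    by rewrite /S1 /pseries /series/= big_nat_recr.
  have S2E M : S2 M.+1 = S2 M + M.+1%:R * (M.+2%:R * hcoef M.+2) * x ^+ M.
    by rewrite /S2 /pseries /series/= big_nat_recr.
  have D' M : x * S2 M + (2 * n%:R + 1) * S1 M.+1 - x ^+ 2 * S2 M
    - (2 * n%:R + 2) * (x * S1 M) - n%:R * S0 M.+1 = - (M%:R * M.+1%:R * hcoef M.+1 * x ^+ M.+1).
    elim: M => [|M IH].
      rewrite S1E S0E [S2 0]big_geq// [S1 0]big_geq// [S0 0]big_geq//.
      have E := hcoefS 0; rewrite add0n -[(2 * n).+1%:R]natr1 natrM expr0 in E *.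
      by apply/eqP; rewrite -subr_eq0; apply/eqP; lra.
    have E := hcoefS M.+1.
    rewrite addSn -[(M + (2 * n).+1).+1%:R]natr1 natrD -[(2 * n).+1%:R]natr1 natrM in E.
    rewrite S2E S1E S0E S1E S0E.
    rewrite S1E S0E in IH.
    move/eqP: IH; rewrite -subr_eq0 => /eqP IH; move/eqP: E; rewrite -subr_eq0 => /eqP E.
    apply/eqP; rewrite -subr_eq0; apply/eqP.
    rewrite -[RHS]addr0 -[X in _ = X + _]IH -[X in _ = _ + X](mulr0 (x ^+ M.+1)) -E.
    by rewrite !exprS -!natr1; ring.
  by rewrite D' /t2 /pseries_diffs !exprS; ring.
have cs (u : nat -> R) (l : R) : u @ \oo --> l -> (fun N => u N.+1) @ \oo --> l.
  by move=> cu; rewrite -cvg_shiftS in cu.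
have cL : (fun N => x * S2 N.+1 + (2 * n%:R + 1) * S1 N.+2 - x ^+ 2 * S2 N.+1
    - (2 * n%:R + 2) * (x * S1 N.+1) - n%:R * S0 N.+2) @ \oo -->
   x * hser2 x + (2 * n%:R + 1) * hser1 x - x ^+ 2 * hser2 x
    - (2 * n%:R + 2) * (x * hser1 x) - n%:R * hser x.
  have k1 := cs _ _ c1; have k2 := cs _ _ c2; have k11 := cs _ _ k1.
  have k00 := cs _ _ (cs _ _ c0).
  apply: cvgB; last exact: cvgZl_tmp k00.
  apply: cvgB; last by apply: cvgZl_tmp; exact: cvgZl_tmp k1.
  apply: cvgB; last exact: cvgZl_tmp k2.
  by apply: cvgD; exact: cvgZl_tmp.
have cR : (fun N => - (x ^+ 2 * t2 N)) @ \oo --> 0.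
  by rewrite -oppr0; apply: cvgN; rewrite -(mulr0 (x ^+ 2)); exact: cvgZl_tmp ct.
rewrite (_ : (fun N => _ - _) = (fun N => - (x ^+ 2 * t2 N))) in cL; last by apply/funext.
have E := cvg_unique (@Rhausdorff R) cL cR.
apply/eqP; rewrite -subr_eq0; apply/eqP; rewrite -[RHS]E; ring.
Qed.

End hseries.

End series.

#[global] Arguments hcoef : simpl never.

Lemma MVT_closed (R : realType) (f df : R -> R) (a b : R) : a <= b ->
  (forall x, a <= x <= b -> is_derive x 1 f (df x)) ->
  exists2 c, a <= c <= b & f b - f a = df c * (b - a).
Proof.
move=> ab d.
have d' x : x \in `]a, b[%R -> is_derive x 1 f (df x).
  by rewrite in_itv/= => /andP[ax xb]; apply: d; rewrite !ltW.
have cf : {within `[a, b], continuous f}.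
  apply: continuous_in_subspaceT => x; rewrite inE/= in_itv/= => xab.
  exact: (is_derive_continuous (d x xab)).
by have [c] := MVT_segment ab d' cf; rewrite in_itv/= => cab E; exists c.
Qed.

(** * Slope of the logarithmic derivative *)

Section hlog.
Context {R : realType}.
Variable n : nat.
Hypothesis n0 : (0 < n)%N.

Definition hlog (x : R) := x * hser1 n x / hser n x.

Let A N (x : R) := \sum_(0 <= k < N) hcoef n k * x ^+ k.
Let B N (x : R) := \sum_(0 <= k < N) k%:R * hcoef n k * x ^+ k.

Let cvg_A (x : R) : 0 <= x < 1 -> (fun N => A N x) @ \oo --> hser n x.
Proof. by move=> x01; exact: (hser_cvg n0 x01).1. Qed.

Let cvg_B (x : R) : 0 <= x < 1 -> (fun N => B N.+1 x) @ \oo --> x * hser1 n x.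
Proof.
move=> x01; have c1 := (hser1_cvg n0 x01).1.
have -> : (fun N => B N.+1 x) = (fun N => x * pseries (pseries_diffs (@hcoef R n)) x N).
  apply/funext => N; rewrite /B big_nat_recl// mul0r mul0r add0r /pseries /series/= mulr_sumr.
  by apply: eq_bigr => k _; rewrite /pseries_diffs [x ^+ k.+1]exprS mulrCA.
exact: cvgZl_tmp c1.
Qed.

(** As [B N] is x times the derivative of [A N], the right-hand side is the sum over j < k of (k -
    j) c_j c_k (x^k y^j - x^j y^k), with nonnegative terms for y <= x; the pair (0, 1) alone gives
    the left-hand side. Each induction step adds the pairs whose larger index is the new one. *)
Let cross (x y : R) N : 0 <= y <= x ->
  hcoef n 1 * (x - y) <= A N.+2 y * B N.+2 x - A N.+2 x * B N.+2 y.
Proof.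
move=> /andP[y0 yx]; have x0 := le_trans y0 yx.
elim: N => [|N IH].
  rewrite /A /B !big_nat_recr//= !big_geq// !expr0 !expr1.
  have h0 : hcoef n 0 = 1 :> R by [].
  rewrite h0 le_eqVlt; apply/orP; left; apply/eqP. ring.
apply: le_trans IH _.
rewrite /A /B [in leRHS]big_nat_recr// [X in _ <= _ * X - _]big_nat_recr// [X in _ <= _ - X * _]big_nat_recr//
  [X in _ <= _ - _ * X]big_nat_recr// -/(A _ _) -/(A _ _) -/(B _ _) -/(B _ _).
set M := N.+2; set p := hcoef n M.
have p0 : 0 <= p by have /andP[/ltW] := @hcoef_itv R n n0 M.
have key : 0 <= (A M y * M%:R - B M y) * x ^+ M - (A M x * M%:R - B M x) * y ^+ M.
  have E z : A M z * M%:R - B M z = \sum_(0 <= k < M) (M%:R - k%:R) * hcoef n k * z ^+ k.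
    by rewrite /A /B mulr_suml -sumrB; apply: eq_bigr => k _; ring.
  rewrite !E !mulr_suml -sumrB big_nat; apply: sumr_ge0 => k /andP[_ kM].
  have -> : (M%:R - k%:R) * hcoef n k * y ^+ k * x ^+ M - (M%:R - k%:R) * hcoef n k * x ^+ k * y ^+ M =
     (M%:R - k%:R) * hcoef n k * ((x * y) ^+ k * (x ^+ (M - k) - y ^+ (M - k))).
    have eM (z : R) : z ^+ M = z ^+ k * z ^+ (M - k) by rewrite -exprD subnKC// ltnW.
    by rewrite (eM x) (eM y) exprMn; ring.
  have h : 0 <= hcoef n k :> R by have /andP[/ltW] := @hcoef_itv R n n0 k.
  apply: mulr_ge0; first by rewrite mulr_ge0// subr_ge0 ler_nat ltnW.
  by rewrite mulr_ge0 ?exprn_ge0 ?mulr_ge0// subr_ge0 lerXn2r.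
rewrite -subr_ge0.
have -> : (A M y + p * y ^+ M) * (B M x + M%:R * p * x ^+ M) -
   (A M x + p * x ^+ M) * (B M y + M%:R * p * y ^+ M) - (A M y * B M x - A M x * B M y) =
   p * ((A M y * M%:R - B M y) * x ^+ M - (A M x * M%:R - B M x) * y ^+ M) by ring.
exact: mulr_ge0.
Qed.

Let hcoef1 : 1 / 3 <= hcoef n 1 :> R.
Proof.
have nr : 1 <= n%:R :> R by rewrite ler1n.
have E := @hcoefS R n 0; rewrite add0n -[(2 * n).+1%:R]natr1 natrM expr0n/= in E.
have h0 : hcoef n 0 = 1 :> R by [].
rewrite h0 in E.
have c0 : 0 < 2 * n%:R + 1 :> R by lra.
rewrite -(ler_pM2l c0); lra.
Qed.

Variable rho : R.
Hypothesis rho1 : 0 <= rho < 1.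

Lemma hlog_ge0 x : 0 <= x <= rho -> 0 <= hlog x.
Proof.
move=> /andP[x0 xr]; have x01 : 0 <= x < 1 by case/andP: rho1; lra.
have h := hser_ge1 n0 x01; have h1 := hser1_ge0 n0 x01.
by rewrite divr_ge0// ?mulr_ge0//; lra.
Qed.

Let hser1_le x : 0 <= x <= rho -> hser1 n x <= (1 - rho) ^- 2.
Proof.
move=> /andP[x0 xr]; have [r0 r1] := andP rho1; have x01 : 0 <= x < 1 by lra.
apply: le_trans (hser1_cvg n0 x01).2 _.
by rewrite lef_pV2 ?posrE ?exprn_gt0// ?lerXn2r ?nnegrE//; lra.
Qed.

Lemma hlog_le x : 0 <= x <= rho -> hlog x <= (1 - rho) ^- 2.
Proof.
move=> xr; have /andP[x0 x1] := xr; have [r0 r1] := andP rho1; have x01 : 0 <= x < 1 by lra.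
have h := hser_ge1 n0 x01; have h1 := hser1_ge0 n0 x01.
rewrite /hlog ler_pdivrMr; last by lra.
have := hser1_le xr; set u := (1 - rho) ^- 2 => h2; nra.
Qed.

(** The limit of [cross] bounds the numerator of the difference from below; [hcoef n 1] = n / (2n +
    1) is at least 1/3, and each of the two denominators is at most 1 / (1 - rho). *)
Lemma hlog_lower x y : 0 <= y <= x -> x <= rho ->
  (1 - rho) ^+ 2 / 3 * (x - y) <= hlog x - hlog y.
Proof.
move=> yx xr; have [r0 r1] := andP rho1; have [y0 yx'] := andP yx.
have x01 : 0 <= x < 1 by lra.
have y01 : 0 <= y < 1 by lra.
have hx := hser_ge1 n0 x01; have hy := hser_ge1 n0 y01.
have C : hcoef n 1 * (x - y) <= hser n y * (x * hser1 n x) - hser n x * (y * hser1 n y).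
  have cs (u : nat -> R) (l : R) : u @ \oo --> l -> (fun N => u N.+1) @ \oo --> l.
    by move=> cu; rewrite -cvg_shiftS in cu.
  have c : (fun N => A N.+2 y * B N.+2 x - A N.+2 x * B N.+2 y) @ \oo -->
      hser n y * (x * hser1 n x) - hser n x * (y * hser1 n y).
    apply: cvgB; apply: cvgM; try exact: (cs _ _ (cs _ _ (cvg_A _)));
      exact: (cs _ _ (cvg_B _)).
  by rewrite -(cvg_lim (@Rhausdorff R) c); apply: limr_ge; [apply/cvg_ex; eexists; exact: c|apply: nearW => N; exact: cross].
have -> : hlog x - hlog y = (hser n y * (x * hser1 n x) - hser n x * (y * hser1 n y)) / (hser n x * hser n y).
  by rewrite /hlog; field; apply/andP; split; lra.
have Pxy : hser n x * hser n y <= (1 - rho) ^- 2.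
  rewrite expr2 invfM; apply: ler_pM; try lra.
    apply: le_trans (hser_cvg n0 x01).2 _; rewrite lef_pV2 ?posrE; lra.
  apply: le_trans (hser_cvg n0 y01).2 _; rewrite lef_pV2 ?posrE; lra.
rewrite ler_pdivlMr; last by nra.
apply: le_trans _ C.
apply: (@le_trans _ _ (1 / 3 * (x - y))); last by have := hcoef1; nra.
have u0 : 0 < (1 - rho) ^+ 2 by rewrite exprn_gt0//; lra.
have : (1 - rho) ^+ 2 * (hser n x * hser n y) <= 1.
  by rewrite -ler_pdivlMl// mulr1.
set P := _ * hser n y; set u := (1 - rho) ^+ 2; nra.
Qed.

(** [hser] is increasing and at least 1, so the quotient grows no faster than its numerator x
    [hser1], whose derivative [hser1] + x [hser2] is at most (1 - rho)^-2 + 2 (1 - rho)^-3. *)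
Lemma hlog_upper x y : 0 <= y <= x -> x <= rho ->
  hlog x - hlog y <= 3 * (1 - rho) ^- 3 * (x - y).
Proof.
move=> yx xr; have [r0 r1] := andP rho1; have [y0 yx'] := andP yx.
have x01 : 0 <= x < 1 by lra.
have y01 : 0 <= y < 1 by lra.
have hx := hser_ge1 n0 x01; have hy := hser_ge1 n0 y01.
have nrm (z : R) : y <= z <= x -> `|z| < 1 by move=> zyx; rewrite ger0_norm; lra.
have d1 (z : R) : `|z| < 1 -> is_derive z 1 (fun z => z * hser1 n z) (hser1 n z + z * hser2 n z).
  move=> z1; have h := is_derive_hser1 n0 z1.
  have -> : (fun z => z * hser1 n z) = (@idfun R) * hser1 n by [].
  by apply: is_derive_eq; rewrite /GRing.scale/=; ring.
have Pmono : hser n y <= hser n x.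
  have [c ci E] := MVT_closed yx' (fun z zi => is_derive_hser n0 (nrm z zi)).
  rewrite -subr_ge0 E mulr_ge0 ?subr_ge0//; apply: (hser1_ge0 n0); lra.
have T : x * hser1 n x - y * hser1 n y <= 3 * (1 - rho) ^- 3 * (x - y).
  have [c ci ->] := MVT_closed yx' (fun z zi => d1 z (nrm z zi)).
  have c01 : 0 <= c < 1 by lra.
  have cr : 0 <= c <= rho by lra.
  apply: ler_wpM2r; first by rewrite subr_ge0.
  have h1 := hser1_le cr.
  have h2 : hser2 n c <= 2 * (1 - rho) ^- 3.
    apply: le_trans (hser2_cvg n0 c01).2 _; rewrite ler_pM2l//.
    by rewrite lef_pV2 ?posrE ?exprn_gt0// ?lerXn2r ?nnegrE//; lra.
  have h20 := hser2_ge0 n0 c01.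
  have e : (1 - rho) ^- 2 <= (1 - rho) ^- 3.
    by rewrite lef_pV2 ?posrE ?exprn_gt0 ?[(_ ^+ 3)]exprS ?ler_piMl ?exprn_ge0//; lra.
  have : c * hser2 n c <= hser2 n c by rewrite ler_piMl//; lra.
  lra.
apply: le_trans T.
have h1x := hser1_ge0 n0 x01; have h1y := hser1_ge0 n0 y01.
apply: (@le_trans _ _ ((x * hser1 n x - y * hser1 n y) / hser n x)).
  rewrite mulrBl lerD2l lerN2 /hlog ler_pM// ?invr_ge0 ?mulr_ge0//; try lra.
  by rewrite lef_pV2 ?posrE; lra.
rewrite ler_pdivrMr; last by lra.
apply: ler_peMr => //.
have [c ci E] := MVT_closed yx' (fun z zi => d1 z (nrm z zi)).
rewrite E mulr_ge0 ?subr_ge0//.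
have c01 : 0 <= c < 1 by lra.
by have := hser1_ge0 n0 c01; have := hser2_ge0 n0 c01 => ? ?; rewrite addr_ge0// mulr_ge0//; lra.
Qed.

End hlog.

(** * Radial profiles and their matching at the interface *)

Section profile.
Context {R : realType}.

(* [par1 al + par2 al * (a - r) = (par1 al + par2 al * a) * (1 - kappa a al * r)]. *)
Definition kappa (a : R) (al : @param R) := par2 al / (par1 al + par2 al * a).

(* For the solution [e^(i n theta) R r], the quotient of [gamma * R'] by [n * R / r] at the
   interface [r = a]. *)
Definition admittance (n : nat) (a : R) (al : @param R) :=
  par1 al * (1 + hlog n (kappa a al * a) / n%:R).

(* Value at [r = 1] of [gamma * R' / R] when [R] is the combination of [r ^+ n] and [r ^- n]
   on [a < r < 1] that matches the admittance at [a]. *)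
Definition dn_eigenvalue (n : nat) (a : R) (al : @param R) :=
  let F := admittance n a al in let q := a ^+ (2 * n) in
  n%:R * par0 al * ((par0 al + F - q * (par0 al - F)) / (par0 al + F + q * (par0 al - F))).

(** The radial factor is R = r^n P inside and r^n Q outside, so r gamma R' = r^n gamma (n P + r P').
    [prof_in] and [prof_out] are then the equation (r gamma R')' = n^2 gamma R / r, while
    [prof_glue] and [prof_flux] express continuity of R and gamma R' at r = a. Splitting off r^n
    exhibits the solution as the polynomial z^n times a function of |z|. The integral identities
    know P and Q through these fields only. *)
Record profile (n : nat) (a : R) (al : @param R) (P P' Q Q' : R -> R) : Prop := Profile {
  prof_dP : forall r : R, `|r| <= a -> is_derive r 1 P (P' r);
  prof_cP : forall r : R, `|r| <= a -> {for r, continuous P'};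
  prof_dQ : forall r : R, 0 < r -> is_derive r 1 Q (Q' r);
  prof_cQ : forall r : R, 0 < r -> {for r, continuous Q'};
  prof_glue : P a = Q a;
  prof_one : Q 1 = 1;
  prof_in : forall r : R, 0 <= r <= a ->
    is_derive r 1 (fun r : R => r ^+ n * ((par1 al + par2 al * (a - r)) * (n%:R * P r + r * P' r)))
      (n%:R ^+ 2 * r ^+ n.-1 * ((par1 al + par2 al * (a - r)) * P r));
  prof_out : forall r : R, 0 < r ->
    is_derive r 1 (fun r : R => r ^+ n * (par0 al * (n%:R * Q r + r * Q' r)))
      (n%:R ^+ 2 * r ^+ n.-1 * (par0 al * Q r));
  prof_flux : par1 al * (n%:R * P a + a * P' a) = par0 al * (n%:R * Q a + a * Q' a);
  prof_eig : par0 al * (n%:R * Q 1 + Q' 1) = dn_eigenvalue n a al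
}.

Section exists_profile.
Variables (m : nat) (a : R) (al : @param R).
Let n := m.+1.
Hypothesis a01 : 0 < a < 1.
Hypotheses (al0 : 0 < par0 al) (al1 : 0 < par1 al) (al2 : 0 <= par2 al).

Let c := par1 al + par2 al * a.
Let k := kappa a al.

Let c0 : 0 < c.
Proof. by rewrite /c ltr_pwDl// mulr_ge0// ltW//; case/andP: a01. Qed.

Let ck : c * k = par2 al.
Proof. by rewrite /k /kappa -/c mulrC divfK// gt_eqF. Qed.

Let k0 : 0 <= k. Proof. by rewrite /k /kappa -/c divr_ge0// ltW. Qed.

Lemma kappa_itv : 0 <= k * a < 1.
Proof.
have /andP[a0 a1] := a01.
rewrite mulr_ge0//=; last exact: ltW.
by rewrite /k /kappa -/c mulrAC ltr_pdivrMr// mul1r /c ltrDr.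
Qed.

Let kr (r : R) : `|r| <= a -> `|k * r| < 1.
Proof.
move=> ra; rewrite normrM (ger0_norm k0).
by apply: le_lt_trans (ler_wpM2l k0 ra) _; have /andP[] := kappa_itv.
Qed.

Lemma admittance_gt0 : 0 < admittance n a al.
Proof.
have /andP[x0 x1] := kappa_itv.
have rho1 : 0 <= k * a < 1 by rewrite x0.
have h := @hlog_ge0 R n isT (k * a) rho1 (k * a) ltac:(by rewrite x0 lexx).
by rewrite /admittance mulr_gt0// ltr_pwDl// divr_ge0.
Qed.

Let F := admittance n a al.
Let q (r : R) := (r ^+ (2 * n))^-1.
Let D0 := (par0 al + F) + a ^+ (2 * n) * (par0 al - F).

Let D00 : 0 < D0.
Proof.
have F0 := admittance_gt0; rewrite -/F in F0; have /andP[a0 a1] := a01.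
have q0 : 0 < a ^+ (2 * n) by rewrite exprn_gt0.
have q1 : a ^+ (2 * n) < 1 by rewrite exprn_ilt1// ltW.
rewrite /D0; have -> : par0 al + F + a ^+ (2 * n) * (par0 al - F) =
  par0 al * (1 + a ^+ (2 * n)) + F * (1 - a ^+ (2 * n)) by ring.
by apply: addr_gt0; apply: mulr_gt0 => //; lra.
Qed.

(** Outside, R = [A] r^n + [B] r^-n. Continuity of R and of the flux at r = a fixes the ratio of [A]
    and [B]; [D0] normalises R(1) = 1, and [s] is then dictated by [P a = Q a]. *)
Let A := (par0 al + F) / D0.
Let B := a ^+ (2 * n) * (par0 al - F) / D0.
Let Pa := hser n (k * a).

Let Pa1 : 1 <= Pa. Proof. exact: (@hser_ge1 R n isT (k * a) kappa_itv). Qed.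

Let s := 2 * par0 al / D0 / Pa.
Let P r := s * hser n (k * r).
Let P' r := s * (k * hser1 n (k * r)).
Let Q r := A + B * q r.
Let Q' r := B * (- (2 * n%:R) * q r / r).

Let dX (j : nat) (r : R) : is_derive r 1 (fun r : R => r ^+ j.+1) (j.+1%:R * r ^+ j).
Proof.
split; first exact: exprn_derivable.
by rewrite -derive1E exp_derive1.
Qed.

Let dq (r : R) : 0 < r -> is_derive r 1 q (- (2 * n%:R) * q r / r).
Proof.
move=> r0; have r0' : r ^+ (2 * n) != 0 by rewrite expf_neq0// gt_eqF.
pose f (r : R) := r ^+ (2 * n).
have df : derivable f r 1 by exact: exprn_derivable.
have qE : q = (fun x => (f x)^-1) by [].
rewrite qE; split; first exact: derivableV.
have E : 'D_1 f r = (2 * n)%:R * r ^+ (2 * m).+1.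
  by rewrite -derive1E exp_derive1; congr (_ *: _ ^+ _); rewrite mulnS.
rewrite deriveV// E; transitivity (- (f r) ^- 2 * ((2 * n)%:R * r ^+ (2 * m).+1)) => //.
rewrite /f natrM; have -> : (2 * n = (2 * m).+2)%N by rewrite mulnS.
have rm : r ^+ (2 * m) != 0 by rewrite expf_neq0// gt_eqF.
by rewrite !exprS; field; rewrite rm gt_eqF.
Qed.

Lemma profileP : profile n a al P P' Q Q'.
Proof.
have /andP[a0 a1] := a01.
have dk (r : R) : is_derive r 1 (fun r => k * r) k.
  have -> : (fun r => k * r) = k *: (@idfun R) by [].
  by apply: is_derive_eq; rewrite /GRing.scale/= mulr1.
have dh (r : R) : `|r| <= a -> is_derive r 1 (fun r => hser n (k * r)) (k * hser1 n (k * r)).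
  move=> ra; have h := is_derive1_comp (is_derive_hser (isT : (0 < n)%N) (kr ra)) (dk r).
  by apply: is_derive_eq h _; rewrite mulrC.
have dh1 (r : R) : `|r| <= a -> is_derive r 1 (fun r => hser1 n (k * r)) (k * hser2 n (k * r)).
  move=> ra; have h := is_derive1_comp (is_derive_hser1 (isT : (0 < n)%N) (kr ra)) (dk r).
  by apply: is_derive_eq h _; rewrite mulrC.
have cq (r : R) : 0 < r -> {for r, continuous q}.
  by move=> r0; exact: is_derive_continuous (dq r0).
have qa : a ^+ (2 * n) * q a = 1 by rewrite /q mulfV// expf_neq0// gt_eqF.
have Bqa : B * q a = (par0 al - F) / D0.
  have -> : B * q a = (a ^+ (2 * n) * q a) * ((par0 al - F) / D0).
    by rewrite /B; move: (a ^+ (2 * n)) (q a) => u v; ring.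
  by rewrite qa mul1r.
have D0n : D0 != 0 by rewrite gt_eqF.
have Pan : Pa != 0 by rewrite gt_eqF// (lt_le_trans ltr01).
(* True at 0 as well, where [q x] is 0 by the convention on inverses; this permits an equality of
   functions on the whole line in the proof of [prof_out]. *)
have rQ (x : R) : x * Q' x = - (2 * n%:R) * B * q x.
  rewrite /Q'; have [->|x0] := eqVneq x 0.
    by rewrite mul0r /q expr0n/= invr0 mulr0.
  by field.
have dP (r : R) : `|r| <= a -> is_derive r 1 P (P' r).
  by move=> ra; have h := dh r ra; exact: (is_deriveZ s h).
have dP' (r : R) : `|r| <= a -> is_derive r 1 P' (s * (k * (k * hser2 n (k * r)))).
  move=> ra; have h := is_deriveZ (s * k) (dh1 r ra).
  have -> : P' = (s * k) *: (fun r => hser1 n (k * r)).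
    by apply/funext => x; rewrite /P' mulrA.
  by apply: is_derive_eq h _; rewrite /GRing.scale/= mulrA.
split.
- exact: dP.
- by move=> r ra; exact: is_derive_continuous (dP' r ra).
- move=> r r0; have h := is_deriveZ B (dq r0).
  have := is_deriveD (is_derive_cst A r 1) h; rewrite add0r; exact.
- move=> r r0.
  have ci : {for r, continuous (fun x : R => x^-1)}.
    by apply: inv_continuous; rewrite gt_eqF.
  have cc : {for r, continuous (cst (B * - (2 * n%:R)) : R -> R)} by exact: cst_continuous.
  have h := continuousM cc (continuousM (cq r r0) ci).
  have -> : Q' = cst (B * - (2 * n%:R)) * (q * (fun x : R => x^-1)).
    by apply/funext => x; rewrite /Q' !fctE; ring.
  exact: h.
- rewrite /P /Q -/Pa /s /B -[A + _]/(A + B * q a).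
  rewrite Bqa.
  by rewrite divfK// /A -mulrDl; congr (_ / _); ring.
- by rewrite /Q /q expr1n invr1 mulr1 /A /B -mulrDl divff.
- move=> r /andP[r0 ra].
  have ra' : `|r| <= a by rewrite ger0_norm.
  have hG : is_derive r 1 (fun r => par1 al + par2 al * (a - r)) (- par2 al).
    have h := is_deriveD (is_derive_cst (par1 al) r 1)
      (is_deriveZ (par2 al) (is_deriveB (is_derive_cst a r 1) (is_derive_id r 1))).
    by apply: is_derive_eq h _; rewrite /GRing.scale/=; ring.
  have hV : is_derive r 1 (fun r => n%:R * P r + r * P' r)
      (n%:R * P' r + (P' r + r * (s * (k * (k * hser2 n (k * r)))))).
    have h := is_deriveD (is_deriveZ n%:R (dP r ra')) (is_deriveM (is_derive_id r 1) (dP' r ra')).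
    by apply: is_derive_eq h _; rewrite /GRing.scale/=; ring.
  have h := is_deriveM (dX m r) (is_deriveM hG hV).
  apply: is_derive_eq h _; rewrite /GRing.scale/= !fctE.
  have /eqP := hser_ode (isT : (0 < n)%N) (kr ra'); rewrite -subr_eq0 => /eqP ode.
  (* The differential equation at k r, multiplied by [r ^+ m * (c * s * (k * r))], is inserted as a
     zero; what remains is a polynomial identity. *)
  rewrite -[RHS]addr0 -[X in _ = _ + X](mulr0 (r ^+ m * (c * s * (k * r)))) -ode.
  have -> : par1 al = c - par2 al * a by rewrite /c addrK.
  rewrite -ck /P /P' exprS -[m.+1]/n; move: (n%:R) => N; ring.
- move=> r r0.
  have -> : (fun r => r ^+ n * (par0 al * (n%:R * Q r + r * Q' r))) =
     (fun r => r ^+ n) * ((par0 al * n%:R) *: (cst A - B *: q)).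
    by apply/funext => x; rewrite !fctE/= rQ /Q /GRing.scale/=; ring.
  have h := is_deriveM (dX m r) (is_deriveZ (par0 al * n%:R) (is_deriveB (is_derive_cst A r 1) (is_deriveZ B (dq r0)))).
  apply: is_derive_eq h _; rewrite /GRing.scale/= !fctE/= /Q /GRing.scale/= exprS.
  rewrite -[m.+1]/n; move: (n%:R) (q r) => N u; field; by rewrite gt_eqF.
- rewrite rQ /P /P' /Q.
  have -> : par1 al * (n%:R * (s * hser n (k * a)) + a * (s * (k * hser1 n (k * a)))) = s * n%:R * Pa * F.
    rewrite /F /admittance /hlog -/k -/Pa; field.
    by rewrite Pan andbT pnatr_eq0.
  have -> : n%:R * (A + B * q a) + - (2 * n%:R) * B * q a = n%:R * (A - B * q a) by ring.
  by rewrite Bqa /A /s; field; rewrite D0n Pan.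
- have := rQ 1; rewrite mul1r => ->.
  rewrite /Q /q expr1n invr1 !mulr1 /dn_eigenvalue -/F -/D0 /A /B.
  by field.
Qed.

End exists_profile.

End profile.

(** * Smooth approximation of the solution *)

Section gradient.
Context {R : realType}.

(** Total differentiability with prescribed partial derivatives: unlike partial derivatives alone it
    obeys the chain rule, and [Ck] demands it. *)
Definition gradient_at (f : R * R -> R) (p : R * R) (gx gy : R) :=
  is_diff p f (fun v : R * R => v.1 * gx + v.2 * gy).

Lemma gradient_atP f p gx gy : gradient_at f p gx gy ->
  [/\ differentiable f p, 'D_((1, 0) : R * R) f p = gx & 'D_((0, 1) : R * R) f p = gy].
Proof.
move=> [df E]; split => //; rewrite deriveE// E/=.
  by rewrite mul1r mul0r addr0.
by rewrite mul0r mul1r add0r.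
Qed.

Lemma Ck1_of_gradient (f fx fy : R * R -> R) :
  (forall p, gradient_at f p (fx p) (fy p)) -> continuous fx -> continuous fy -> Ck 1 f.
Proof.
move=> gf cfx cfy.
have E1 : (fun p => 'D_((1, 0) : R * R) f p) = fx.
  by apply/funext => p; case: (gradient_atP (gf p)).
have E2 : (fun p => 'D_((0, 1) : R * R) f p) = fy.
  by apply/funext => p; case: (gradient_atP (gf p)).
split.
- by move=> p; case: (gradient_atP (gf p)).
- by rewrite E1; exact: cfx.
- by rewrite E2; exact: cfy.
Qed.

Lemma gradient_at_eq f p gx gy gx' gy' :
  gradient_at f p gx gy -> gx = gx' -> gy = gy' -> gradient_at f p gx' gy'.
Proof. by move=> h <- <-. Qed.

Lemma gradient_at_cst (c : R) p : gradient_at (fun _ => c) p 0 0.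
Proof.
by apply: is_diff_eq (is_diff_cst c p) _; apply/funext => v; rewrite !mulr0 addr0.
Qed.

Lemma gradient_at_fst p : gradient_at fst p 1 0.
Proof.
have h : is_diff p (fst : R * R -> R) fst.
  split; first exact: linear_differentiable (@continuous_fst R R).
  by apply: diff_lin; exact: continuous_fst.
by apply: is_diff_eq h _; apply/funext => v; rewrite mulr0 mulr1 addr0.
Qed.

Lemma gradient_at_snd p : gradient_at snd p 0 1.
Proof.
have h : is_diff p (snd : R * R -> R) snd.
  split; first exact: linear_differentiable (@continuous_snd R R).
  by apply: diff_lin; exact: continuous_snd.
by apply: is_diff_eq h _; apply/funext => v; rewrite mulr0 mulr1 add0r.
Qed.

Lemma gradient_atD f g p fx fy gx gy :
  gradient_at f p fx fy -> gradient_at g p gx gy ->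
  gradient_at (fun q => f q + g q) p (fx + gx) (fy + gy).
Proof.
move=> df dg; apply: is_diff_eq (is_diffD df dg) _.
by apply/funext => v; rewrite !fctE; ring.
Qed.

Lemma gradient_atB f g p fx fy gx gy :
  gradient_at f p fx fy -> gradient_at g p gx gy ->
  gradient_at (fun q => f q - g q) p (fx - gx) (fy - gy).
Proof.
move=> df dg; apply: is_diff_eq (is_diffB df dg) _.
by apply/funext => v; rewrite !fctE; ring.
Qed.

Lemma gradient_atM f g p fx fy gx gy :
  gradient_at f p fx fy -> gradient_at g p gx gy ->
  gradient_at (fun q => f q * g q) p (fx * g p + f p * gx) (fy * g p + f p * gy).
Proof.
move=> df dg; apply: is_diff_eq (is_diffM df dg) _.
by apply/funext => v; rewrite !fctE /GRing.scale/=; ring.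
Qed.

Lemma gradient_at_comp (g : R -> R) (f : R * R -> R) p (g' fx fy : R) :
  is_derive (f p) 1 g g' -> gradient_at f p fx fy ->
  gradient_at (fun q => g (f q)) p (g' * fx) (g' * fy).
Proof.
move=> [dg gE] df.
have dg' : differentiable g (f p) by exact/derivable1_diffP.
have h : is_diff (f p) g ('d g (f p)) by split.
apply: is_diff_eq (is_diff_comp df h) _; apply/funext => v /=.
have -> : v.1 * fx + v.2 * fy = (v.1 * fx + v.2 * fy) *: (1 : R) by rewrite /GRing.scale/= mulr1.
rewrite linearZ/= -deriveE// gE /GRing.scale/=; ring.
Qed.

(* The real and imaginary parts of [(A - i B) (x + i y) ^ n]. *)
Fixpoint harmonic_pair (A B : R) (n : nat) (p : R * R) : R * R :=
  if n is m.+1 then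
    let z := harmonic_pair A B m p in (p.1 * z.1 - p.2 * z.2, p.1 * z.2 + p.2 * z.1)
  else (A, - B).

Definition harm A B n p := (harmonic_pair A B n p).1.
Definition harmk A B n p := (harmonic_pair A B n p).2.

Lemma harm_polar (A B : R) n (t x : R) :
  harm A B n (t * cos x, t * sin x) = t ^+ n * trigc A B n x /\
  harmk A B n (t * cos x, t * sin x) = t ^+ n * trigs A B n x.
Proof.
rewrite /harm /harmk; elim: n => [|n [IH1 IH2]].
  by rewrite /trigc /trigs /= !mul0r cos0 sin0; split; ring.
rewrite /= IH1 IH2 /trigc /trigs -natr1 mulrDl mul1r cosD sinD exprS.
by split; ring.
Qed.

(** Cauchy-Riemann: the x-derivative of z^(n+1) is (n + 1) z^n, and the y-derivative is i times
    that. *)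
Lemma harm_gradient (A B : R) n p :
  gradient_at (harm A B n.+1) p (n.+1%:R * harm A B n p) (- (n.+1%:R * harmk A B n p)) /\
  gradient_at (harmk A B n.+1) p (n.+1%:R * harmk A B n p) (n.+1%:R * harm A B n p).
Proof.
have g1 := gradient_at_fst p; have g2 := gradient_at_snd p.
elim: n => [|n [IH1 IH2]]; rewrite /harm /harmk.
  have cA := gradient_at_cst A p; have cB := gradient_at_cst (- B) p.
  split.
    by apply: gradient_at_eq (gradient_atB (gradient_atM g1 cA) (gradient_atM g2 cB)) _ _ => /=; ring.
  by apply: gradient_at_eq (gradient_atD (gradient_atM g1 cB) (gradient_atM g2 cA)) _ _ => /=; ring.
split.
  apply: gradient_at_eq (gradient_atB (gradient_atM g1 IH1) (gradient_atM g2 IH2)) _ _;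
    by rewrite /harm /harmk /= -!natr1; ring.
apply: gradient_at_eq (gradient_atD (gradient_atM g1 IH2) (gradient_atM g2 IH1)) _ _;
  by rewrite /harm /harmk /= -!natr1; ring.
Qed.

Lemma harm_continuous (A B : R) n : continuous (harm A B n) /\ continuous (harmk A B n).
Proof.
rewrite /harm /harmk; elim: n => [|n [IH1 IH2]].
  by split; [exact: (@continuous_cst _ _ A)|exact: (@continuous_cst _ _ (- B))].
have c1 := @continuous_fst R R; have c2 := @continuous_snd R R.
split.
  exact: (continuous_funB (continuous_funM c1 IH1) (continuous_funM c2 IH2)).
exact: (continuous_funD (continuous_funM c1 IH2) (continuous_funM c2 IH1)).
Qed.

Lemma continuous_bounded_disk (g : R * R -> R) : continuous g ->
  exists2 K : R, 0 <= K & forall p, disk p -> `|g p| <= K.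
Proof.
move=> cg.
have csq : compact (`[(-1)%R, 1%R] `*` `[(-1)%R, 1%R] : set (R * R)).
  by apply: compact_setX; exact: segment_compact.
have [K [_ KG]] : bounded_set (g @` (`[(-1)%R, 1%R] `*` `[(-1)%R, 1%R])).
  apply: compact_bounded; apply: continuous_compact csq.
  exact: continuous_subspaceT.
exists (`|K| + 1); first by rewrite addr_ge0.
move=> p /disk_le1[h1 h2]; apply: (KG (`|K| + 1)).
  by rewrite (le_lt_trans (ler_norm _))// ltrDl.
by exists p => //; split; rewrite /= in_itv/= -ler_norml.
Qed.

(** The disk has finite measure, so a uniform bound and convergence at every point suffice, with the
    constant (K + K)^2 as dominating function. This is also how the gradient of the solution is seen
    to be measurable and bounded. *)
Lemma L2_dominated_cvg (f_ : nat -> R * R -> R) (f : R * R -> R) (K : R) :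
  (forall k, measurable_fun (@disk R : set (@plane R)) (f_ k : @plane R -> measurableTypeR R)) ->
  (forall k p, disk p -> `|f_ k p| <= K) ->
  (forall p, disk p -> f_ ^~ p @ \oo --> f p) ->
  [/\ measurable_fun (@disk R : set (@plane R)) (f : @plane R -> measurableTypeR R),
      forall p, disk p -> `|f p| <= K &
      (fun k => \int[@mu2 R]_(p in @disk R) ((f_ k p - f p) ^+ 2)%:E)%E @ \oo --> 0%E].
Proof.
move=> mf_ bf_ cf.
have mf : measurable_fun (@disk R : set (@plane R)) (f : @plane R -> measurableTypeR R).
  apply: (measurable_fun_cvg mf_) => p dp; exact: cf.
have bf p : disk p -> `|f p| <= K.
  move=> dp; have c : (fun k => `|f_ k p|) @ \oo --> `|f p| by apply: cvg_norm; exact: cf.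
  rewrite -(cvg_lim (@Rhausdorff R) c); apply: limr_le.
    by apply/cvg_ex; eexists; exact: c.
  by apply: nearW => k; exact: bf_.
split=> //.
pose g_ k (p : @plane R) := ((f_ k p - f p) ^+ 2)%:E.
have mg_ k : measurable_fun (@disk R : set (@plane R)) (g_ k).
  by apply/measurable_EFinP; apply: measurable_funX; exact: (measurable_funB (mf_ k) mf).
have K0 : 0 <= K.
  apply: le_trans (bf (0, 0) _); first exact: normr_ge0.
  by rewrite /disk/= /Defs.radius/= expr0n/= addr0 sqrtr0.
have [] := @dominated_convergence _ _ R (@mu2 R) _ measurable_disk g_ (cst 0%E)
   (cst ((K + K) ^+ 2)%:E) mg_.
- exact: measurable_cst.
- apply: aeW => p dp; rewrite /g_.
  apply: cvg_EFin; first exact: nearW.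
  rewrite (_ : 0 = (f p - f p) ^+ 2); last by rewrite subrr expr0n.
  have c : (fun k => f_ k p - f p) @ \oo --> f p - f p.
    by apply: cvgB; [exact: cf|exact: cvg_cst].
  exact: (cvgM c c).
- apply: (@bounded_integrable_disk _ (fun => (K + K) ^+ 2) ((K + K) ^+ 2)).
    exact: measurable_cst.
  by move=> p _; rewrite ger0_norm// sqr_ge0.
- apply: aeW => p k dp; rewrite /g_ /= lee_fin ger0_norm ?sqr_ge0//.
  have h1 := bf p dp; have h2 := bf_ k p dp.
  rewrite -[leLHS]ger0_norm ?sqr_ge0// normrX lerXn2r ?nnegrE ?addr_ge0//.
  by rewrite (le_trans (ler_normB _ _))// addrC lerD.
move=> _ _; under eq_cvg => k do rewrite /=; rewrite integral0; exact.
Qed.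

End gradient.

Section smoothing.
Context {R : realType}.

(* [kink d] is a smooth version of [max 0], at scale [d ^+ 2]; its argument is
   shifted by [d] so that its slope tends to 1 also at the kink itself. *)
Definition kroot (d s : R) := Num.sqrt (s ^+ 2 + d ^+ 4).
Definition kink (d s : R) := (s + kroot d s) / 2.
Definition slope (d s : R) := (1 + s / kroot d s) / 2.

Variable d : R.
Hypothesis d0 : 0 < d.

Let arg0 (s : R) : 0 < s ^+ 2 + d ^+ 4.
Proof. by rewrite ltr_wpDl ?sqr_ge0// exprn_gt0. Qed.

Lemma kroot_gt0 (s : R) : 0 < kroot d s. Proof. by rewrite sqrtr_gt0. Qed.

Lemma kroot_ge (s : R) : `|s| <= kroot d s.
Proof. by rewrite -sqrtr_sqr /kroot ler_sqrt ?lerDl ?exprn_ge0// ltW. Qed.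

Lemma kroot_le (s : R) : kroot d s <= `|s| + d ^+ 2.
Proof.
have d2 : 0 <= d ^+ 2 by rewrite sqr_ge0.
rewrite -[leRHS]ger0_norm ?addr_ge0// -sqrtr_sqr /kroot ler_sqrt ?sqr_ge0//.
rewrite sqrrD real_normK ?num_real// -exprM -addrA lerD2l lerDr.
by rewrite mulrn_wge0// mulr_ge0.
Qed.

Lemma continuous_kroot : continuous (kroot d).
Proof.
apply: (continuous_compose _ (@sqrt_continuous R)); apply: continuous_funD.
  by apply: continuous_funX; exact: continuous_idfun.
exact: continuous_cst.
Qed.

Lemma continuous_slope : continuous (slope d).
Proof.
apply: continuous_funM; last exact: continuous_cst.
apply: continuous_funD; first exact: continuous_cst.
apply: continuous_funM; first exact: continuous_idfun.
apply: continuous_funV; last exact: continuous_kroot.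
by move=> s; rewrite gt_eqF// kroot_gt0.
Qed.

Lemma is_derive_kink (s : R) : is_derive s 1 (kink d) (slope d s).
Proof.
have h1 : is_derive s 1 (fun s : R => s ^+ 2 + d ^+ 4) (2 * s).
  have h := is_deriveD (is_deriveM (is_derive_id s 1) (is_derive_id s 1)) (is_derive_cst (d ^+ 4) s 1).
  have -> : (fun s : R => s ^+ 2 + d ^+ 4) = (@idfun R * @idfun R) + cst (d ^+ 4).
    by apply/funext => x; rewrite !fctE expr2.
  by apply: is_derive_eq h _; rewrite /GRing.scale/=; ring.
have h2 := @is_derive1_comp R Num.sqrt (fun s : R => s ^+ 2 + d ^+ 4) s _ _ (is_derive1_sqrt (arg0 s)) h1.
have h := is_deriveZ (2^-1) (is_deriveD (is_derive_id s 1) h2).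
have -> : kink d = 2^-1 *: (@idfun R + (Num.sqrt \o (fun s : R => s ^+ 2 + d ^+ 4))).
  by apply/funext => x; rewrite /kink mulrC.
apply: is_derive_eq h _; rewrite /GRing.scale/= /slope -/(kroot d s).
by have := kroot_gt0 s; move=> k0; field; rewrite gt_eqF.
Qed.

Lemma slope_itv (s : R) : 0 <= slope d s <= 1.
Proof.
have k0 := kroot_gt0 s; have := kroot_ge s; rewrite ler_norml => /andP[h1 h2].
rewrite /slope; have : -1 <= s / kroot d s <= 1.
  by rewrite ler_pdivlMr// ler_pdivrMr// mulN1r mul1r h1.
by lra.
Qed.

Lemma kink_bounds (s : R) : kink d s >= 0 /\ s <= kink d s /\ kink d s <= Num.max s 0 + d ^+ 2.
Proof.
have h1 := kroot_ge s; have h2 := kroot_le s; have d2 : 0 <= d ^+ 2 by rewrite sqr_ge0.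
rewrite /kink; have [s0|s0] := leP 0 s.
  by move: h1 h2; rewrite ger0_norm// => h1 h2; split; [|split]; lra.
by move: h1 h2; rewrite ltr0_norm// => h1 h2; split; [|split]; lra.
Qed.

(** For s >= d one has d^4 <= d^2 s^2, so [kroot d s] is at most s (1 + d). This is where the
    smoothing scale d^2 has to be small compared with the shift d. *)
Lemma slope_ge (s : R) : d <= s -> 1 - d <= slope d s.
Proof.
move=> ds; have s0 : 0 < s by exact: lt_le_trans d0 ds.
have k0 := kroot_gt0 s.
have : kroot d s <= s * (1 + d).
  rewrite -[leRHS]ger0_norm; last by rewrite mulr_ge0 ?addr_ge0 // ltW.
  rewrite -sqrtr_sqr /kroot ler_sqrt ?sqr_ge0//.
  have e : d ^+ 4 = d ^+ 2 * d ^+ 2 by rewrite -exprD.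
  have : d ^+ 2 <= s ^+ 2 by apply: lerXn2r; rewrite ?nnegrE // ltW.
  rewrite e; set u := d ^+ 2; set v := s ^+ 2 => uv.
  have u0 : 0 <= u by rewrite sqr_ge0.
  have -> : (s * (1 + d)) ^+ 2 = v * (1 + 2 * d + u) by rewrite /u /v; ring.
  have p1 : 0 <= (v - u) * u by rewrite mulr_ge0 // subr_ge0.
  have p2 : 0 <= v * d by rewrite mulr_ge0 ?sqr_ge0 // ltW.
  lra.
move=> kle; rewrite /slope.
have : (1 - d) <= s / kroot d s.
  rewrite ler_pdivlMr//; have : (1 - d) * (1 + d) <= 1 by nra.
  have [d1|d1] := leP d 1; nra.
have d0p : 0 < d by []. lra.
Qed.

End smoothing.

Section approximation.
Context {R : realType}.

Lemma bounded_on_itv (f : R -> R) (b c : R) :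
  (forall r, b <= r <= c -> {for r, continuous f}) ->
  exists2 K : R, 0 <= K & forall r, b <= r <= c -> `|f r| <= K.
Proof.
move=> cf.
have wf : {within `[b, c], continuous f}.
  by apply: continuous_in_subspaceT => t; rewrite inE/= in_itv/=; exact: cf.
have [K [_ Kf]] : bounded_set (f @` `[b, c]).
  apply: compact_bounded; apply: continuous_compact => //; exact: segment_compact.
exists (`|K| + 1); first by rewrite addr_ge0.
move=> r rbc; apply: (Kf (`|K| + 1)).
  by rewrite (le_lt_trans (ler_norm _))// ltrDl.
by exists r => //; rewrite /= in_itv.
Qed.

Variables (n : nat) (a : R) (al : @param R) (P P' Q Q' : R -> R).
Hypothesis a01 : 0 < a < 1.
Hypothesis prof : profile n a al P P' Q Q'.

Definition radial_part (r : R) := if r < a then P r else Q r.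
Definition radial_deriv (r : R) := if r < a then P' r else Q' r.

Let a0 : 0 < a. Proof. by case/andP: a01. Qed.
Let a1 : a < 1. Proof. by case/andP: a01. Qed.

(* [srad d], [mn d] and [mx d] are smooth versions of [r], [min r a] and [max r a], so that
   [T0 d] is a smooth version of [radial_part r]. *)
Let srad (d : R) (p : R * R) := Num.sqrt (p.1 ^+ 2 + p.2 ^+ 2 + d ^+ 2).
Let sarg (d : R) (p : R * R) := srad d p - a + d.
Let mn (d : R) (p : R * R) := srad d p - kink d (sarg d p).
Let mx (d : R) (p : R * R) := a + kink d (sarg d p).
Let T0 (d : R) (p : R * R) := P (mn d p) + Q (mx d p) - Q a.
Let Tr (d : R) (p : R * R) :=
  P' (mn d p) * (1 - slope d (sarg d p)) + Q' (mx d p) * slope d (sarg d p).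

Section fixed_scale.
Variable d : R.
Hypothesis d0 : 0 < d.
Hypothesis da : d <= a / 2.

Let arg0 (p : R * R) : 0 < p.1 ^+ 2 + p.2 ^+ 2 + d ^+ 2.
Proof. by rewrite ltr_wpDl ?exprn_gt0// addr_ge0// sqr_ge0. Qed.

Let srad_gt0 p : 0 < srad d p. Proof. by rewrite sqrtr_gt0. Qed.

Let srad_ged (p : R * R) : d <= srad d p.
Proof.
apply: (@le_trans _ _ (Num.sqrt (d ^+ 2))); first by rewrite sqrtr_sqr ger0_norm// ltW.
by rewrite /srad ler_sqrt ?lerDr ?addr_ge0 ?sqr_ge0// ltW.
Qed.

Let srad_ge1 (p : R * R) : `|p.1| <= srad d p.
Proof.
rewrite -sqrtr_sqr /srad ler_sqrt; last exact: ltW.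
by rewrite -addrA lerDl addr_ge0// sqr_ge0.
Qed.

Let srad_ge2 (p : R * R) : `|p.2| <= srad d p.
Proof.
rewrite -sqrtr_sqr /srad ler_sqrt; last exact: ltW.
by rewrite addrAC lerDr addr_ge0// sqr_ge0.
Qed.

Let srad_le (p : R * R) : Defs.radius p <= 1 -> srad d p <= 1 + d.
Proof.
move=> dp; rewrite -[leRHS]ger0_norm; last by rewrite addr_ge0// ltW.
rewrite -sqrtr_sqr /srad ler_sqrt ?sqr_ge0//.
have : p.1 ^+ 2 + p.2 ^+ 2 <= 1.
  by move: dp; rewrite /Defs.radius -[leRHS]sqrtr1 ler_sqrt.
have d0' : 0 < d by []; rewrite sqrrD expr1n mul1r => h.
rewrite -mulr_natl; lra.
Qed.

Let d1 : d < 2^-1.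
Proof. by have h1 := a1; have h2 := da; lra. Qed.

Let d2d : d ^+ 2 <= d / 2.
Proof.
by have h1 := d1; have h2 : 0 < d by []; rewrite expr2 ler_pM2l// ltW.
Qed.

(** [P] is controlled for |r| <= a only, so the smoothed minimum must lie in [0, a] exactly. The
    upper bound follows from [kink d s >= s] at the shifted argument, the lower one from
    [srad d p >= d], [d <= a / 2] and [d ^+ 2 <= d / 2]. *)
Let mn_itv p : 0 <= mn d p <= a.
Proof.
have [k0 [k1 k2]] := kink_bounds d0 (sarg d p).
have h1 := srad_ged p; have h2 := d2d; have h3 := da; have h4 := a0.
move: k0 k1 k2; rewrite /mn; set K := kink _ _; rewrite /sarg => k0 k1 k2.
have d0' : 0 < d by [].
move: k2; have [s0|s0] := leP (srad d p - a + d) 0 => k2; apply/andP; split; lra.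
Qed.

Let mx_ge p : a <= mx d p.
Proof. by have [k0 _] := kink_bounds d0 (sarg d p); rewrite /mx lerDl. Qed.

(** [srad] is at most 1 + d, the shift adds d and the kink d^2; with d < 1/2 the total stays below
    3. This is why [Q] is bounded on [a, 3] rather than on [a, 1]. *)
Let mx_le (p : R * R) : Defs.radius p <= 1 -> mx d p <= 3.
Proof.
move=> dp; have [k0 [k1 k2]] := kink_bounds d0 (sarg d p).
have h1 := srad_le dp; have h2 := d2d; have h3 := d1; have h4 := a0; have h5 := a1.
have d0' : 0 < d by [].
move: k0 k1 k2; rewrite /mx; set K := kink _ _; rewrite /sarg => k0 k1 k2.
move: k2; have [s0|s0] := leP (srad d p - a + d) 0 => k2; lra.
Qed.

Let mn_norm p : `|mn d p| <= a.
Proof. by have /andP[h1 h2] := mn_itv p; rewrite ger0_norm. Qed.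

Let mx_gt0 p : 0 < mx d p. Proof. exact: lt_le_trans a0 (mx_ge p). Qed.

Let srad_gradient p : gradient_at (srad d) p (p.1 / srad d p) (p.2 / srad d p).
Proof.
have g1 := gradient_at_fst p; have g2 := gradient_at_snd p.
have g := gradient_atD (gradient_atD (gradient_atM g1 g1) (gradient_atM g2 g2)) (gradient_at_cst (d ^+ 2) p).
have E : (fun q : R * R => q.1 * q.1 + q.2 * q.2 + d ^+ 2) = (fun q => q.1 ^+ 2 + q.2 ^+ 2 + d ^+ 2).
  by apply/funext => q; rewrite !expr2.
rewrite E in g.
have g' := @gradient_at_comp R Num.sqrt _ p _ _ _ (is_derive1_sqrt (arg0 p)) g.
by apply: (@gradient_at_eq R (srad d) p _ _ _ _ g'); rewrite -/(srad d p); field; rewrite gt_eqF.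
Qed.

Let T0_gradient p : gradient_at (T0 d) p (Tr d p * (p.1 / srad d p)) (Tr d p * (p.2 / srad d p)).
Proof.
have gs := srad_gradient p.
have gsa : gradient_at (sarg d) p (p.1 / srad d p) (p.2 / srad d p).
  apply: gradient_at_eq (gradient_atD (gradient_atB gs (gradient_at_cst a p)) (gradient_at_cst d p)) _ _; ring.
have gk := gradient_at_comp (is_derive_kink d0 (sarg d p)) gsa.
have gmn := gradient_atB gs gk.
have gmx := gradient_atD (gradient_at_cst a p) gk.
have gP := gradient_at_comp (prof_dP prof (mn_norm p)) gmn.
have gQ := gradient_at_comp (prof_dQ prof (mx_gt0 p)) gmx.
have g := gradient_atB (gradient_atD gP gQ) (gradient_at_cst (Q a) p).
by apply: gradient_at_eq g _ _; rewrite /Tr; ring.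
Qed.

Let csrad : continuous (srad d).
Proof. by move=> p; have [df _ _] := gradient_atP (srad_gradient p); exact: differentiable_continuous. Qed.

Let csarg : continuous (sarg d).
Proof.
apply: continuous_funD; last exact: continuous_cst.
by apply: continuous_funB; [exact: csrad|exact: continuous_cst].
Qed.

Let ckink : continuous (fun p => kink d (sarg d p)).
Proof.
apply: (continuous_compose csarg) => s; exact: (is_derive_continuous (is_derive_kink d0 s)).
Qed.

Let cslope : continuous (fun p => slope d (sarg d p)).
Proof. exact: (continuous_compose csarg (continuous_slope d0)). Qed.

Let cTr : continuous (Tr d).
Proof.
have cmn : continuous (mn d) by apply: continuous_funB; [exact: csrad|exact: ckink].
have cmx : continuous (mx d) by apply: continuous_funD; [exact: continuous_cst|exact: ckink].
have c1 : continuous (fun p => P' (mn d p)).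
  by move=> p; apply: (@continuous_comp _ _ _ (mn d) P'); [exact: cmn|exact: (prof_cP prof (mn_norm p))].
have c2 : continuous (fun p => Q' (mx d p)).
  by move=> p; apply: (@continuous_comp _ _ _ (mx d) Q'); [exact: cmx|exact: (prof_cQ prof (mx_gt0 p))].
apply: continuous_funD; apply: continuous_funM.
- exact: c1.
- by apply: continuous_funB; [exact: continuous_cst|exact: cslope].
- exact: c2.
- exact: cslope.
Qed.

Let cTx (e : R * R -> R) : continuous e -> continuous (fun p => Tr d p * (e p / srad d p)).
Proof.
move=> ce; apply: continuous_funM; first exact: cTr.
apply: continuous_funM; first exact: ce.
by apply: continuous_funV; [move=> p; rewrite gt_eqF|exact: csrad].
Qed.

Lemma smoothing_fixed_scale (KP KQ : R) :
  (forall r, 0 <= r <= a -> `|P r| <= KP /\ `|P' r| <= KP) ->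
  (forall r, a <= r <= 3 -> `|Q r| <= KQ /\ `|Q' r| <= KQ) ->
  [/\ forall p, gradient_at (T0 d) p (Tr d p * (p.1 / srad d p)) (Tr d p * (p.2 / srad d p)),
      continuous (fun p => Tr d p * (p.1 / srad d p)) /\
      continuous (fun p => Tr d p * (p.2 / srad d p)),
      forall p, Defs.radius p <= 1 -> `|T0 d p| <= KP + KQ + KQ,
      forall p, Defs.radius p <= 1 -> `|Tr d p * (p.1 / srad d p)| <= KP + KQ &
      forall p, Defs.radius p <= 1 -> `|Tr d p * (p.2 / srad d p)| <= KP + KQ].
Proof.
move=> HP HQ.
have TrK p : Defs.radius p <= 1 -> `|Tr d p| <= KP + KQ.
  move=> dp; have [_ hP] := HP _ (mn_itv p).
  have [_ hQ] := HQ (mx d p) ltac:(by rewrite mx_ge mx_le).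
  have /andP[s0 s1] := slope_itv d0 (sarg d p).
  rewrite /Tr (le_trans (ler_normD _ _))// (normrM (P' _)) (normrM (Q' _)).
  apply: lerD.
    rewrite (@ger0_norm _ (1 - _)) ?subr_ge0//.
    by apply: le_trans hP; rewrite ler_piMr// gerBl.
  by rewrite (ger0_norm s0); apply: le_trans hQ; rewrite ler_piMr.
have small (p : R * R) (e : R) : `|e| <= srad d p -> `|e / srad d p| <= 1.
  move=> h; rewrite normrM normfV (gtr0_norm (srad_gt0 p)).
  by rewrite ler_pdivrMr// mul1r.
split.
- exact: T0_gradient.
- by split; apply: cTx; [exact: continuous_fst|exact: continuous_snd].
- move=> p dp; have [hP _] := HP _ (mn_itv p).
  have [hQ _] := HQ (mx d p) ltac:(by rewrite mx_ge mx_le).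
  have [hQa _] := HQ a ltac:(by rewrite lexx/= (le_trans (ltW a1))// ler1n).
  rewrite /T0 (le_trans (ler_normB _ _))// lerD// (le_trans (ler_normD _ _))// lerD//.
- move=> p dp; rewrite normrM -[leRHS]mulr1; apply: ler_pM => //; first exact: TrK.
  by apply: small; exact: srad_ge1.
- move=> p dp; rewrite normrM -[leRHS]mulr1; apply: ler_pM => //; first exact: TrK.
  by apply: small; exact: srad_ge2.
Qed.

End fixed_scale.

Let dl (k : nat) : R := a / k.+2%:R.

Let dl0 k : 0 < dl k. Proof. by rewrite divr_gt0. Qed.

Let dla k : dl k <= a / 2.
Proof. by rewrite /dl ler_pM2l// lef_pV2 ?posrE// ler_nat. Qed.

Let cdl : dl @ \oo --> 0.
Proof.
rewrite -(mulr0 a); apply: cvgZl_tmp.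
have := @cvg_harmonic R; rewrite -cvg_shiftS; exact.
Qed.

Section limits.
Variable p : R * R.
Let r := Defs.radius p.

Let csrad : (fun k => srad (dl k) p) @ \oo --> r.
Proof.
have h : (fun k => p.1 ^+ 2 + p.2 ^+ 2 + dl k ^+ 2) @ \oo --> p.1 ^+ 2 + p.2 ^+ 2.
  rewrite -[X in _ --> X]addr0 -(mulr0 0); apply: cvgD; first exact: cvg_cst.
  exact: (cvgM cdl cdl).
exact: (continuous_cvg _ (@sqrt_continuous R _) h).
Qed.

Let csarg : (fun k => sarg (dl k) p) @ \oo --> r - a.
Proof.
rewrite -[X in _ --> X]addr0; apply: cvgD; last exact: cdl.
by apply: cvgB; [exact: csrad|exact: cvg_cst].
Qed.

Let ckroot : (fun k => kroot (dl k) (sarg (dl k) p)) @ \oo --> `|r - a|.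
Proof.
have h : (fun k => sarg (dl k) p ^+ 2 + dl k ^+ 4) @ \oo --> (r - a) ^+ 2.
  rewrite -[X in _ --> X]addr0; apply: cvgD; first exact: (cvgM csarg csarg).
  have c2 : (fun k => dl k * dl k) @ \oo --> 0 by rewrite -[X in _ --> X](mulr0 0); exact: (cvgM cdl cdl).
  have -> : (fun k => dl k ^+ 4) = (fun k => (dl k * dl k) * (dl k * dl k)).
    by apply/funext => k; ring.
  by rewrite -[X in _ --> X](mulr0 0); exact: (cvgM c2 c2).
rewrite -sqrtr_sqr; exact: (continuous_cvg _ (@sqrt_continuous R _) h).
Qed.

Let ckink : (fun k => kink (dl k) (sarg (dl k) p)) @ \oo --> ((r - a) + `|r - a|) / 2.
Proof. by apply: cvgMr_tmp; apply: cvgD; [exact: csarg|exact: ckroot]. Qed.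

(** For r >= a the shifted argument is at least [dl k], which squeezes the slope between 1 - [dl k]
    and 1. The limit agrees with the case distinction in [radial_deriv] on the circle r = a too, so
    convergence holds at every point. *)
Let cslope : (fun k => slope (dl k) (sarg (dl k) p)) @ \oo --> (if r < a then 0 else 1 : R).
Proof.
have [ra|ra] := ltP r a.
  have -> : 0 = (1 + (r - a) / `|r - a|) / 2 :> R.
    by rewrite ltr0_norm ?subr_lt0// invrN mulrN divff ?subr_eq0 ?lt_eqF// subrr mul0r.
  apply: cvgMr_tmp; apply: cvgD; first exact: cvg_cst.
  apply: cvgM; first exact: csarg.
  by apply: cvgV; [rewrite normr_eq0 subr_eq0 lt_eqF|exact: ckroot].
apply: (@squeeze_cvgr _ _ _ _ (fun k => 1 - dl k) (fun _ => 1)).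
- apply: nearW => k; have /andP[_ ->] := slope_itv (dl0 k) (sarg (dl k) p).
  rewrite andbT; apply: slope_ge => //; rewrite /sarg lerDr subr_ge0 (le_trans ra)//.
  rewrite /r /Defs.radius /srad ler_sqrt ?lerDl ?sqr_ge0//.
  by rewrite !addr_ge0// sqr_ge0.
- by rewrite -[X in _ --> X]subr0; apply: cvgB; [exact: cvg_cst|exact: cdl].
- exact: cvg_cst.
Qed.

Let r0 : 0 <= r. Proof. exact: radius_ge0. Qed.

Let cmn : (fun k => mn (dl k) p) @ \oo --> (if r < a then r else a).
Proof.
have -> : (if r < a then r else a) = r - ((r - a) + `|r - a|) / 2.
  have [ra|ra] := ltP r a; first by rewrite ltr0_norm ?subr_lt0//; field.
  by rewrite ger0_norm ?subr_ge0//; field.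
by apply: cvgB; [exact: csrad|exact: ckink].
Qed.

Let cmx : (fun k => mx (dl k) p) @ \oo --> (if r < a then a else r).
Proof.
have -> : (if r < a then a else r) = a + ((r - a) + `|r - a|) / 2.
  have [ra|ra] := ltP r a; first by rewrite ltr0_norm ?subr_lt0//; field.
  by rewrite ger0_norm ?subr_ge0//; field.
by apply: cvgD; [exact: cvg_cst|exact: ckink].
Qed.

Let r1E : `|if r < a then r else a| <= a.
Proof. by have [ra|ra] := ltP r a; rewrite ger0_norm// ltW. Qed.

Let r2E : 0 < (if r < a then a else r).
Proof. by have [ra|ra] := ltP r a; [exact: a0|exact: lt_le_trans a0 ra]. Qed.

Lemma smoothing_cvg : (fun k => T0 (dl k) p) @ \oo --> radial_part r.
Proof.
have -> : radial_part r = P (if r < a then r else a) + Q (if r < a then a else r) - Q a.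
  rewrite /radial_part; have [ra|ra] := ltP r a; first by rewrite addrK.
  by rewrite (prof_glue prof) addrAC subrr add0r.
apply: cvgB; last exact: cvg_cst; apply: cvgD.
  exact: (continuous_cvg _ (is_derive_continuous (prof_dP prof r1E)) cmn).
exact: (continuous_cvg _ (is_derive_continuous (prof_dQ prof r2E)) cmx).
Qed.

Let cTr : (fun k => Tr (dl k) p) @ \oo --> radial_deriv r.
Proof.
have -> : radial_deriv r = P' (if r < a then r else a) * (1 - (if r < a then 0 else 1)) +
   Q' (if r < a then a else r) * (if r < a then 0 else 1).
  rewrite /radial_deriv; have [ra|ra] := ltP r a; ring.
apply: cvgD; apply: cvgM.
- exact: (continuous_cvg _ (prof_cP prof r1E) cmn).
- by apply: cvgB; [exact: cvg_cst|exact: cslope].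
- exact: (continuous_cvg _ (prof_cQ prof r2E) cmx).
- exact: cslope.
Qed.

Lemma smoothing_deriv_cvg (e : R) : `|e| <= r ->
  (fun k => Tr (dl k) p * (e / srad (dl k) p)) @ \oo --> radial_deriv r * (e / r).
Proof.
(* At the origin [e] is 0, so all terms and the limit vanish although the direction of p is
   undefined there. *)
move=> er; have [r00|rn0] := eqVneq r 0.
  have -> : e = 0 by move: er; rewrite r00 normr_le0 => /eqP.
  rewrite mul0r mulr0; under eq_cvg do rewrite mul0r mulr0; exact: cvg_cst.
apply: cvgM; first exact: cTr.
by apply: cvgM; [exact: cvg_cst|apply: cvgV; [|exact: csrad]].
Qed.

End limits.

Lemma smooth_approximation : exists (T Tx Ty : nat -> R * R -> R) (K : R),
  [/\ forall k, [/\ forall p, gradient_at (T k) p (Tx k p) (Ty k p),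
        continuous (Tx k) & continuous (Ty k)],
      forall k x, T k (cos x, sin x) = 1,
      forall k p, disk p -> [/\ `|T k p| <= K, `|Tx k p| <= K & `|Ty k p| <= K] &
      forall p, disk p -> let r := Defs.radius p in
        [/\ T ^~ p @ \oo --> radial_part r,
            Tx ^~ p @ \oo --> radial_deriv r * (p.1 / r) &
            Ty ^~ p @ \oo --> radial_deriv r * (p.2 / r)]].
Proof.
have nr (r : R) : 0 <= r <= a -> `|r| <= a by move=> /andP[? ?]; rewrite ger0_norm.
have pr (r : R) : a <= r <= 3 -> 0 < r by move=> /andP[ar _]; exact: lt_le_trans a0 ar.
have [K1 K10 H1] := bounded_on_itv (fun r ri => is_derive_continuous (prof_dP prof (nr r ri))).
have [K2 K20 H2] := bounded_on_itv (fun r ri => prof_cP prof (nr r ri)).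
have [K3 K30 H3] := bounded_on_itv (fun r ri => is_derive_continuous (prof_dQ prof (pr r ri))).
have [K4 K40 H4] := bounded_on_itv (fun r ri => prof_cQ prof (pr r ri)).
have HP r : 0 <= r <= a -> `|P r| <= K1 + K2 /\ `|P' r| <= K1 + K2.
  by move=> ri; rewrite (le_trans (H1 r ri)) ?lerDl// (le_trans (H2 r ri)) ?lerDr.
have HQ r : a <= r <= 3 -> `|Q r| <= K3 + K4 /\ `|Q' r| <= K3 + K4.
  by move=> ri; rewrite (le_trans (H3 r ri)) ?lerDl// (le_trans (H4 r ri)) ?lerDr.
set KP := K1 + K2 in HP; set KQ := K3 + K4 in HQ.
have KP0 : 0 <= KP by exact: addr_ge0.
have KQ0 : 0 <= KQ by exact: addr_ge0.
have F k := smoothing_fixed_scale (dl0 k) (dla k) HP HQ.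
have rad1 : Defs.radius ((1, 0) : R * R) = 1.
  by rewrite /Defs.radius/= expr0n/= addr0 expr1n sqrtr1.
(* [T0 (dl k)] is constant on the unit circle. Adding its difference from 1 makes the boundary
   values exact for every k, leaves the gradient unchanged, and tends to 0 because [Q 1 = 1]. *)
exists (fun k p => T0 (dl k) p + (1 - T0 (dl k) (1, 0))),
  (fun k p => Tr (dl k) p * (p.1 / srad (dl k) p)),
  (fun k p => Tr (dl k) p * (p.2 / srad (dl k) p)), ((KP + KQ + KQ) + (1 + (KP + KQ + KQ))).
split.
- move=> k; have [g [c1 c2] _ _ _] := F k; split => // p.
  by apply: gradient_at_eq (gradient_atD (g p) (gradient_at_cst _ p)) _ _; rewrite addr0.
- move=> k x; have -> : T0 (dl k) (cos x, sin x) = T0 (dl k) (1, 0).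
    by rewrite /T0 /mn /mx /sarg /srad/= cos2Dsin2 expr1n expr0n/= addr0.
  by rewrite addrC subrK.
- move=> k p /ltW dp; have [_ _ b1 b2 b3] := F k; split.
  + rewrite (le_trans (ler_normD _ _))// lerD ?b1// (le_trans (ler_normB _ _))// normr1.
    by rewrite lerD2l b1// rad1.
  + by rewrite (le_trans (b2 p dp))//; lra.
  + by rewrite (le_trans (b3 p dp))//; lra.
- move=> p dp r; split.
  + rewrite -[X in _ --> X]addr0; apply: cvgD; first exact: smoothing_cvg.
    have S1 : radial_part 1 = 1 by rewrite /radial_part ltNge ltW//= (prof_one prof).
    rewrite -[X in _ --> X](subrr 1); apply: cvgB; first exact: cvg_cst.
    by have := @smoothing_cvg (1, 0); rewrite rad1 S1; exact.
  + apply: smoothing_deriv_cvg.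
    by rewrite /Defs.radius -sqrtr_sqr ler_sqrt ?lerDl ?addr_ge0 ?sqr_ge0.
  + apply: smoothing_deriv_cvg.
    by rewrite /Defs.radius -sqrtr_sqr ler_sqrt ?lerDr ?addr_ge0 ?sqr_ge0.
Qed.

End approximation.

Section solution.
Context {R : realType}.
Notation mu := (@lebesgue_measure R).

Variables (m : nat) (a : R) (al : @param R) (P P' Q Q' : R -> R).
Let n := m.+1.
Hypothesis a01 : 0 < a < 1.
Hypothesis prof : profile n a al P P' Q Q'.

Let S (p : R * R) := radial_part a P Q (Defs.radius p).
Let dS (p : R * R) := radial_deriv a P' Q' (Defs.radius p).

Definition sol (A B : R) (p : R * R) := harm A B n p * S p.
Definition solx (A B : R) (p : R * R) :=
  n%:R * harm A B m p * S p + harm A B n p * (dS p * (p.1 / Defs.radius p)).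
Definition soly (A B : R) (p : R * R) :=
  - (n%:R * harmk A B m p) * S p + harm A B n p * (dS p * (p.2 / Defs.radius p)).

Definition L2_approx (u ux uy : R * R -> R) (phi phix phiy : nat -> R * R -> R) :=
  [/\ forall k, [/\ forall p, gradient_at (phi k) p (phix k p) (phiy k p),
        continuous (phix k) & continuous (phiy k)],
    (fun k => \int[@mu2 R]_(p in @disk R) ((phi k p - u p) ^+ 2)%:E)%E @ \oo --> 0%E,
    (fun k => \int[@mu2 R]_(p in @disk R) ((phix k p - ux p) ^+ 2)%:E)%E @ \oo --> 0%E &
    (fun k => \int[@mu2 R]_(p in @disk R) ((phiy k p - uy p) ^+ 2)%:E)%E @ \oo --> 0%E].

Definition bounded_mfun_disk (f : R * R -> R) :=
  measurable_fun (@disk R : set (@plane R)) (f : @plane R -> measurableTypeR R) /\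
  exists K, forall p, disk p -> `|f p| <= K.

Lemma continuous_bounded_mfun_disk (f : R * R -> R) : continuous f -> bounded_mfun_disk f.
Proof.
move=> cf; split; first by apply: measurable_funTS; exact: continuous_measurable_plane.
by have [K _ h] := continuous_bounded_disk cf; exists K.
Qed.

Lemma bounded_mfun_diskD f g : bounded_mfun_disk f -> bounded_mfun_disk g ->
  bounded_mfun_disk (fun p => f p + g p).
Proof.
move=> [mf [K Kf]] [mg [L Lg]]; split; first exact: (measurable_funD mf mg).
by exists (K + L) => p dp; rewrite (le_trans (ler_normD _ _))// lerD ?Kf ?Lg.
Qed.

Lemma bounded_mfun_diskM f g : bounded_mfun_disk f -> bounded_mfun_disk g ->
  bounded_mfun_disk (fun p => f p * g p).
Proof.
move=> [mf [K Kf]] [mg [L Lg]]; split; first exact: (measurable_funM mf mg).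
by exists (K * L) => p dp; rewrite normrM ler_pM ?Kf ?Lg.
Qed.

(** Only the radial factor fails to be smooth; it is replaced by the functions of
    [smooth_approximation] while the harmonic polynomial is kept. *)
Lemma sol_approx (A B : R) :
  [/\ bounded_mfun_disk (sol A B), bounded_mfun_disk (solx A B), bounded_mfun_disk (soly A B) &
   exists phi phix phiy, L2_approx (sol A B) (solx A B) (soly A B) phi phix phiy /\
     forall k x, phi k (cos x, sin x) = trigc A B n x].
Proof.
have [T [Tx [Ty [K [gT T1 bT cT]]]]] := smooth_approximation a01 prof.
have [ch chk] := harm_continuous A B n; have [cm cmk] := harm_continuous A B m.
have [H H0 bH] := continuous_bounded_disk ch.
have [Hm Hm0 bHm] := continuous_bounded_disk cm.
have [Hk Hk0 bHk] := continuous_bounded_disk cmk.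
pose phi k p := harm A B n p * T k p.
pose phix k p := n%:R * harm A B m p * T k p + harm A B n p * Tx k p.
pose phiy k p := - (n%:R * harmk A B m p) * T k p + harm A B n p * Ty k p.
have cTk k : continuous (T k).
  move=> p; have [g _ _] := gT k; have [df _ _] := gradient_atP (g p).
  exact: differentiable_continuous.
have gphi k p : gradient_at (phi k) p (phix k p) (phiy k p).
  have [g _ _] := gT k; have [gh _] := harm_gradient A B m p.
  exact: gradient_atM gh (g p).
have cphix k : continuous (phix k).
  have [_ cx _] := gT k; apply: continuous_funD; apply: continuous_funM => //.
  by apply: continuous_funM => //; exact: continuous_cst.
have cphiy k : continuous (phiy k).
  have [_ _ cy] := gT k; apply: continuous_funD; apply: continuous_funM => //.
  have c0 : continuous (fun p => n%:R * harmk A B m p).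
    by apply: continuous_funM => //; exact: continuous_cst.
  by move=> p; apply: cvgN; exact: c0.
have cphi k : continuous (phi k) by exact: continuous_funM.
have meas (f : R * R -> R) : continuous f ->
    measurable_fun (@disk R : set (@plane R)) (f : @plane R -> measurableTypeR R).
  by move=> cf; apply: measurable_funTS; exact: continuous_measurable_plane.
have := @L2_dominated_cvg R phi (sol A B) (H * K) (fun k => meas _ (cphi k)).
case.
- by move=> k p dp; have [b _ _] := bT k p dp; rewrite normrM ler_pM ?bH.
- by move=> p dp; have [c _ _] := cT p dp; apply: cvgM => //; exact: cvg_cst.
move=> m1 b1 l1.
have := @L2_dominated_cvg R phix (solx A B) (n%:R * Hm * K + H * K) (fun k => meas _ (cphix k)).
case.
- move=> k p dp; have [b bx _] := bT k p dp; rewrite (le_trans (ler_normD _ _))// !normrM.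
  by rewrite (@ger0_norm _ n%:R)// lerD// ler_pM ?mulr_ge0 ?bH// ler_pM ?bHm.
- move=> p dp; have [c cx _] := cT p dp; apply: cvgD; apply: cvgM => //; exact: cvg_cst.
move=> m2 b2 l2.
have := @L2_dominated_cvg R phiy (soly A B) (n%:R * Hk * K + H * K) (fun k => meas _ (cphiy k)).
case.
- move=> k p dp; have [b _ by_] := bT k p dp; rewrite (le_trans (ler_normD _ _))// !normrM normrN normrM.
  by rewrite (@ger0_norm _ n%:R)// lerD// ler_pM ?mulr_ge0 ?bH// ler_pM ?bHk.
- move=> p dp; have [c _ cy] := cT p dp; apply: cvgD; apply: cvgM => //; exact: cvg_cst.
move=> m3 b3 l3.
split.
- by split => //; exists (H * K).
- by split => //; eexists; exact: b2.
- by split => //; eexists; exact: b3.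
exists phi, phix, phiy; split.
  by split.
move=> k x; have := harm_polar A B n 1 x; rewrite !mul1r expr1n mul1r => -[E _].
by rewrite /phi E T1 mulr1.
Qed.

End solution.

(** * Green's formula for the explicit solution *)

Section green_disk.
Context {R : realType}.
Notation mu := (@lebesgue_measure R).

Variables (m : nat) (a : R) (al : @param R) (P P' Q Q' : R -> R).
Let n := m.+1.
Hypothesis a01 : 0 < a < 1.
Hypothesis prof : profile n a al P P' Q Q'.

Let gam := conductivity a al.

Lemma conductivity_bounded : bounded_mfun_disk gam.
Proof.
split.
  apply: measurable_funTS; rewrite /gam /conductivity.
  have mr := @measurable_radius R.
  apply: (@measurable_fun_ifT _ _ _ _ (fun p : @plane R => par1 al + par2 al * (a - Defs.radius p) : measurableTypeR R)
     (fun _ => par0 al) (fun p => Defs.radius p < a)).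
  - by apply: measurable_fun_ltr => //; exact: measurable_cst.
  - apply: measurable_funD; first exact: measurable_cst.
    apply: measurable_funM; first exact: measurable_cst.
    by apply: measurable_funB => //; exact: measurable_cst.
  - exact: measurable_cst.
exists (`|par1 al| + `|par2 al| * a + `|par0 al|) => p _; rewrite /gam /conductivity.
have a0 : 0 < a by case/andP: a01.
have r0 := radius_ge0 p.
case: ifPn => ra.
  rewrite (le_trans (ler_normD _ _))// -[leLHS]addr0 lerD// lerD2l normrM ler_wpM2l//.
  by rewrite ger0_norm; [rewrite gerBl|rewrite subr_ge0 ltW].
by rewrite lerDr addr_ge0// mulr_ge0// ltW.
Qed.

(** The gradient of z^n brings in z^m in Cartesian components, whereas [green_annulus] is stated
    with index [n] in the rotating polar frame; this passes from one to the other. *)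
Lemma trig_pred (A B : R) (x : R) :
  trigc A B m x = trigc A B n x * cos x + trigs A B n x * sin x /\
  trigs A B m x = trigs A B n x * cos x - trigc A B n x * sin x.
Proof.
have E1 : trigc A B n x = trigc A B m x * cos x - trigs A B m x * sin x.
  by rewrite /trigc /trigs /n -natr1 mulrDl mul1r cosD sinD; ring.
have E2 : trigs A B n x = trigs A B m x * cos x + trigc A B m x * sin x.
  by rewrite /trigc /trigs /n -natr1 mulrDl mul1r cosD sinD; ring.
have cs := cos2Dsin2 x; rewrite E1 E2; split.
  by rewrite -[LHS]mulr1 -cs; ring.
by rewrite -[LHS]mulr1 -cs; ring.
Qed.

(** [green_annulus] is applied on [0, a] and on [a, 1] with W = r gamma R'. The term at 0 vanishes
    with r^n, the terms at a cancel by [prof_flux], and the value at 1 is the eigenvalue by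
    [prof_eig]. *)
Lemma sol_green (A B : R) (f : R * R -> R) : Ck 1 f ->
  \int[@mu2 R]_(p in @disk R) (gam p *
     (solx m a P P' Q Q' A B p * 'D_((1, 0) : R * R) f p
      + soly m a P P' Q Q' A B p * 'D_((0, 1) : R * R) f p)) =
  dn_eigenvalue n a al * \int[mu]_(x in `[0, 2 * pi]) (trigc A B n x * f (cos x, sin x)).
Proof.
move=> cf.
have /andP[a0 a1] := a01.
pose fx := 'D_((1, 0) : R * R) f; pose fy := 'D_((0, 1) : R * R) f.
have cfx : continuous fx by case: cf => _ h _; exact: h.
have cfy : continuous fy by case: cf => _ _ h; exact: h.
pose ux := solx m a P P' Q Q' A B; pose uy := soly m a P P' Q Q' A B.
pose F p := gam p * (ux p * fx p + uy p * fy p).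
have [_ bux buy _] := sol_approx a01 prof A B.
have [mF [K FK]] : bounded_mfun_disk F.
  apply: bounded_mfun_diskM; first exact: conductivity_bounded.
  have bfx := continuous_bounded_mfun_disk cfx; have bfy := continuous_bounded_mfun_disk cfy.
  exact: (bounded_mfun_diskD (bounded_mfun_diskM bux bfx) (bounded_mfun_diskM buy bfy)).
have cF t : `|t| < 1 -> continuous (fun x => F (t * cos x, t * sin x)).
  move=> _; have cc := @continuous_cos R; have cs := @continuous_sin R.
  have cpt : continuous (fun x => (t * cos x, t * sin x)).
    by apply: continuous_pair; apply: continuous_funM => //; exact: continuous_cst.
  have [ch _] := harm_continuous A B n; have [cm cmk] := harm_continuous A B m.
  pose s := radial_part a P Q `|t|; pose ds := radial_deriv a P' Q' `|t|.
  pose g := if `|t| < a then par1 al + par2 al * (a - `|t|) else par0 al.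
  have -> : (fun x => F (t * cos x, t * sin x)) = (fun x => let p := (t * cos x, t * sin x) in
     g * ((n%:R * harm A B m p * s + harm A B n p * (ds * (t * cos x / `|t|))) * fx p
       + ((0 - n%:R * harmk A B m p) * s + harm A B n p * (ds * (t * sin x / `|t|))) * fy p)).
    by apply/funext => x; rewrite /F /gam /conductivity /ux /uy /solx /soly radius_polar sub0r.
  have Kc (c : R) : continuous (fun _ : R => c) by exact: continuous_cst.
  have chp := continuous_compose cpt ch; have cmp := continuous_compose cpt cm.
  have cmkp := continuous_compose cpt cmk.
  have cfxp := continuous_compose cpt cfx; have cfyp := continuous_compose cpt cfy.
  have part (e : R -> R) : continuous e -> continuous (fun x => ds * (t * e x / `|t|)).
    move=> ce; apply: (continuous_funM (Kc ds)).
    exact: (continuous_funM (continuous_funM (Kc t) ce) (Kc _)).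
  apply: (continuous_funM (Kc g)); apply: continuous_funD.
    apply: continuous_funM cfxp; apply: continuous_funD.
      exact: (continuous_funM (continuous_funM (Kc n%:R) cmp) (Kc s)).
    exact: (continuous_funM chp (part _ cc)).
  apply: continuous_funM cfyp; apply: continuous_funD.
    exact: (continuous_funM (continuous_funB (Kc 0) (continuous_funM (Kc n%:R) cmkp)) (Kc s)).
  exact: (continuous_funM chp (part _ cs)).
transitivity (\int[@mu2 R]_(p in @disk R) F p); first by [].
rewrite (polar_disk_on mF FK cF).
pose pt (t x : R) := (t * cos x, t * sin x).
pose Win (r : R) := r ^+ n * ((par1 al + par2 al * (a - r)) * (n%:R * P r + r * P' r)).
pose Win' (r : R) := n%:R ^+ 2 * r ^+ m * ((par1 al + par2 al * (a - r)) * P r).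
pose Wout (r : R) := r ^+ n * (par0 al * (n%:R * Q r + r * Q' r)).
pose Wout' (r : R) := n%:R ^+ 2 * r ^+ m * (par0 al * Q r).
pose inner (W W' : R -> R) (t : R) := \int[mu]_(x in `[0, 2 * pi])
    (W t * trigc A B n x * (cos x * fx (pt t x) + sin x * fy (pt t x))
     - W' t / n%:R * trigs A B n x * (t * (cos x * fy (pt t x) - sin x * fx (pt t x)))).
have dWin t : 0 <= t <= a -> is_derive t 1 Win (Win' t) by exact: prof_in prof t.
have dWout t : a <= t <= 1 -> is_derive t 1 Wout (Wout' t).
  by move=> /andP[at_ _]; apply: (prof_out prof); exact: lt_le_trans a0 at_.
have cWin' t : 0 <= t <= a -> {for t, continuous Win'}.
  move=> /andP[t0 ta].
  have c1 : continuous (fun r : R => n%:R ^+ 2 * r ^+ m).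
    apply: continuous_funM; first exact: continuous_cst.
    by apply: continuous_funX; exact: continuous_idfun.
  have c2 : continuous (fun r : R => par1 al + par2 al * (a - r)).
    apply: continuous_funD; first exact: continuous_cst.
    apply: continuous_funM; first exact: continuous_cst.
    by apply: continuous_funB; [exact: continuous_cst|exact: continuous_idfun].
  have c3 : {for t, continuous P}.
    by apply: (is_derive_continuous (prof_dP prof _)); rewrite ger0_norm.
  exact: (continuousM (c1 t) (continuousM (c2 t) c3)).
have cWout' t : a <= t <= 1 -> {for t, continuous Wout'}.
  move=> /andP[at_ t1].
  have c1 : continuous (fun r : R => n%:R ^+ 2 * r ^+ m).
    apply: continuous_funM; first exact: continuous_cst.
    by apply: continuous_funX; exact: continuous_idfun.
  have c2 : continuous (fun r : R => par0 al) by exact: continuous_cst.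
  have c3 : {for t, continuous Q}.
    by apply: (is_derive_continuous (prof_dQ prof _)); exact: lt_le_trans a0 at_.
  exact: (continuousM (c1 t) (continuousM (c2 t) c3)).
have nn0 : n%:R != 0 :> R by rewrite pnatr_eq0.
(* The factor t of the area element turns the energy density into the integrand of [green_annulus]:
   the radial derivative of f meets t gamma R', the angular one n gamma R / t. At t = 0 both sides
   vanish, as W is 0 there and the angular derivative carries a factor t. *)
have core (t s ds g W W' : R) : 0 <= t < 1 ->
    radial_part a P Q t = s -> radial_deriv a P' Q' t = ds ->
    (if t < a then par1 al + par2 al * (a - t) else par0 al) = g ->
    W = t ^+ n * (g * (n%:R * s + t * ds)) -> W' = n%:R ^+ 2 * t ^+ m * (g * s) ->
    t * \int[mu]_(x in `[0, 2 * pi]) F (pt t x) = \int[mu]_(x in `[0, 2 * pi])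
    (W * trigc A B n x * (cos x * fx (pt t x) + sin x * fy (pt t x))
     - W' / n%:R * trigs A B n x * (t * (cos x * fy (pt t x) - sin x * fx (pt t x)))).
  move=> /andP[t0 t1] sE dsE gE WE W'E.
  rewrite -RintegralZl//; last first.
    by apply: continuous_integrable_itv; apply: cF; rewrite ger0_norm.
  apply: eq_Rintegral => x _.
  have [h1 _] := harm_polar A B n t x; have [h2 h3] := harm_polar A B m t x.
  have [p1 p2] := trig_pred A B x.
  rewrite /F /gam /conductivity /ux /uy /solx /soly /pt radius_polar ger0_norm// sE dsE gE h1 h2 h3 p1 p2 /= WE W'E.
  have [->|tn0] := eqVneq t 0.
    by rewrite /n [0 ^+ m.+1]exprS !(mul0r, mulr0) subrr.
  rewrite /n [t ^+ m.+1]exprS.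
  move: nn0; move: (n%:R) (fx _) (fy _) (trigc _ _ _ _) (trigs _ _ _ _) (t ^+ m) => k X Y C D E k0.
  by field; rewrite k0 tn0.
have Ein (t : R) : 0 <= t < a -> t * \int[mu]_(x in `[0, 2 * pi]) F (pt t x) = inner Win Win' t.
  move=> /andP[t0 ta]; apply: (core _ (P t) (P' t) (par1 al + par2 al * (a - t))) => //.
  - by rewrite t0 (lt_trans ta).
  - by rewrite /radial_part ta.
  - by rewrite /radial_deriv ta.
  - by rewrite ta.
have Eout (t : R) : a <= t < 1 -> t * \int[mu]_(x in `[0, 2 * pi]) F (pt t x) = inner Wout Wout' t.
  move=> /andP[ta t1]; apply: (core _ (Q t) (Q' t) (par0 al)) => //.
  - by rewrite t1 (le_trans (ltW a0)).
  - by rewrite /radial_part ltNge ta.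
  - by rewrite /radial_deriv ltNge ta.
  - by rewrite ltNge ta.
have I1 := green_annulus_integrable cf A B (isT : (0 < n)%N) a0 dWin cWin'.
have I2 := green_annulus_integrable cf A B (isT : (0 < n)%N) a1 dWout cWout'.
have G1 := green_annulus cf A B (isT : (0 < n)%N) a0 dWin cWin'.
have G2 := green_annulus cf A B (isT : (0 < n)%N) a1 dWout cWout'.
have -> : `[0, 1[%classic = `[0, a[%classic `|` `[a, 1[%classic :> set R.
  by rewrite -itv_bndbnd_setU ?bnd_simp// ltW.
pose H (t : R) := t * \int[mu]_(x in `[0, 2 * pi]) F (pt t x).
have J1 : mu.-integrable `[0, a[ (EFin \o H).
  have : mu.-integrable `[0, a[ (EFin \o inner Win Win').
    by apply: integrableS I1 => //; apply: subset_itv; rewrite bnd_simp.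
  by apply: eq_integrable => // t; rewrite inE/= in_itv/= => ti; rewrite /H Ein.
have J2 : mu.-integrable `[a, 1[ (EFin \o H).
  have : mu.-integrable `[a, 1[ (EFin \o inner Wout Wout').
    by apply: integrableS I2 => //; apply: subset_itv; rewrite bnd_simp.
  by apply: eq_integrable => // t; rewrite inE/= in_itv/= => ti; rewrite /H Eout.
have disj : [disjoint `[0, a[%classic & `[a, 1[%classic].
  apply/disj_setPS => t /= []; rewrite !in_itv/= => /andP[_ ta] /andP[at_ _].
  by move: (lt_le_trans ta at_); rewrite ltxx.
rewrite (@Rintegral_setU _ _ _ mu `[0, a[ `[a, 1[ H)//; last first.
- move/integrableP: J1 => [m1 i1]; move/integrableP: J2 => [m2 i2].
  apply/integrableP; split; first by apply/measurable_funU.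
  rewrite ge0_integral_setU//; first by rewrite lte_add_pinfty.
    apply: measurableT_comp => //; exact/measurable_funU.
have -> : \int[mu]_(t in `[0, a[) H t = \int[mu]_(t in `[0, a]) inner Win Win' t.
  rewrite -Rintegral_itv_bndo_bndc; first by apply: eq_Rintegral => t; rewrite inE/= in_itv/= => ti; exact: Ein.
  by apply: integrableS I1 => //; apply: subset_itv; rewrite bnd_simp.
have -> : \int[mu]_(t in `[a, 1[) H t = \int[mu]_(t in `[a, 1]) inner Wout Wout' t.
  rewrite -Rintegral_itv_bndo_bndc; first by apply: eq_Rintegral => t; rewrite inE/= in_itv/= => ti; exact: Eout.
  by apply: integrableS I2 => //; apply: subset_itv; rewrite bnd_simp.
rewrite G1 G2.
have -> : Wout a = Win a.
  by rewrite /Wout /Win subrr mulr0 addr0 (prof_flux prof).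
have -> : Win 0 = 0 by rewrite /Win exprS !mul0r.
have -> : Wout 1 = dn_eigenvalue n a al.
  by rewrite /Wout expr1n !mul1r (prof_eig prof).
rewrite mul0r subr0 addrC subrK; congr (_ * _).
by apply: eq_Rintegral => x _; rewrite /pt !mul1r.
Qed.

End green_disk.

(** * The divergence theorem and L^2 limits on the disk *)

Section disk_integrals.
Context {R : realType}.
Notation mu := (@lebesgue_measure R).

(** The case W = r, n = 1 of [green_annulus]: the constant field (A, B) has radial component
    [trigc A B 1] and angular component minus [trigs A B 1]. *)
Lemma disk_divergence (A B : R) (f : R * R -> R) : Ck 1 f ->
  \int[@mu2 R]_(p in @disk R)
    (A * 'D_((1, 0) : R * R) f p + B * 'D_((0, 1) : R * R) f p) =
  \int[mu]_(x in `[0, 2 * pi]) (trigc A B 1 x * f (cos x, sin x)).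
Proof.
move=> cf.
pose fx := 'D_((1, 0) : R * R) f; pose fy := 'D_((0, 1) : R * R) f.
have cfx : continuous fx by case: cf => _ h _; exact: h.
have cfy : continuous fy by case: cf => _ _ h; exact: h.
pose F p := A * fx p + B * fy p.
have Kc (c : R) (T : topologicalType) : continuous (fun _ : T => c) by exact: continuous_cst.
have cF : continuous F.
  exact: (continuous_funD (continuous_funM (Kc A _) cfx) (continuous_funM (Kc B _) cfy)).
have [mF [K FK]] := continuous_bounded_mfun_disk cF.
have cFt t : `|t| < 1 -> continuous (fun x => F (t * cos x, t * sin x)).
  move=> _; apply: continuous_compose cF; apply: continuous_pair; apply: continuous_funM.
  - exact: Kc.
  - exact: continuous_cos.
  - exact: Kc.
  - exact: continuous_sin.
transitivity (\int[@mu2 R]_(p in @disk R) F p); first by [].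
rewrite (polar_disk_on mF FK cFt).
pose W (r : R) := r; pose W' (r : R) := 1 : R.
have dW (t : R) : 0 <= t <= 1 -> is_derive t 1 W (W' t) by move=> _; exact: is_derive_id.
have cW' (t : R) : 0 <= t <= 1 -> {for t, continuous W'} by move=> _; exact: Kc.
have := green_annulus cf A B (isT : (0 < 1)%N) ltr01 dW cW'.
have I := green_annulus_integrable cf A B (isT : (0 < 1)%N) ltr01 dW cW'.
have -> : W 1 = 1 by []. have -> : W 0 = 0 by [].
rewrite mul1r mul0r subr0 -Rintegral_itv_bndo_bndc; last first.
  by apply: integrableS I => //; apply: subset_itv; rewrite bnd_simp.
under [RHS]eq_Rintegral do rewrite !mul1r.
move=> <-; apply: eq_Rintegral => t; rewrite inE/= in_itv/= => /andP[t0 t1].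
rewrite -RintegralZl//; last first.
  by apply: continuous_integrable_itv; apply: cFt; rewrite ger0_norm.
apply: eq_Rintegral => x _.
have cs := cos2Dsin2 x; rewrite /F /W /W' /trigc /trigs.
have -> : 1%:R * x = x by rewrite mul1r.
rewrite /fx /fy /=; move: ('D_(1, 0) f _) ('D_(0, 1) f _) => X Y.
transitivity (t * (A * X + B * Y) * (cos x ^+ 2 + sin x ^+ 2)); first by rewrite cs mulr1.
by rewrite divr1; ring.
Qed.

Definition sqintegrable_disk (w : R * R -> R) :=
  measurable_fun (@disk R : set (@plane R)) (w : @plane R -> measurableTypeR R) /\
  (\int[@mu2 R]_(p in @disk R) ((w p) ^+ 2)%:E < +oo)%E.

Lemma measurable_EFin_disk (w : R * R -> R) :
  measurable_fun (@disk R : set (@plane R)) (w : @plane R -> measurableTypeR R) ->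
  measurable_fun (@disk R : set (@plane R)) (EFin \o w : @plane R -> \bar R).
Proof. by move=> mw; exact/measurable_EFinP. Qed.

Lemma sqintegrable_int (w : R * R -> R) : sqintegrable_disk w ->
  (@mu2 R).-integrable (@disk R) (EFin \o (fun p => w p ^+ 2)).
Proof.
move=> [mw fw]; apply/integrableP; split.
  by apply: measurable_EFin_disk; exact: (measurable_funX 2 mw).
apply: le_lt_trans fw; apply: ge0_le_integral => //.
- exact: measurable_disk.
- by apply: measurableT_comp => //; apply: measurable_EFin_disk; exact: (measurable_funX 2 mw).
- by apply: measurable_EFin_disk; exact: (measurable_funX 2 mw).
- by move=> p _ /=; rewrite lee_fin ger0_norm// sqr_ge0.
Qed.

Lemma bounded_integrable (b : R * R -> R) : bounded_mfun_disk b ->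
  (@mu2 R).-integrable (@disk R) (EFin \o b).
Proof. by move=> [mb [K bK]]; exact: bounded_integrable_disk mb bK. Qed.

Lemma bounded_sqintegrable (b : R * R -> R) : bounded_mfun_disk b -> sqintegrable_disk b.
Proof.
move=> bb; split; first by case: bb.
have [mb [K bK]] := bb.
have /integrableP[_ h] := bounded_integrable (bounded_mfun_diskM bb bb).
apply: le_lt_trans h; apply: ge0_le_integral => //.
- exact: measurable_disk.
- by move=> p _; rewrite lee_fin sqr_ge0.
- by apply: measurable_EFin_disk; exact: (measurable_funX 2 mb).
- by apply: measurableT_comp => //; apply: measurable_EFin_disk; exact: (measurable_funM mb mb).
- by move=> p _ /=; rewrite lee_fin -expr2 ler_norm.
Qed.

Lemma bounded_mul_integrable (b w : R * R -> R) : bounded_mfun_disk b -> sqintegrable_disk w ->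
  (@mu2 R).-integrable (@disk R) (EFin \o (fun p => b p * w p)).
Proof.
move=> [mb [K bK]] sw; have [mw _] := sw.
have b1 : bounded_mfun_disk (fun _ => `|K|).
  by split; [exact: measurable_cst|exists `|K| => p _; rewrite normr_id].
have := integrableD measurable_disk (bounded_integrable b1)
  (integrableZl measurable_disk `|K| (sqintegrable_int sw)).
apply: le_integrable => //; first exact: measurable_disk.
  by apply: measurable_EFin_disk; exact: (measurable_funM mb mw).
move=> p dp /=; rewrite lee_fin normrM.
have hb : `|b p| <= `|K| by exact: le_trans (bK p dp) (ler_norm K).
have h0 := normr_ge0 K; have h1 := normr_ge0 (w p).
rewrite [leRHS]ger0_norm; last by rewrite addr_ge0 ?(mulr_ge0 h0) ?sqr_ge0.
apply: le_trans (ler_wpM2r h1 hb) _.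
rewrite -(real_normK (num_real (w p))); move: `|K| `|w p| h0 h1 => k v k0 v0.
(* In other words, k v <= k + k v^2. *)
have : 0 <= k * ((v - 1) ^+ 2 + v) by rewrite mulr_ge0// addr_ge0// sqr_ge0.
by nra.
Qed.

(** The role of the Cauchy-Schwarz inequality is taken by K v <= K d + (K / d) v^2, valid for every
    d > 0 and integrated over a disk of finite measure. *)
Lemma Rintegral_L2_cvg (b w : R * R -> R) (wk : nat -> R * R -> R) :
  bounded_mfun_disk b -> (forall k, sqintegrable_disk (wk k)) -> sqintegrable_disk w ->
  (fun k => \int[@mu2 R]_(p in @disk R) ((wk k p - w p) ^+ 2)%:E)%E @ \oo --> 0%E ->
  (fun k => \int[@mu2 R]_(p in @disk R) (b p * wk k p)) @ \oo -->
    \int[@mu2 R]_(p in @disk R) (b p * w p).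
Proof.
move=> bb swk sw cv.
have [mb [K0 bK0]] := bb; pose K := `|K0| + 1.
have K_gt0 : 0 < K by rewrite ltr_wpDl.
have bK p : disk p -> `|b p| <= K.
  by move=> dp; apply: le_trans (bK0 p dp) _; rewrite /K (le_trans (ler_norm _))// lerDl.
have mD k : measurable_fun (@disk R : set (@plane R)) ((fun p => wk k p - w p) : @plane R -> measurableTypeR R).
  by have [m1 _] := swk k; have [m2 _] := sw; exact: (measurable_funB m1 m2).
pose I k := (\int[@mu2 R]_(p in @disk R) ((wk k p - w p) ^+ 2)%:E)%E.
have /fine_cvgP[fI /cvgrPdist_lt cI] : I @ \oo --> (0:R)%:E by exact: cv.
pose V := fine (@mu2 R (@disk R)).
have V0 : 0 <= V by rewrite fine_ge0.
apply/cvgrPdist_le => e e0.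
(* [d] makes K d V at most e / 2, with V + 1 in the denominator to stay clear of 0; [c] then makes
   (K / d) c equal to e / 2. *)
pose d := e / (2 * K * (V + 1)); have V1 : 0 < V + 1 by rewrite ltr_wpDl.
have d0 : 0 < d by rewrite /d; apply: divr_gt0 => //; apply: mulr_gt0 => //; apply: mulr_gt0.
pose c := d * e / (2 * K); have c0 : 0 < c by rewrite /c; apply: divr_gt0; apply: mulr_gt0.
have := cI c c0; apply: filterS2 fI => k fIk; rewrite sub0r normrN => Ik.
have sD : sqintegrable_disk (fun p => wk k p - w p).
  split; first exact: mD.
  by rewrite -/(I k) -ge0_fin_numE//; apply: integral_ge0 => p _; rewrite lee_fin sqr_ge0.
have iD := bounded_mul_integrable bb sD.
have iwk := bounded_mul_integrable bb (swk k).
have iw := bounded_mul_integrable bb sw.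
have i2 := sqintegrable_int sD.
have icst (r : R) : (@mu2 R).-integrable (@disk R) (EFin \o (fun _ => r)).
  apply: bounded_integrable; split; first exact: measurable_cst.
  by exists `|r|.
have mdisk := @measurable_disk R.
rewrite distrC -RintegralB//.
have -> : \int[@mu2 R]_(p in @disk R) (b p * wk k p - b p * w p) =
    \int[@mu2 R]_(p in @disk R) (b p * (wk k p - w p)).
  by apply: eq_Rintegral => p _; rewrite mulrBr.
apply: le_trans (le_normr_Rintegral _ iD) _ => //.
have iS : (@mu2 R).-integrable (@disk R) (EFin \o (fun p => K / d * (wk k p - w p) ^+ 2)).
  exact: (integrableZl mdisk (K / d) i2).
apply: le_trans (_ : \int[@mu2 R]_(p in @disk R) (K * d + K / d * (wk k p - w p) ^+ 2) <= _).
  apply: le_Rintegral => //.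
  - exact: integrable_norm.
  - exact: (integrableD mdisk (icst _) iS).
  move=> p dp; rewrite normrM; apply: le_trans (ler_wpM2r (normr_ge0 _) (bK p dp)) _.
  rewrite -(real_normK (num_real (wk k p - w p))); move: `|_| (normr_ge0 (wk k p - w p)) => v v0.
  rewrite -subr_ge0.
  have -> : K * d + K / d * v ^+ 2 - K * v = K / d * ((d - v / 2) ^+ 2 + 3 / 4 * v ^+ 2).
    by field; rewrite gt_eqF.
  apply: mulr_ge0; first by rewrite divr_ge0 ?ltW.
  by apply: addr_ge0; rewrite ?sqr_ge0//; apply: mulr_ge0; rewrite ?sqr_ge0//; lra.
rewrite RintegralD// Rintegral_cst// RintegralZl//.
have IkE : \int[@mu2 R]_(p in @disk R) (wk k p - w p) ^+ 2 <= c.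
  by apply: le_trans (ler_norm _) (ltW _).
have : K / d * \int[@mu2 R]_(p in @disk R) (wk k p - w p) ^+ 2 <= K / d * c.
  by apply: ler_wpM2l => //; rewrite divr_ge0// ltW.
have -> : K / d * c = e / 2.
  by rewrite /c; field; rewrite !gt_eqF.
have : K * d * V <= e / 2.
  have -> : K * d * V = e / 2 * (V / (V + 1)).
    by rewrite /d; field; rewrite !gt_eqF.
  have Vle : V / (V + 1) <= 1 by rewrite ler_pdivrMr// mul1r lerDl.
  by apply: ler_piMr => //; rewrite divr_ge0 ?ltW.
rewrite -/V.
lra.
Qed.

End disk_integrals.

(** * The Dirichlet-to-Neumann map on a Fourier mode *)

Section complex_L2.
Context {R : realType}.
Local Open Scope complex_scope.
Notation Rez := complex.Re.
Notation Imz := complex.Im.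

Lemma normc_sqr (z : R[i]) : ComplexField.Normc.normc z ^+ 2 = Rez z ^+ 2 + Imz z ^+ 2.
Proof. by case: z => x y /=; rewrite sqr_sqrtr// addr_ge0 ?sqr_ge0. Qed.

Definition cmeasurable_disk (w : R * R -> R[i]) :=
  measurable_fun (@disk R : set (@plane R)) ((fun p => Rez (w p)) : @plane R -> measurableTypeR R) /\
  measurable_fun (@disk R : set (@plane R)) ((fun p => Imz (w p)) : @plane R -> measurableTypeR R).

Lemma L2normsqE (w : R * R -> R[i]) : cmeasurable_disk w ->
  L2normsq w = (\int[@mu2 R]_(p in @disk R) ((Rez (w p)) ^+ 2)%:E
                + \int[@mu2 R]_(p in @disk R) ((Imz (w p)) ^+ 2)%:E)%E.
Proof.
move=> [mr mi]; rewrite /L2normsq.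
under eq_integral do rewrite normc_sqr EFinD.
rewrite ge0_integralD//.
- exact: measurable_disk.
- by move=> p _; rewrite lee_fin sqr_ge0.
- by apply: measurable_EFin_disk; exact: (measurable_funX 2 mr).
- by move=> p _; rewrite lee_fin sqr_ge0.
- by apply: measurable_EFin_disk; exact: (measurable_funX 2 mi).
Qed.

Lemma integral_sqr_ge0 (f : R * R -> R) :
  (0 <= \int[@mu2 R]_(p in @disk R) ((f p) ^+ 2)%:E)%E.
Proof. by apply: integral_ge0 => p _; rewrite lee_fin sqr_ge0. Qed.

Lemma L2normsq_ge0 (w : R * R -> R[i]) : (0 <= L2normsq w)%E.
Proof. by apply: integral_ge0 => p _; rewrite lee_fin sqr_ge0. Qed.

Lemma L2P (w : R * R -> R[i]) :
  L2 w <-> sqintegrable_disk (fun p => Rez (w p)) /\ sqintegrable_disk (fun p => Imz (w p)).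
Proof.
split=> [[mr mi]|[[mr fr] [mi fi]]].
  rewrite L2normsqE// => h; split; split => //.
    by apply: le_lt_trans h; apply: leeDl; exact: integral_sqr_ge0.
  by apply: le_lt_trans h; apply: leeDr; exact: integral_sqr_ge0.
by split => //; rewrite L2normsqE// lte_add_pinfty.
Qed.

Lemma cvg0_le (u v : nat -> \bar R) : (forall k, (0 <= u k)%E) -> (forall k, (u k <= v k)%E) ->
  v @ \oo --> 0%E -> u @ \oo --> 0%E.
Proof.
move=> u0 uv cv; apply: squeeze_cvge cv => //; last exact: cvg_cst.
by apply: nearW => k; rewrite u0 uv.
Qed.

Lemma L2normsq_cvg0 (w : nat -> R * R -> R[i]) : (forall k, cmeasurable_disk (w k)) ->
  (fun k => L2normsq (w k)) @ \oo --> 0%E <->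
  (fun k => \int[@mu2 R]_(p in @disk R) ((Rez (w k p)) ^+ 2)%:E)%E @ \oo --> 0%E /\
  (fun k => \int[@mu2 R]_(p in @disk R) ((Imz (w k p)) ^+ 2)%:E)%E @ \oo --> 0%E.
Proof.
move=> mw; have -> : (fun k => L2normsq (w k)) = (fun k =>
    (\int[@mu2 R]_(p in @disk R) ((Rez (w k p)) ^+ 2)%:E +
     \int[@mu2 R]_(p in @disk R) ((Imz (w k p)) ^+ 2)%:E)%E).
  by apply/funext => k; rewrite L2normsqE.
split=> [h|[hr hi]].
  split; apply: cvg0_le h => k; rewrite ?integral_sqr_ge0//.
    by apply: leeDl; exact: integral_sqr_ge0.
  by apply: leeDr; exact: integral_sqr_ge0.
by rewrite -[0%E in X in _ --> X]adde0; exact: cvgeD.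
Qed.

Lemma H1normsq_cvg0 (u : nat -> R * R -> R[i]) (du : nat -> R * R -> R[i] * R[i]) :
  (fun k => H1normsq (u k) (du k)) @ \oo --> 0%E <->
  [/\ (fun k => L2normsq (u k)) @ \oo --> 0%E,
      (fun k => L2normsq (fun p => (du k p).1)) @ \oo --> 0%E &
      (fun k => L2normsq (fun p => (du k p).2)) @ \oo --> 0%E].
Proof.
split=> [h|[h1 h2 h3]].
  split; apply: cvg0_le h => k; rewrite ?L2normsq_ge0// /H1normsq.
  - by rewrite -addeA; apply: leeDl; apply: adde_ge0; exact: L2normsq_ge0.
  - by rewrite addeAC; apply: leeDr; apply: adde_ge0; exact: L2normsq_ge0.
  - by apply: leeDr; apply: adde_ge0; exact: L2normsq_ge0.
rewrite -[0%E in X in _ --> X]adde0; apply: cvgeD => //.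
by rewrite -[0%E in X in _ --> X]adde0; exact: cvgeD.
Qed.

Lemma cmeasurableB (v w : R * R -> R[i]) : cmeasurable_disk v -> cmeasurable_disk w ->
  cmeasurable_disk (fun p => v p - w p).
Proof.
move=> [a b] [c d]; split.
  apply: (eq_measurable_fun (fun p => Rez (v p) - Rez (w p))).
    by move=> p _; rewrite raddfB.
  exact: measurable_funB.
apply: (eq_measurable_fun (fun p => Imz (v p) - Imz (w p))).
  by move=> p _; rewrite raddfB.
exact: measurable_funB.
Qed.

(** Four products, because the real or imaginary part of [energy] consists of four: two components
    of the gradient, each with a real and an imaginary part. *)
Lemma Rintegral_L2_cvg4 (b1 b2 b3 b4 w1 w2 w3 w4 : R * R -> R) (v1 v2 v3 v4 : nat -> R * R -> R) :
  bounded_mfun_disk b1 -> bounded_mfun_disk b2 -> bounded_mfun_disk b3 -> bounded_mfun_disk b4 ->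
  let cvgL2 (v : nat -> R * R -> R) w := [/\ forall k, sqintegrable_disk (v k), sqintegrable_disk w &
    (fun k => \int[@mu2 R]_(p in @disk R) ((v k p - w p) ^+ 2)%:E)%E @ \oo --> 0%E] in
  cvgL2 v1 w1 -> cvgL2 v2 w2 -> cvgL2 v3 w3 -> cvgL2 v4 w4 ->
  (fun k => \int[@mu2 R]_(p in @disk R) (b1 p * v1 k p + b2 p * v2 k p + b3 p * v3 k p + b4 p * v4 k p)) @ \oo -->
    \int[@mu2 R]_(p in @disk R) (b1 p * w1 p + b2 p * w2 p + b3 p * w3 p + b4 p * w4 p).
Proof.
move=> h1 h2 h3 h4 cvgL2 [s1 t1 c1] [s2 t2 c2] [s3 t3 c3] [s4 t4 c4].
have md := @measurable_disk R.
have E (z1 z2 z3 z4 : R * R -> R) :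
  sqintegrable_disk z1 -> sqintegrable_disk z2 -> sqintegrable_disk z3 -> sqintegrable_disk z4 ->
  \int[@mu2 R]_(p in @disk R) (b1 p * z1 p + b2 p * z2 p + b3 p * z3 p + b4 p * z4 p) =
  \int[@mu2 R]_(p in @disk R) (b1 p * z1 p) + \int[@mu2 R]_(p in @disk R) (b2 p * z2 p)
  + \int[@mu2 R]_(p in @disk R) (b3 p * z3 p) + \int[@mu2 R]_(p in @disk R) (b4 p * z4 p).
  move=> i1 i2 i3 i4.
  have j1 := bounded_mul_integrable h1 i1; have j2 := bounded_mul_integrable h2 i2.
  have j3 := bounded_mul_integrable h3 i3; have j4 := bounded_mul_integrable h4 i4.
  have j12 : (@mu2 R).-integrable (@disk R) (EFin \o (fun p => b1 p * z1 p + b2 p * z2 p)).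
    exact: (integrableD md j1 j2).
  have j123 : (@mu2 R).-integrable (@disk R) (EFin \o (fun p => b1 p * z1 p + b2 p * z2 p + b3 p * z3 p)).
    exact: (integrableD md j12 j3).
  by rewrite !RintegralD.
rewrite E//; under eq_fun do rewrite E//.
apply: cvgD; last exact: Rintegral_L2_cvg.
apply: cvgD; last exact: Rintegral_L2_cvg.
by apply: cvgD; exact: Rintegral_L2_cvg.
Qed.

End complex_L2.

(** * Fourier coefficients on the circle *)

Section fourier.
Context {R : realType}.
Local Open Scope complex_scope.
Notation mu := (@lebesgue_measure R).
Notation Rez := complex.Re.
Notation Imz := complex.Im.

Lemma Rintegral_trigc (A B : R) (n : nat) :
  \int[mu]_(x in `[0, 2 * pi]) trigc A B n x = if n == 0 then 2 * pi * A else 0.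
Proof.
case: eqP => [->|/eqP n0].
  have -> : \int[mu]_(x in `[0, 2 * pi]) trigc A B 0 x = \int[mu]_(x in `[0, 2 * pi]) A.
    by apply: eq_Rintegral => x _; rewrite /trigc !mul0r cos0 sin0 mulr0 addr0 mulr1.
  rewrite Rintegral_cst// mulrC; congr (_ * _).
  have : (0 : R) < 2 * pi by rewrite mulr_gt0 ?pi_gt0.
  move=> h; apply: etrans (congr1 fine (lebesgue_measure_itv `[0, 2 * pi])) _.
  by rewrite /= lte_fin h /= subr0.
have nr0 : n%:R != 0 :> R by rewrite pnatr_eq0.
have pi2 : 0 < 2 * pi :> R by rewrite mulr_gt0 ?pi_gt0.
have dF (t : R) : 0 <= t <= 2 * pi -> is_derive t 1 (fun _ : R => 1 : R) 0.
  by move=> _; exact: is_derive_cst.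
have dG (t : R) : 0 <= t <= 2 * pi -> is_derive t 1 (trigs A B n) (n%:R * trigc A B n t).
  by move=> _; exact: is_derive_trigs.
have cf (t : R) : 0 <= t <= 2 * pi -> {for t, continuous (fun _ : R => 0 : R)}.
  by move=> _; exact: cvg_cst.
have cg (t : R) : 0 <= t <= 2 * pi -> {for t, continuous (fun t => n%:R * trigc A B n t)}.
  by move=> _; apply: cvgM; [exact: cvg_cst|exact: continuous_trigc].
have := Rintegration_by_parts_closed pi2 dF dG cf cg.
have -> : \int[mu]_(t in `[0, 2 * pi]) (1 * (n%:R * trigc A B n t)) =
    n%:R * \int[mu]_(t in `[0, 2 * pi]) trigc A B n t.
  rewrite -RintegralZl//; last by apply: continuous_integrable_itv; exact: continuous_trigc.
  by apply: eq_Rintegral => x _; rewrite mul1r.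
have -> : \int[mu]_(t in `[0, 2 * pi]) (0 * trigs A B n t) = 0.
  transitivity (\int[mu]_(t in `[0, 2 * pi]) (0 : R)); last by rewrite Rintegral_cst ?mul0r.
  by apply: eq_Rintegral => x _; rewrite mul0r.
rewrite trigs_2pi subrr subr0 => /eqP.
by rewrite mulf_eq0 (negbTE nr0) => /eqP.
Qed.

Lemma Rintegral_cos_int (l : int) :
  \int[mu]_(x in `[0, 2 * pi]) cos (l%:~R * x) = if l == 0 then 2 * pi else 0.
Proof.
have <- : \int[mu]_(x in `[0, 2 * pi]) trigc 1 0 `|l|%N x = \int[mu]_(x in `[0, 2 * pi]) cos (l%:~R * x).
  apply: eq_Rintegral => x _; rewrite /trigc mul0r addr0 mul1r.
  case: l => k /=; first by [].
  by rewrite NegzE mulrNz mulNr cosN.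
by rewrite Rintegral_trigc absz_eq0 mulr1.
Qed.

Lemma Rintegral_sin_int (l : int) : \int[mu]_(x in `[0, 2 * pi]) sin (l%:~R * x) = 0.
Proof.
have <- : \int[mu]_(x in `[0, 2 * pi]) trigc 0 (Num.sg l%:~R) `|l|%N x = \int[mu]_(x in `[0, 2 * pi]) sin (l%:~R * x).
  apply: eq_Rintegral => x _; rewrite /trigc mul0r add0r.
  case: l => k /=; last by rewrite NegzE mulrNz mulNr sinN sgrN gtr0_sg ?mulN1r ?ltr0n.
  case: k => [|k]; first by rewrite !mul0r sin0 mulr0.
  by rewrite gtr0_sg ?mul1r// ltr0n.
by rewrite Rintegral_trigc mulr0; case: ifP.
Qed.

Definition delta (n : nat) (z : R[i]) : int -> R[i] := fun j => if j == n%:Z then z else 0.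

Lemma boundary_coef_trig (n : nat) (phi : R * R -> R[i]) :
  (forall x : R, phi (cos x, sin x) = trigc 1 0 n x +i* trigc 0 1 n x) ->
  boundary_coef phi = delta n 1.
Proof.
move=> E; apply/funext => j; rewrite /boundary_coef /cintegral /delta.
have ER (x : R) : Rez (phi (cos x, sin x) * (cos (j%:~R * x) -i* sin (j%:~R * x))) =
    cos ((n%:Z - j)%:~R * x).
  rewrite E /= /trigc rmorphB/= mulrBl cosB -!pmulrn.
  ring.
have EI (x : R) : Imz (phi (cos x, sin x) * (cos (j%:~R * x) -i* sin (j%:~R * x))) =
    sin ((n%:Z - j)%:~R * x).
  rewrite E /= /trigc rmorphB/= mulrBl sinB -!pmulrn.
  ring.
under eq_Rintegral do rewrite ER.
under [X in _ +i* X]eq_Rintegral do rewrite EI.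
rewrite Rintegral_cos_int Rintegral_sin_int subr_eq0 eq_sym.
case: eqP => _; last by rewrite mulr0.
have pi2 : 2 * pi != 0 :> R by rewrite mulf_neq0 ?pnatr_eq0// gt_eqF// pi_gt0.
by apply/eqP; rewrite eq_complex /= !mulr0 !mul0r subr0 addr0 mulVf// !eqxx.
Qed.

Lemma Hsnormsq_term_ge0 (s : R) (f : int -> R[i]) (n : int) :
  (0 <= (((1 + n%:~R ^+ 2) `^ s) * ComplexField.Normc.normc (f n) ^+ 2)%:E)%E.
Proof. by rewrite lee_fin mulr_ge0 ?powR_ge0 ?sqr_ge0. Qed.

Lemma Hsnormsq_ge0 (s : R) (f : int -> R[i]) : (0 <= Hsnormsq s f)%E.
Proof. by apply: esum_ge0 => n _; exact: Hsnormsq_term_ge0. Qed.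

Lemma Hsnormsq_ge (s : R) (f : int -> R[i]) (n : int) :
  ((((1 + n%:~R ^+ 2) `^ s) * ComplexField.Normc.normc (f n) ^+ 2)%:E <= Hsnormsq s f)%E.
Proof.
apply: esum_ge; exists [set n]; first by split => //; exact: finite_set1.
by rewrite fsbig_set1.
Qed.

Lemma normc0 : ComplexField.Normc.normc (0 : R[i]) = 0.
Proof. by rewrite /= expr0n/= addr0 sqrtr0. Qed.

Lemma Hsnormsq_delta (s : R) (n : nat) (z : R[i]) : Hsnormsq s (delta n z) =
  (((1 + n%:R ^+ 2) `^ s) * ComplexField.Normc.normc z ^+ 2)%:E.
Proof.
rewrite /Hsnormsq (esumID [set n%:Z])/=; last by move=> k _; exact: Hsnormsq_term_ge0.
rewrite setTI esum_set1; last exact: Hsnormsq_term_ge0.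
rewrite esum1; first by rewrite /delta eqxx adde0.
move=> k [_ /=] /eqP/negbTE kn.
by rewrite /delta kn normc0 expr0n mulr0.
Qed.

Lemma Hs_delta (s : R) (n : nat) (z : R[i]) : Hs s (delta n z).
Proof. by rewrite /Hs Hsnormsq_delta ltry. Qed.

Lemma HsB (s : R) (f g : int -> R[i]) : Hs s f -> Hs s g -> Hs s (f - g).
Proof.
rewrite /Hs => hf hg.
have E (h : int -> R[i]) : Hsnormsq s h = (\esum_(n in [set: int])
     (((1 + n%:~R ^+ 2) `^ s) * ComplexField.Normc.normc (h n) ^+ 2)%:E)%E by [].
(* Termwise |f - g|^2 <= 2 |f|^2 + 2 |g|^2, the doubling being written as a sum so that [esumD]
   applies. *)
apply: (@le_lt_trans _ _ ((Hsnormsq s f + Hsnormsq s f) + (Hsnormsq s g + Hsnormsq s g))%E).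
  rewrite !E -!esumD; last 6 first.
  all: try by move=> n _; rewrite ?adde_ge0 ?Hsnormsq_term_ge0.
  apply: le_esum => n _; rewrite -!EFinD lee_fin; move: (powR _ _) (powR_ge0 (1 + n%:~R ^+ 2) s) => c c0.
  rewrite !normc_sqr.
  have -> : (f - g) n = f n - g n by [].
  case: (f n) (g n) => x y [z w] /=.
  have := mulr_ge0 c0 (sqr_ge0 (x + z)); have := mulr_ge0 c0 (sqr_ge0 (y + w)).
  nra.
by rewrite !lte_add_pinfty.
Qed.

Lemma limn_near_cst (u : nat -> R) (l : R) (N0 : nat) : (forall N, (N0 <= N)%N -> u N = l) ->
  limn u = l.
Proof.
move=> h; apply/cvg_lim => //; apply: cvg_near_cst.
by exists N0 => // N /= hN; exact: h.
Qed.

Lemma zsum_single (c : int -> R[i]) (n : nat) : (forall j, j != n%:Z -> c j = 0) ->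
  zsum c = c n%:Z.
Proof.
move=> c0.
have key (f : R[i] -> R) : f 0 = 0 ->
    limn (fun N : nat => \sum_(k < N.*2.+1) f (c (k%:Z - N%:Z))) = f (c n%:Z).
  (* The symmetric partial sums are constant from N = n on: the index n then occupies position N +
     n. *)
  move=> f0; apply: (@limn_near_cst _ _ n) => N nN.
  have kn : (N + n < N.*2.+1)%N by rewrite ltnS -addnn leq_add2l.
  rewrite (bigD1 (Ordinal kn))//= big1 => [|i ik].
    by rewrite addr0 PoszD addrC addKr.
  rewrite c0 ?f0//; apply: contra ik => /eqP e; apply/eqP/val_inj => /=.
  by apply/eqP; rewrite -eqz_nat PoszD -e addrC subrK.
by rewrite /zsum !key//; case: (c n).
Qed.

Lemma pairing_single (h g : int -> R[i]) (n : nat) :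
  (forall j, j != n%:Z -> h j * conjc (g j) = 0) ->
  pairing h g = (2 * pi)%:C * (h n%:Z * conjc (g n%:Z)).
Proof. by move=> H; rewrite /pairing (zsum_single H). Qed.

End fourier.

(** * The explicit solution as a weak solution, and its conormal derivative *)

Section weak_derivative.
Context {R : realType}.
Local Open Scope complex_scope.

Lemma Ck1_gradient (f : R * R -> R) p : Ck 1 f ->
  gradient_at f p ('D_((1, 0) : R * R) f p) ('D_((0, 1) : R * R) f p).
Proof.
case=> df _ _; split; first exact: df.
by apply/funext => v; rewrite diff_gradE.
Qed.

Lemma test_function_circle (psi : R * R -> R) x : test_function psi -> psi (cos x, sin x) = 0.
Proof.
move=> [_ _ h]; apply/eqP/negPn/negP => p0.
have /h : closure [set p | psi p != 0] (cos x, sin x) by exact: subset_closure.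
by rewrite /disk/= /Defs.radius/= cos2Dsin2 sqrtr1 ltxx.
Qed.

Lemma L2_approx_sqintegrable (u ux uy : R * R -> R) phi phix phiy :
  L2_approx u ux uy phi phix phiy -> forall k,
  [/\ Ck 1 (phi k), sqintegrable_disk (phi k), sqintegrable_disk (phix k) & sqintegrable_disk (phiy k)].
Proof.
move=> [A _ _ _] k; have [g cx cy] := A k.
have cphi : continuous (phi k).
  by move=> p; have [df _ _] := gradient_atP (g p); exact: differentiable_continuous.
split; first exact: Ck1_of_gradient g cx cy.
- exact: (bounded_sqintegrable (continuous_bounded_mfun_disk cphi)).
- exact: (bounded_sqintegrable (continuous_bounded_mfun_disk cx)).
- exact: (bounded_sqintegrable (continuous_bounded_mfun_disk cy)).
Qed.

(** The product of [phi k] and [psi] is C^1 and vanishes on the circle, so [disk_divergence] makes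
    the integral of its derivative zero; the identity follows in the L^2 limit. The coefficients [A]
    and [B] cover both partial derivatives at once. *)
Lemma L2_approx_weak (u ux uy : R * R -> R) phi phix phiy (A B : R) (psi : R * R -> R) :
  bounded_mfun_disk u -> bounded_mfun_disk ux -> bounded_mfun_disk uy ->
  L2_approx u ux uy phi phix phiy -> test_function psi ->
  \int[@mu2 R]_(p in @disk R) (u p * (A * 'D_((1, 0) : R * R) psi p + B * 'D_((0, 1) : R * R) psi p))
  = - \int[@mu2 R]_(p in @disk R) ((A * ux p + B * uy p) * psi p).
Proof.
move=> bu bux buy ap tpsi.
have sphi := L2_approx_sqintegrable ap.
have cpsi1 : Ck 1 psi by case: tpsi.
have [dpsi cpx cpy] := cpsi1.
have cpsi : continuous psi by move=> p; exact: differentiable_continuous.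
pose px := 'D_((1, 0) : R * R) psi; pose py := 'D_((0, 1) : R * R) psi.
have bpsi := continuous_bounded_mfun_disk cpsi.
have bpx : bounded_mfun_disk px := continuous_bounded_mfun_disk cpx.
have bpy : bounded_mfun_disk py := continuous_bounded_mfun_disk cpy.
have bc (c : R) : bounded_mfun_disk (fun _ => c).
  by split; [exact: measurable_cst|exists `|c|].
have bd := bounded_mfun_diskD (bounded_mfun_diskM (bc A) bpx) (bounded_mfun_diskM (bc B) bpy).
have bA := bounded_mfun_diskM (bc A) bpsi; have bB := bounded_mfun_diskM (bc B) bpsi.
have [apg a1 a2 a3] := ap.
have su := bounded_sqintegrable bu; have sux := bounded_sqintegrable bux.
have suy := bounded_sqintegrable buy.
have s1 k : sqintegrable_disk (phi k) by case: (sphi k).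
have s2 k : sqintegrable_disk (phix k) by case: (sphi k).
have s3 k : sqintegrable_disk (phiy k) by case: (sphi k).
(* Only three products occur; the fourth slot is filled with the factor 0. *)
have := Rintegral_L2_cvg4 bd bA bB (bc 0) (And3 s1 su a1) (And3 s2 sux a2) (And3 s3 suy a3) (And3 s1 su a1).
rewrite (_ : (fun k => _) = fun _ => 0); last first.
  apply/funext => k.
  have [g cx cy] := apg k.
  have cphi : continuous (phi k).
    by move=> p; have [df _ _] := gradient_atP (g p); exact: differentiable_continuous.
  have gM p := gradient_atM (g p) (Ck1_gradient p cpsi1).
  have cM : Ck 1 (fun q => phi k q * psi q).
    exact: (Ck1_of_gradient gM
      (continuous_funD (continuous_funM cx cpsi) (continuous_funM cphi cpx))
      (continuous_funD (continuous_funM cy cpsi) (continuous_funM cphi cpy))).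
  have := disk_divergence A B cM.
  have -> : \int[lebesgue_measure]_(x in `[0, 2 * pi])
      (trigc A B 1 x * (phi k (cos x, sin x) * psi (cos x, sin x))) = 0.
    transitivity (\int[@lebesgue_measure R]_(x in `[0, 2 * pi]) (0 : R)).
      by apply: eq_Rintegral => x _; rewrite (test_function_circle x tpsi) !mulr0.
    by rewrite Rintegral_cst// mul0r.
  move=> E0; rewrite -[RHS]E0; apply: eq_Rintegral => p _.
  by have [_ -> ->] := gradient_atP (gM p); rewrite /px /py; ring.
move=> cv; have E := cvg_unique (@Rhausdorff R) cv (cvg_cst (0 : R)).
apply/eqP; rewrite -addr_eq0; apply/eqP; rewrite -[RHS]E.
have i1 := bounded_integrable (bounded_mfun_diskM bu bd).
have i2 := bounded_integrable (bounded_mfun_diskM (bounded_mfun_diskD (bounded_mfun_diskM (bc A) bux) (bounded_mfun_diskM (bc B) buy)) bpsi).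
rewrite -RintegralD//; last exact: measurable_disk.
by apply: eq_Rintegral => p _; rewrite /px /py; ring.
Qed.

End weak_derivative.

Section complex_solution.
Context {R : realType}.
Local Open Scope complex_scope.
Notation mu := (@lebesgue_measure R).
Notation Rez := complex.Re.
Notation Imz := complex.Im.

Lemma complex_ext (z w : R[i]) : Rez z = Rez w -> Imz z = Imz w -> z = w.
Proof. by case: z => a b; case: w => c d /= -> ->. Qed.

Lemma Re_energy (gam : R * R -> R) (du dv : R * R -> R[i] * R[i]) :
  Rez (energy gam du dv) = \int[@mu2 R]_(p in @disk R)
    (gam p * Rez (du p).1 * Rez (dv p).1 + gam p * Imz (du p).1 * Imz (dv p).1
     + gam p * Rez (du p).2 * Rez (dv p).2 + gam p * Imz (du p).2 * Imz (dv p).2).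
Proof.
rewrite /energy /cintegral /=; apply: eq_Rintegral => p _.
by case: (du p) (dv p) => -[a b] [c d] [[a' b'] [c' d']] /=; ring.
Qed.

Lemma Im_energy (gam : R * R -> R) (du dv : R * R -> R[i] * R[i]) :
  Imz (energy gam du dv) = \int[@mu2 R]_(p in @disk R)
    (gam p * Imz (du p).1 * Rez (dv p).1 + - 1 * (gam p * Rez (du p).1) * Imz (dv p).1
     + gam p * Imz (du p).2 * Rez (dv p).2 + - 1 * (gam p * Rez (du p).2) * Imz (dv p).2).
Proof.
rewrite /energy /cintegral /=; apply: eq_Rintegral => p _.
by case: (du p) (dv p) => -[a b] [c d] [[a' b'] [c' d']] /=; ring.
Qed.

Lemma Re_energyC (gam : R * R -> R) (du dv : R * R -> R[i] * R[i]) :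
  Rez (energy gam du dv) = Rez (energy gam dv du).
Proof. by rewrite !Re_energy; apply: eq_Rintegral => p _; ring. Qed.

Lemma Ck1_continuous (f : R * R -> R) : Ck 1 f -> continuous f.
Proof. by move=> [df _ _] p; exact: differentiable_continuous. Qed.

Lemma circle_integrable (A B : R) n (f : R * R -> R) : continuous f ->
  mu.-integrable `[0, 2 * pi] (EFin \o (fun x => trigc A B n x * f (cos x, sin x))).
Proof.
move=> cf; apply: continuous_integrable_itv.
have cp : continuous (fun x : R => (cos x, sin x)).
  by apply: continuous_pair; [exact: continuous_cos|exact: continuous_sin].
apply: continuous_funM; [exact: continuous_trigc|exact: continuous_compose cp cf].
Qed.

Lemma boundary_coefE (n : nat) (phi : R * R -> R[i]) : C1 phi ->
  2 * pi * Rez (boundary_coef phi n) =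
    \int[mu]_(x in `[0, 2 * pi]) (trigc 1 0 n x * Rez (phi (cos x, sin x)))
    + \int[mu]_(x in `[0, 2 * pi]) (trigc 0 1 n x * Imz (phi (cos x, sin x))) /\
  2 * pi * Imz (boundary_coef phi n) =
    \int[mu]_(x in `[0, 2 * pi]) (trigc 1 0 n x * Imz (phi (cos x, sin x)))
    - \int[mu]_(x in `[0, 2 * pi]) (trigc 0 1 n x * Rez (phi (cos x, sin x))).
Proof.
move=> [/Ck1_continuous c1 /Ck1_continuous c2].
have pi2 : 2 * pi != 0 :> R by rewrite mulf_neq0 ?pnatr_eq0// gt_eqF// pi_gt0.
have i1 A B := circle_integrable A B n c1; have i2 A B := circle_integrable A B n c2.
rewrite -RintegralD// -RintegralB// /boundary_coef /cintegral /= !mul0r subr0 addr0 !mulVKf//.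
split; apply: eq_Rintegral => x _; case: (phi _) => a b; rewrite /trigc /= -pmulrn; ring.
Qed.

Variables (m : nat) (a : R) (al : @param R) (P P' Q Q' : R -> R).
Let n := m.+1.
Hypothesis a01 : 0 < a < 1.
Hypothesis prof : profile n a al P P' Q Q'.
Let gam := conductivity a al.
Let lam := dn_eigenvalue n a al.

(** This is z^n times the radial part: (A, B) = (1, 0) selects the real part of z^n, and (0, 1) the
    imaginary part. *)
Definition csol (p : R * R) : R[i] := sol m a P Q 1 0 p +i* sol m a P Q 0 1 p.
Definition cgrad (p : R * R) : R[i] * R[i] :=
  (solx m a P P' Q Q' 1 0 p +i* solx m a P P' Q Q' 0 1 p,
   soly m a P P' Q Q' 1 0 p +i* soly m a P P' Q Q' 0 1 p).

(** [sol_green] for the two real solutions against the two real components of [phi], recombined. The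
    energy is conjugate linear in its second argument, hence the conjugate coefficient. *)
Lemma energy_C1 (phi : R * R -> R[i]) : C1 phi ->
  energy gam cgrad (grad phi) = (2 * pi * lam)%:C * conjc (boundary_coef phi n).
Proof.
move=> C1phi; have [E1 E2] := boundary_coefE n C1phi.
have [k1 k2] := C1phi.
have bg := conductivity_bounded al a01.
have [_ bx1 by1 _] := sol_approx a01 prof 1 0; have [_ bx2 by2 _] := sol_approx a01 prof 0 1.
have iG (A B : R) (f : R * R -> R) : Ck 1 f -> (@mu2 R).-integrable (@disk R) (EFin \o (fun p => gam p *
     (solx m a P P' Q Q' A B p * 'D_((1, 0) : R * R) f p
      + soly m a P P' Q Q' A B p * 'D_((0, 1) : R * R) f p))).
  case=> _ cx cy; have [_ bx by_ _] := sol_approx a01 prof A B.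
  exact: (bounded_integrable (bounded_mfun_diskM bg (bounded_mfun_diskD
    (bounded_mfun_diskM bx (continuous_bounded_mfun_disk cx))
    (bounded_mfun_diskM by_ (continuous_bounded_mfun_disk cy))))).
have G (A B : R) (f : R * R -> R) (cf : Ck 1 f) :
  lam * \int[mu]_(x in `[0, 2 * pi]) (trigc A B n x * f (cos x, sin x)) = _ :=
  esym (sol_green a01 prof A B cf).
have md := @measurable_disk R.
apply: complex_ext.
  transitivity (lam * (2 * pi * Rez (boundary_coef phi n))).
    rewrite E1 mulrDr (G _ _ _ k1) (G _ _ _ k2) -RintegralD//; try exact: iG.
    rewrite Re_energy; apply: eq_Rintegral => p _; rewrite /cgrad /grad /pderive /= -/gam; ring.
  by case: (boundary_coef _ _) => x y /=; ring.
transitivity (- (lam * (2 * pi * Imz (boundary_coef phi n)))).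
  rewrite E2 mulrBr (G _ _ _ k1) (G _ _ _ k2) opprB -RintegralB//; try exact: iG.
  rewrite Im_energy; apply: eq_Rintegral => p _; rewrite /cgrad /grad /pderive /= -/gam; ring.
by case: (boundary_coef _ _) => x y /=; ring.
Qed.

End complex_solution.

Section weak_solution_existence.
Context {R : realType}.
Local Open Scope complex_scope.
Notation mu := (@lebesgue_measure R).
Notation Rez := complex.Re.
Notation Imz := complex.Im.

Lemma cvg_of_sqr (u : nat -> R) (l : R) (v : nat -> \bar R) :
  (forall k, (((u k - l) ^+ 2)%:E <= v k)%E) -> v @ \oo --> 0%E -> u @ \oo --> l.
Proof.
move=> uv cv.
have : (fun k => ((u k - l) ^+ 2)%:E) @ \oo --> (0 : R)%:E.
  by apply: cvg0_le uv cv => k; rewrite lee_fin sqr_ge0.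
move=> /fine_cvgP[_ /cvgrPdist_le h]; apply/cvgrPdist_le => e e0.
have := h (e ^+ 2) (exprn_gt0 2 e0); apply: filterS => k /=.
rewrite sub0r normrN ger0_norm ?sqr_ge0// distrC => le2.
by rewrite -(@ler_pXn2r _ 2)// ?nnegrE ?normr_ge0 ?(ltW e0)// real_normK ?num_real.
Qed.

(** For s >= 0 all weights are at least 1, so the norm dominates each single coefficient. *)
Lemma Hsnormsq_cvg_coef (s : R) (f : nat -> int -> R[i]) (g : int -> R[i]) (n : int) : 0 <= s ->
  (fun k => Hsnormsq s (fun j => f k j - g j)) @ \oo --> 0%E ->
  (fun k => Rez (f k n)) @ \oo --> Rez (g n) /\ (fun k => Imz (f k n)) @ \oo --> Imz (g n).
Proof.
move=> s0 cv.
have key k : ((ComplexField.Normc.normc (f k n - g n) ^+ 2)%:E <= Hsnormsq s (fun j => f k j - g j)%R)%E.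
  apply: le_trans (Hsnormsq_ge _ _ n); rewrite lee_fin.
  apply: ler_peMl; first exact: sqr_ge0.
  rewrite -[leLHS](powRr0 (1 + n%:~R ^+ 2)); apply: ler_powR => //.
  by rewrite lerDl sqr_ge0.
split; apply: cvg_of_sqr cv => k; apply: le_trans (key k); rewrite lee_fin normc_sqr !raddfB/=.
  by rewrite lerDl sqr_ge0.
by rewrite lerDr sqr_ge0.
Qed.

Lemma weak_pderiveP (e : R * R) (u w : R * R -> R[i]) :
  (forall phi, test_function phi ->
    \int[@mu2 R]_(p in @disk R) (Rez (u p) * 'D_e phi p) = - (\int[@mu2 R]_(p in @disk R) (Rez (w p) * phi p)) /\
    \int[@mu2 R]_(p in @disk R) (Imz (u p) * 'D_e phi p) = - (\int[@mu2 R]_(p in @disk R) (Imz (w p) * phi p))) ->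
  weak_pderive e u w.
Proof.
move=> h phi /h [hr hi].
have Rm (z : R[i]) (c : R) : Rez (z * c%:C) = Rez z * c by case: z => x y /=; ring.
have Im (z : R[i]) (c : R) : Imz (z * c%:C) = Imz z * c by case: z => x y /=; ring.
have ER (z : R * R -> R[i]) (f : R * R -> R) : \int[@mu2 R]_(p in @disk R) Rez (z p * (f p)%:C) =
  \int[@mu2 R]_(p in @disk R) (Rez (z p) * f p) by apply: eq_Rintegral => p _; exact: Rm.
have EI (z : R * R -> R[i]) (f : R * R -> R) : \int[@mu2 R]_(p in @disk R) Imz (z p * (f p)%:C) =
  \int[@mu2 R]_(p in @disk R) (Imz (z p) * f p) by apply: eq_Rintegral => p _; exact: Im.
by rewrite /cintegral; apply: complex_ext => /=; rewrite ?ER ?EI.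
Qed.

Lemma gradE (phi : R * R -> R[i]) p (ax ay bx by_ : R) :
  gradient_at (fun q => Rez (phi q)) p ax ay -> gradient_at (fun q => Imz (phi q)) p bx by_ ->
  grad phi p = (ax +i* bx, ay +i* by_).
Proof.
move=> /gradient_atP[_ h1 h2] /gradient_atP[_ h3 h4].
by rewrite /grad /pderive h1 h2 h3 h4.
Qed.

Lemma C1_grad_L2 (phi : R * R -> R[i]) : C1 phi ->
  [/\ sqintegrable_disk (fun p => Rez (grad phi p).1), sqintegrable_disk (fun p => Imz (grad phi p).1),
      sqintegrable_disk (fun p => Rez (grad phi p).2) & sqintegrable_disk (fun p => Imz (grad phi p).2)].
Proof.
move=> [[_ c1 c2] [_ c3 c4]].
have h (f : R * R -> R) (cf : continuous f) := bounded_sqintegrable (continuous_bounded_mfun_disk cf).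
by split; [exact: h c1|exact: h c3|exact: h c2|exact: h c4].
Qed.

(** With [du] and [gam] bounded, L^2 convergence of the other gradient is enough. This carries
    [energy_C1] from C^1 functions to H^1. *)
Lemma energy_cvg (gam : R * R -> R) (du dv : R * R -> R[i] * R[i]) (phi : nat -> R * R -> R[i]) :
  bounded_mfun_disk gam ->
  bounded_mfun_disk (fun p => Rez (du p).1) -> bounded_mfun_disk (fun p => Imz (du p).1) ->
  bounded_mfun_disk (fun p => Rez (du p).2) -> bounded_mfun_disk (fun p => Imz (du p).2) ->
  (forall k, C1 (phi k)) -> L2 (fun p => (dv p).1) -> L2 (fun p => (dv p).2) ->
  (fun k => L2normsq (fun p => (grad (phi k) p - dv p).1)) @ \oo --> 0%E ->
  (fun k => L2normsq (fun p => (grad (phi k) p - dv p).2)) @ \oo --> 0%E ->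
  (fun k => Rez (energy gam du (grad (phi k)))) @ \oo --> Rez (energy gam du dv) /\
  (fun k => Imz (energy gam du (grad (phi k)))) @ \oo --> Imz (energy gam du dv).
Proof.
move=> bg b1 b2 b3 b4 cphi l1 l2 cv1 cv2.
have [/L2P[s1 s2] /L2P[s3 s4]] := (l1, l2).
have sk1 k : sqintegrable_disk (fun p => Rez (grad (phi k) p).1) by have [] := C1_grad_L2 (cphi k).
have sk2 k : sqintegrable_disk (fun p => Imz (grad (phi k) p).1) by have [] := C1_grad_L2 (cphi k).
have sk3 k : sqintegrable_disk (fun p => Rez (grad (phi k) p).2) by have [] := C1_grad_L2 (cphi k).
have sk4 k : sqintegrable_disk (fun p => Imz (grad (phi k) p).2) by have [] := C1_grad_L2 (cphi k).
have m1 k : cmeasurable_disk (fun p => (grad (phi k) p - dv p).1).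
  by apply: (@cmeasurableB _ (fun p => (grad (phi k) p).1) (fun p => (dv p).1)); split; [have [] := sk1 k|have [] := sk2 k|have [] := s1|have [] := s2].
have m2 k : cmeasurable_disk (fun p => (grad (phi k) p - dv p).2).
  by apply: (@cmeasurableB _ (fun p => (grad (phi k) p).2) (fun p => (dv p).2)); split; [have [] := sk3 k|have [] := sk4 k|have [] := s3|have [] := s4].
move: cv1 => /(L2normsq_cvg0 m1)[r1 r2].
move: cv2 => /(L2normsq_cvg0 m2)[r3 r4].
have q (f g : nat -> R * R -> R) (h : R * R -> R) : (forall k p, f k p = g k p - h p) ->
    (fun k => \int[@mu2 R]_(p in @disk R) ((f k p) ^+ 2)%:E)%E @ \oo --> 0%E ->
    (fun k => \int[@mu2 R]_(p in @disk R) ((g k p - h p) ^+ 2)%:E)%E @ \oo --> 0%E.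
  move=> fgh; have -> // : f = fun k p => g k p - h p.
  by apply/funext => k; apply/funext => p.
have q1 := q _ (fun k p => Rez (grad (phi k) p).1) (fun p => Rez (dv p).1) (fun k p => raddfB _ _ _) r1.
have q2 := q _ (fun k p => Imz (grad (phi k) p).1) (fun p => Imz (dv p).1) (fun k p => raddfB _ _ _) r2.
have q3 := q _ (fun k p => Rez (grad (phi k) p).2) (fun p => Rez (dv p).2) (fun k p => raddfB _ _ _) r3.
have q4 := q _ (fun k p => Imz (grad (phi k) p).2) (fun p => Imz (dv p).2) (fun k p => raddfB _ _ _) r4.
have bN (b : R * R -> R) : bounded_mfun_disk b -> bounded_mfun_disk (fun p => - 1 * b p).
  apply: bounded_mfun_diskM; split; first exact: measurable_cst.
  by exists `|- 1|.
have G b (hb : bounded_mfun_disk b) := bounded_mfun_diskM bg hb.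
split.
  rewrite Re_energy; under eq_fun do rewrite Re_energy.
  exact: (Rintegral_L2_cvg4 (G _ b1) (G _ b2) (G _ b3) (G _ b4)
    (And3 sk1 s1 q1) (And3 sk2 s2 q2) (And3 sk3 s3 q3) (And3 sk4 s4 q4)).
rewrite Im_energy; under eq_fun do rewrite Im_energy.
exact: (Rintegral_L2_cvg4 (G _ b2) (bN _ (G _ b1)) (G _ b4) (bN _ (G _ b3))
  (And3 sk1 s1 q1) (And3 sk2 s2 q2) (And3 sk3 s3 q3) (And3 sk4 s4 q4)).
Qed.

Variables (m : nat) (a : R) (al : @param R) (P P' Q Q' : R -> R).
Let n := m.+1.
Hypothesis a01 : 0 < a < 1.
Hypothesis prof : profile n a al P P' Q Q'.
Let gam := conductivity a al.
Let lam := dn_eigenvalue n a al.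
Let u := csol m a P Q.
Let du := cgrad m a P P' Q Q'.

Lemma csol_H1 : H1 u du.
Proof.
have [b1 x1 y1 [p1 [px1 [py1 [ap1 _]]]]] := sol_approx a01 prof 1 0.
have [b2 x2 y2 [p2 [px2 [py2 [ap2 _]]]]] := sol_approx a01 prof 0 1.
have W1 (A B : R) psi := @L2_approx_weak R _ _ _ _ _ _ A B psi b1 x1 y1 ap1.
have W2 (A B : R) psi := @L2_approx_weak R _ _ _ _ _ _ A B psi b2 x2 y2 ap2.
split.
- by apply/L2P; split; exact: bounded_sqintegrable.
- by apply/L2P; split; exact: bounded_sqintegrable.
- by apply/L2P; split; exact: bounded_sqintegrable.
- apply: weak_pderiveP => psi tpsi; split.
    have := W1 1 0 psi tpsi; under eq_Rintegral do rewrite mul1r mul0r addr0.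
    move=> ->; congr (- _).
    by apply: eq_Rintegral => p _; rewrite mul1r mul0r addr0.
  have := W2 1 0 psi tpsi; under eq_Rintegral do rewrite mul1r mul0r addr0.
  move=> ->; congr (- _).
  by apply: eq_Rintegral => p _; rewrite mul1r mul0r addr0.
- apply: weak_pderiveP => psi tpsi; split.
    have := W1 0 1 psi tpsi; under eq_Rintegral do rewrite mul1r mul0r add0r.
    move=> ->; congr (- _).
    by apply: eq_Rintegral => p _; rewrite mul1r mul0r add0r.
  have := W2 0 1 psi tpsi; under eq_Rintegral do rewrite mul1r mul0r add0r.
  move=> ->; congr (- _).
  by apply: eq_Rintegral => p _; rewrite mul1r mul0r add0r.
Qed.

Lemma csol_trace : trace u du (delta n 1).
Proof.
have [b1 x1 y1 [p1 [px1 [py1 [ap1 e1]]]]] := sol_approx a01 prof 1 0.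
have [b2 x2 y2 [p2 [px2 [py2 [ap2 e2]]]]] := sol_approx a01 prof 0 1.
have [g1 l1 lx1 ly1] := ap1; have [g2 l2 lx2 ly2] := ap2.
pose phi k p := p1 k p +i* p2 k p.
have cphi k : C1 (phi k).
  have [h1 _ _ _] := L2_approx_sqintegrable ap1 k.
  by have [h2 _ _ _] := L2_approx_sqintegrable ap2 k.
have gphi k p : grad (phi k) p = (px1 k p +i* px2 k p, py1 k p +i* py2 k p).
  by have [G1 _ _] := g1 k; have [G2 _ _] := g2 k; exact: gradE.
have ms f (s : sqintegrable_disk f) : measurable_fun (@disk R : set (@plane R)) (f : @plane R -> measurableTypeR R) by case: s.
exists phi; split => //.
- apply/H1normsq_cvg0.
  have key (f1 f2 : nat -> R * R -> R) (h1 h2 : R * R -> R) (z : nat -> R * R -> R[i]) :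
    (forall k, sqintegrable_disk (f1 k)) -> (forall k, sqintegrable_disk (f2 k)) ->
    bounded_mfun_disk h1 -> bounded_mfun_disk h2 ->
    (forall k p, z k p = (f1 k p +i* f2 k p) - (h1 p +i* h2 p)) ->
    (fun k => \int[@mu2 R]_(p in @disk R) ((f1 k p - h1 p) ^+ 2)%:E)%E @ \oo --> 0%E ->
    (fun k => \int[@mu2 R]_(p in @disk R) ((f2 k p - h2 p) ^+ 2)%:E)%E @ \oo --> 0%E ->
    (fun k => L2normsq (z k)) @ \oo --> 0%E.
    move=> s1 s2 c1 c2 zE v1 v2.
    have -> : z = (fun k p => (f1 k p +i* f2 k p) - (h1 p +i* h2 p)).
      by apply/funext => k; apply/funext => p.
    apply/L2normsq_cvg0 => // k; split.
      exact: (measurable_funB (ms _ (s1 k)) (ms _ (bounded_sqintegrable c1))).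
    exact: (measurable_funB (ms _ (s2 k)) (ms _ (bounded_sqintegrable c2))).
  have S1 := L2_approx_sqintegrable ap1; have S2 := L2_approx_sqintegrable ap2.
  split.
  + by apply: (key p1 p2 _ _ _ _ _ b1 b2) => // k; [case: (S1 k)|case: (S2 k)].
  + apply: (key px1 px2 _ _ _ _ _ x1 x2) => //.
    * by move=> k; case: (S1 k).
    * by move=> k; case: (S2 k).
    * by move=> k p; rewrite gphi.
  + apply: (key py1 py2 _ _ _ _ _ y1 y2) => //.
    * by move=> k; case: (S1 k).
    * by move=> k; case: (S2 k).
    * by move=> k p; rewrite gphi.
(* The boundary values of the approximations are exact, so this norm is 0 for every k and not merely
   in the limit. *)
- have -> : (fun k => Hsnormsq 2^-1 (fun j => boundary_coef (phi k) j - delta n 1 j)) = fun _ => 0%E.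
    apply/funext => k; rewrite (@boundary_coef_trig _ n); last by move=> x; rewrite /phi e1 e2.
    apply: esum1 => j _; rewrite subrr normc0 expr0n mulr0//.
  exact: cvg_cst.
Qed.

(** A test function vanishes on the circle, so the boundary coefficient in [energy_C1] is 0. *)
Lemma csol_weak_solution : weak_solution gam (delta n 1) u du.
Proof.
split; [exact: csol_H1|exact: csol_trace|].
move=> psi tpsi.
have C1psi : C1 (fun p => (psi p)%:C).
  split; first by case: tpsi => h _ _; exact: (h 1%N).
  exact: (Ck1_of_gradient (gradient_at_cst 0) (@continuous_cst _ _ 0) (@continuous_cst _ _ 0)).
have -> := energy_C1 a01 prof C1psi.
have [E1 E2] := boundary_coefE n C1psi.
have z0 (A B : R) (f : R -> R) : (forall x, f x = 0) ->
    \int[mu]_(x in `[0, 2 * pi]) (trigc A B n x * f x) = 0.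
  move=> f0; transitivity (\int[mu]_(x in `[0, 2 * pi]) (0 : R)); last by rewrite Rintegral_cst ?mul0r.
  by apply: eq_Rintegral => x _; rewrite f0 mulr0.
have pi2 : 2 * pi != 0 :> R by rewrite mulf_neq0 ?pnatr_eq0// gt_eqF// pi_gt0.
have cz x : psi (cos x, sin x) = 0 := test_function_circle x tpsi.
have bc0 : boundary_coef (fun p => (psi p)%:C) n = 0.
  by move: E1 E2; rewrite !z0// addr0 subr0 => /eqP; rewrite mulf_eq0 (negbTE pi2) => /eqP r0 /eqP;
    rewrite mulf_eq0 (negbTE pi2) => /eqP i0; exact: complex_ext.
rewrite bc0.
by rewrite conjc0 mulr0.
Qed.

(** The definition of [trace] supplies C^1 approximations of [v] whose boundary coefficients
    converge to those of [g]; both sides of [energy_C1] pass to the limit. *)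
Lemma csol_conormal : conormal_derivative gam du (delta n lam%:C).
Proof.
split; first exact: Hs_delta.
move=> v dv g [_ l1 l2 _ _] [phi [cphi cvH cvB]].
rewrite (@pairing_single _ _ _ n); last first.
  by move=> j jn; rewrite /delta (negbTE jn) mul0r.
rewrite {1}/delta eqxx.
have [b1 x1 y1 _] := sol_approx a01 prof 1 0; have [b2 x2 y2 _] := sol_approx a01 prof 0 1.
move: cvH => /H1normsq_cvg0[_ c1 c2].
have [er ei] := @energy_cvg gam du dv phi (conductivity_bounded al a01) x1 x2 y1 y2 cphi l1 l2 c1 c2.
have s0 : 0 <= 2^-1 :> R by rewrite invr_ge0.
have [fr fi] := Hsnormsq_cvg_coef n s0 cvB.
have E k : energy gam du (grad (phi k)) = (2 * pi * lam)%:C * conjc (boundary_coef (phi k) n) := energy_C1 a01 prof (cphi k).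
have ReM (z : R[i]) (c : R) : Rez (c%:C * conjc z) = c * Rez z by case: z => x y /=; ring.
have ImM (z : R[i]) (c : R) : Imz (c%:C * conjc z) = - c * Imz z by case: z => x y /=; ring.
have -> : (2 * pi)%:C * (lam%:C * conjc (g n)) = (2 * pi * lam)%:C * conjc (g n).
  by rewrite mulrA -rmorphM.
have rE : (fun k => Rez (energy gam du (grad (phi k)))) = (fun k => 2 * pi * lam * Rez (boundary_coef (phi k) n)).
  by apply/funext => k; rewrite E ReM.
have iE : (fun k => Imz (energy gam du (grad (phi k)))) = (fun k => - (2 * pi * lam) * Imz (boundary_coef (phi k) n)).
  by apply/funext => k; rewrite E ImM.
rewrite rE in er; rewrite iE in ei.
apply: complex_ext.
  apply: (cvg_unique (@Rhausdorff R) er); rewrite ReM.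
  by apply: cvgM fr; exact: cvg_cst.
apply: (cvg_unique (@Rhausdorff R) ei); rewrite ImM.
by apply: cvgM fi; exact: cvg_cst.
Qed.

End weak_solution_existence.

(** * Lower bound for the distance of two Dirichlet-to-Neumann maps *)

Section DN_lower_bound.
Context {R : realType}.
Local Open Scope complex_scope.
Notation Rez := complex.Re.
Notation Imz := complex.Im.

(* Uniqueness of the solution is not needed: whichever [h] the choice in [DN] returns, the
   symmetry of the energy against the explicit solution fixes its coefficient of index [m.+1]. *)
Lemma DN_delta (m : nat) (a : R) (al : @param R) :
  0 < a < 1 -> 0 < par0 al -> 0 < par1 al -> 0 <= par2 al ->
  let h := DN (conductivity a al) (delta m.+1 1) in
  Hs (- 2^-1) h /\ Rez (h m.+1) = dn_eigenvalue m.+1 a al.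
Proof.
move=> a01 al0 al1 al2 h.
have [P [P' [Q [Q' prof]]]] : exists P P' Q Q', profile m.+1 a al P P' Q Q'.
  by do 4 eexists; exact: profileP.
have ws := csol_weak_solution a01 prof; have cn := csol_conormal a01 prof.
have [v [dv [[v1 v2 v3] [hs hc]]]] : [set h | exists u du,
    weak_solution (conductivity a al) (delta m.+1 1) u du /\
    conormal_derivative (conductivity a al) du h] h.
  apply: (@xgetPex _ _ [set h | exists u du,
    weak_solution (conductivity a al) (delta m.+1 1) u du /\
    conormal_derivative (conductivity a al) du h]).
  by do 3 eexists; split; [exact: ws|exact: cn].
split => //.
have [w1 w2 w3] := ws; have [_ cn2] := cn.
have E1 := hc _ _ _ w1 w2; have E2 := cn2 _ _ _ v1 v2.
have := Re_energyC (conductivity a al) dv (cgrad m a P P' Q Q').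
rewrite E1 E2 !(@pairing_single _ _ _ m.+1); last 2 first.
- by move=> j /negbTE jn; rewrite /delta jn mul0r.
- by move=> j /negbTE jn; rewrite /delta jn conjc0 mulr0.
rewrite /delta eqxx conjc1 !mulr1 -rmorphM.
have pi2 : 2 * pi != 0 :> R by rewrite mulf_neq0 ?pnatr_eq0// gt_eqF// pi_gt0.
case: (h m.+1) => x y /=; rewrite mul0r subr0.
exact: (mulfI pi2).
Qed.

(** The supremum is tested on e^(i n theta) with n = m + 1, and only the real part of coefficient n
    of the image is kept. The weights (1 + n^2)^(-1/4) of the image and (1 + n^2)^(1/4) of the datum
    combine to the square root. *)
Lemma star_dist_ge (m : nat) (a : R) (al be : @param R) : 0 < a < 1 ->
  0 < par0 al -> 0 < par1 al -> 0 <= par2 al ->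
  0 < par0 be -> 0 < par1 be -> 0 <= par2 be ->
  ((`|dn_eigenvalue m.+1 a al - dn_eigenvalue m.+1 a be| / Num.sqrt (1 + m.+1%:R ^+ 2))%:E
    <= star_dist (DN (conductivity a al)) (DN (conductivity a be)))%E.
Proof.
move=> a01 al0 al1 al2 be0 be1 be2.
have [ha ea] := DN_delta m a01 al0 al1 al2; have [hb eb] := DN_delta m a01 be0 be1 be2.
set h1 := DN _ _ in ha ea; set h2 := DN _ _ in hb eb.
have d0 : delta m.+1 1 <> 0 :> (int -> R[i]).
  by move=> /(congr1 (fun f => f m.+1%:Z)); rewrite /delta eqxx => /eqP; rewrite oner_eq0.
apply: le_trans (_ : ((Hsnorm (- 2^-1) (h1 - h2) / Hsnorm 2^-1 (delta m.+1 1))%:E <= _)%E); last first.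
  by apply: ereal_sup_ubound; exists (delta m.+1 1) => //; split => //; exact: Hs_delta.
rewrite lee_fin.
set c := 1 + m.+1%:R ^+ 2.
have c0 : 0 < c by rewrite ltr_wpDr ?sqr_ge0.
set q := Num.sqrt c; have q0 : 0 < q by rewrite sqrtr_gt0.
have cq : c `^ 2^-1 = q by rewrite powR12_sqrt// ltW.
have cq' : c `^ (- 2^-1) = q^-1 by rewrite powRN cq.
have -> : Hsnorm 2^-1 (delta m.+1 (1 : R[i])) = Num.sqrt q.
  by rewrite /Hsnorm Hsnormsq_delta /= -/c cq expr1n expr0n/= addr0 sqrtr1 expr1n mulr1.
set d := `|_ - _|.
have le1 : Num.sqrt (q^-1 * d ^+ 2) <= Hsnorm (- 2^-1) (h1 - h2).
  rewrite /Hsnorm ler_wsqrtr// -lee_fin fineK; last first.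
    by rewrite ge0_fin_numE ?Hsnormsq_ge0//; exact: HsB.
  apply: le_trans (Hsnormsq_ge _ _ m.+1); rewrite lee_fin -pmulrn -/c cq'.
  apply: ler_wpM2l; first by rewrite invr_ge0 ltW.
  rewrite normc_sqr /d real_normK ?num_real// -ea -eb -raddfB /=.
  by rewrite lerDl sqr_ge0.
apply: le_trans (_ : Num.sqrt (q^-1 * d ^+ 2) / Num.sqrt q <= _).
  rewrite sqrtrM ?invr_ge0 ?(ltW q0)// sqrtr_sqr normr_id sqrtrV ?(ltW q0)//.
  have sq : Num.sqrt q * Num.sqrt q = q by rewrite -expr2 sqr_sqrtr ?ltW.
  by rewrite -{1}sq invfM mulrCA mulrA mulrC mulrA.
by rewrite ler_wpM2r// invr_ge0 sqrtr_ge0.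
Qed.

End DN_lower_bound.

(** * Stability of the parameters *)

Section stability_algebra.
Context {R : realType}.

(** [dn_eigenvalue] divided by its index, with T = [par0], F = [admittance] and q = a^(2n). For
    fixed T and q it is a Moebius map in F with determinant 4 q T^2. *)
Definition reduced_eigenvalue (T F q : R) := T * ((T + F - q * (T - F)) / (T + F + q * (T - F))).

Section bounds.
Variables (eps M q : R).
Hypothesis eps0 : 0 < eps.
Hypothesis q01 : 0 < q < 1.

Lemma reduced_denominator (T F : R) : eps <= T <= M -> eps <= F <= M ->
  eps <= T + F + q * (T - F) <= 3 * M.
Proof.
move=> /andP[T1 T2] /andP[F1 F2]; have /andP[q0 q1] := q01; have e0 := eps0.
by apply/andP; split; nra.
Qed.

(** The deviation from T is exactly - 2 q T (T - F) / D, where the denominator D is at least eps. *)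
Lemma reduced_eigenvalue_near (T F : R) : eps <= T <= M -> eps <= F <= M ->
  `|reduced_eigenvalue T F q - T| <= q * (2 * M ^+ 2 / eps).
Proof.
move=> hT hF; have /andP[D1 _] := reduced_denominator hT hF.
have D0 : 0 < T + F + q * (T - F) by exact: lt_le_trans eps0 D1.
have /andP[T1 T2] := hT; have /andP[F1 F2] := hF; have /andP[q0 q1] := q01; have e0 := eps0.
have -> : reduced_eigenvalue T F q - T = - (q * (2 * T * (T - F) / (T + F + q * (T - F)))).
  by rewrite /reduced_eigenvalue; field; rewrite gt_eqF.
rewrite normrN normrM (gtr0_norm q0); apply: ler_wpM2l; first exact: ltW.
rewrite normrM normfV (gtr0_norm D0).
have M0 : 0 <= M by lra.
apply: ler_pM; [exact: normr_ge0|by rewrite invr_ge0 ltW| |by rewrite lef_pV2 ?posrE].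
rewrite !normrM (gtr0_norm (ltr0n _ 2 : 0 < 2 :> R)) expr2 -mulrA.
apply: ler_wpM2l => //; apply: ler_pM => //; first by rewrite ger0_norm//; lra.
by rewrite ler_norml; apply/andP; split; lra.
Qed.

(** The difference is split at (T', F). Changing F alone gives 4 q T'^2 (F - F') over two
    denominators of size at most 3 M, which is solved for F - F'; changing T alone is Lipschitz. For
    q = a^(2n) the factor 1 / q grows exponentially with the index, so the estimate serves fixed
    indices only. *)
Lemma reduced_eigenvalue_lip (T T' F F' : R) :
  eps <= T <= M -> eps <= T' <= M -> eps <= F <= M -> eps <= F' <= M ->
  `|F - F'| <= 9 * M ^+ 2 / (4 * q * eps ^+ 2) *
    (`|reduced_eigenvalue T F q - reduced_eigenvalue T' F' q| + 6 * M ^+ 2 / eps ^+ 2 * `|T - T'|).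
Proof.
move=> hT hT' hF hF'.
have /andP[q0 q1] := q01; have e0 := eps0.
have /andP[D1 B1] := reduced_denominator hT hF.
have /andP[D2 B2] := reduced_denominator hT' hF.
have /andP[D3 B3] := reduced_denominator hT' hF'.
set d1 := T + F + _ in D1 B1; set d2 := T' + F + _ in D2 B2; set d3 := T' + F' + _ in D3 B3.
have d10 : 0 < d1 by exact: lt_le_trans e0 D1.
have d20 : 0 < d2 by exact: lt_le_trans e0 D2.
have d30 : 0 < d3 by exact: lt_le_trans e0 D3.
have M0 : 0 <= M by move/andP: hT => [? ?]; lra.
pose X := reduced_eigenvalue T F q - reduced_eigenvalue T' F q.
pose Y := reduced_eigenvalue T' F q - reduced_eigenvalue T' F' q.
have YE : F - F' = d2 * d3 / (4 * q * T' ^+ 2) * Y.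
  have T'0 : 0 < T' by move/andP: hT' => [h _]; exact: lt_le_trans h.
  by rewrite /Y /reduced_eigenvalue -/d2 -/d3 /d2 /d3; field; rewrite -/d2 -/d3 !gt_eqF.
have XE : X = (T - T') * ((T * T' * (1 - q) * (1 + q) + (T + T') * F * (1 - q) ^+ 2 + F ^+ 2 * (1 - q) * (1 + q)) / (d1 * d2)).
  by rewrite /X /reduced_eigenvalue -/d1 -/d2 /d1 /d2; field; rewrite -/d1 -/d2 !gt_eqF.
have Xle : `|X| <= 6 * M ^+ 2 / eps ^+ 2 * `|T - T'|.
  rewrite XE normrM mulrC; apply: ler_wpM2r; first exact: normr_ge0.
  have num0 : 0 <= T * T' * (1 - q) * (1 + q) + (T + T') * F * (1 - q) ^+ 2 + F ^+ 2 * (1 - q) * (1 + q).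
    move/andP: hT => [? ?]; move/andP: hT' => [? ?]; move/andP: hF => [? ?].
    have ? : 0 <= T by lra. have ? : 0 <= T' by lra. have ? : 0 <= F by lra.
    have ? : 0 <= 1 - q by lra. have ? : 0 <= 1 + q by lra.
    apply: addr_ge0; [apply: addr_ge0|]; apply: mulr_ge0 => //; rewrite ?sqr_ge0//.
    - by apply: mulr_ge0 => //; apply: mulr_ge0.
    - by apply: mulr_ge0 => //; apply: addr_ge0.
    - by apply: mulr_ge0 => //; exact: sqr_ge0.
  rewrite ger0_norm; last by rewrite divr_ge0// mulr_ge0 ?ltW.
  apply: ler_pM => //; first by rewrite invr_ge0 mulr_ge0 ?ltW.
    move/andP: hT => [? ?]; move/andP: hT' => [? ?]; move/andP: hF => [? ?].
    have [t0 t0' f0] : [/\ 0 <= T, 0 <= T' & 0 <= F] by split; lra.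
    have h1 : T * T' <= M ^+ 2 by rewrite expr2 ler_pM.
    have h2 : (T + T') * F <= 2 * M ^+ 2.
      have -> : 2 * M ^+ 2 = (M + M) * M by ring.
      by apply: ler_pM => //; lra.
    have h3 : F ^+ 2 <= M ^+ 2 by rewrite ler_pXn2r ?nnegrE.
    have k1 : (1 - q) * (1 + q) <= 1 by nra.
    have k1' : 0 <= (1 - q) * (1 + q) by nra.
    have k2 : (1 - q) ^+ 2 <= 1 by nra.
    have m2 := sqr_ge0 M.
    have r1 : T * T' * ((1 - q) * (1 + q)) <= M ^+ 2 * 1 by apply: ler_pM => //; exact: mulr_ge0.
    have r2 : (T + T') * F * (1 - q) ^+ 2 <= 2 * M ^+ 2 * 1.
      by apply: ler_pM => //; [rewrite mulr_ge0// addr_ge0|exact: sqr_ge0].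
    have r3 : F ^+ 2 * ((1 - q) * (1 + q)) <= M ^+ 2 * 1 by apply: ler_pM => //; exact: sqr_ge0.
    lra.
  rewrite lef_pV2 ?posrE ?exprn_gt0 ?mulr_gt0//.
  by rewrite expr2; apply: ler_pM => //; exact: ltW.
have Yle : `|Y| <= `|reduced_eigenvalue T F q - reduced_eigenvalue T' F' q| + 6 * M ^+ 2 / eps ^+ 2 * `|T - T'|.
  have -> : Y = (reduced_eigenvalue T F q - reduced_eigenvalue T' F' q) - X by rewrite /X /Y; ring.
  by apply: le_trans (ler_normB _ _) _; rewrite lerD2l.
rewrite YE normrM; apply: ler_pM => //.
have T'0 : 0 < T' by move/andP: hT' => [h _]; exact: lt_le_trans h.
rewrite ger0_norm; last by rewrite divr_ge0 ?mulr_ge0 ?sqr_ge0 ?ltW.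
apply: ler_pM; first by rewrite mulr_ge0 ?ltW.
- by rewrite invr_ge0 ?mulr_ge0 ?sqr_ge0 ?ltW.
- have -> : 9 * M ^+ 2 = (3 * M) * (3 * M) by ring.
  by apply: ler_pM => //; exact: ltW.
- rewrite lef_pV2 ?posrE ?mulr_gt0 ?exprn_gt0//.
  apply: ler_wpM2l; first by rewrite mulr_ge0// ltW.
  by case/andP: hT' => h _; rewrite ler_pXn2r ?nnegrE ?(ltW e0) ?(ltW T'0).
Qed.

End bounds.
End stability_algebra.

Section stability.
Context {R : realType}.
Variables (a eps M N : R).
Hypothesis a01 : 0 < a < 1.
Hypothesis eps0 : 0 < eps.
Hypothesis N0 : 0 <= N.

(** [rho] bounds kappa a = par2 a / (par1 + par2 a) on the box, by monotonicity in par1 and par2;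
    being below 1 it keeps the power series away from its singularity at 1. [H] bounds the quotient
    [g n] of [hlog] by n, [L] / n is its Lipschitz constant in kappa a, [B] bounds the admittances,
    and [c] is the lower slope of [hlog]. *)
Let rho := N * a / (eps + N * a).
Let H := ((1 - rho) ^+ 2)^-1.
Let L := 3 / (1 - rho) ^+ 3.
Let B := M * (1 + H).
Let c := (1 - rho) ^+ 2 / 3.

Definition in_box (al : @param R) :=
  [/\ eps <= par0 al <= M, eps <= par1 al <= M & 0 <= par2 al <= N].

Lemma rho01 : 0 <= rho < 1.
Proof.
have /andP[a0 a1] := a01; have e0 := eps0; have n0 := N0.
have Na : 0 <= N * a by rewrite mulr_ge0// ltW.
have d0 : 0 < eps + N * a by rewrite ltr_wpDr.
by rewrite /rho divr_ge0 ?(ltW d0)//= ltr_pdivrMr// mul1r ltrDr.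
Qed.

Lemma in_box_pos al : in_box al -> [/\ 0 < par0 al, 0 < par1 al & 0 <= par2 al].
Proof.
by move=> [/andP[h0 _] /andP[h1 _] /andP[h2 _]]; split => //; exact: lt_le_trans eps0 _.
Qed.

Lemma kappa_box al : in_box al -> 0 <= kappa a al * a <= rho.
Proof.
move=> bal; have [_ p1 p2] := in_box_pos bal.
have /andP[-> _] := kappa_itv a01 p1 p2.
have /andP[a0 a1] := a01; have e0 := eps0; have n0 := N0.
have [_ /andP[l1 _] /andP[_ l2]] := bal.
have Na : 0 <= N * a by rewrite mulr_ge0// ltW.
have d0 : 0 < eps + N * a by rewrite ltr_wpDr.
have pa : 0 <= par2 al * a by rewrite mulr_ge0// ltW.
have d1 : 0 < par1 al + par2 al * a by rewrite ltr_wpDr.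
rewrite /= /kappa /rho mulrAC ler_pdivrMr// mulrAC ler_pdivlMr//.
rewrite -subr_ge0.
have -> : N * a * (par1 al + par2 al * a) - par2 al * a * (eps + N * a) =
  a * (N * par1 al - par2 al * eps) by ring.
apply: mulr_ge0; first exact: ltW.
by rewrite subr_ge0; apply: ler_pM => //; exact: ltW.
Qed.

Lemma H0 : 0 < H.
Proof. by have /andP[_ r1] := rho01; rewrite /H invr_gt0 exprn_gt0// subr_gt0. Qed.

Lemma L0 : 0 < L.
Proof. by have /andP[_ r1] := rho01; rewrite /L divr_gt0// exprn_gt0// subr_gt0. Qed.

Lemma c0 : 0 < c.
Proof. by have /andP[_ r1] := rho01; rewrite /c divr_gt0// exprn_gt0// subr_gt0. Qed.

Let g n al := hlog n (kappa a al * a) / n%:R.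

Lemma slope_bounds n al : (0 < n)%N -> in_box al -> 0 <= g n al <= H.
Proof.
move=> n0 bal; have kb := kappa_box bal; have r01 := rho01.
have n0r : 1 <= n%:R :> R by rewrite ler1n.
have n00 : 0 < n%:R :> R by rewrite ltr0n.
have h0 := hlog_ge0 n0 r01 kb; have h1 := hlog_le n0 r01 kb.
rewrite /g; apply/andP; split; first by apply: divr_ge0 => //; exact: ltW.
rewrite ler_pdivrMr//; apply: le_trans h1 _.
by rewrite -[leLHS]mulr1; apply: ler_wpM2l => //; rewrite ltW// H0.
Qed.

Lemma slope_lip n al be : (0 < n)%N -> in_box al -> in_box be ->
  `|g n al - g n be| <= L / n%:R * `|kappa a al * a - kappa a be * a|.
Proof.
move=> n0 bal bbe; have r01 := rho01.
have n00 : 0 < n%:R :> R by rewrite ltr0n.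
have key x y : 0 <= x <= rho -> 0 <= y <= rho -> y <= x -> `|hlog n x - hlog n y| <= L * `|x - y|.
  move=> /andP[x0 x1] /andP[y0 y1] yx.
  have hy : 0 <= y <= x by rewrite y0 yx.
  rewrite [X in _ <= L * X]ger0_norm ?subr_ge0//; rewrite ger0_norm.
    have hh := hlog_upper n0 r01 hy x1. exact: hh.
  apply: le_trans (hlog_lower n0 r01 hy x1).
  by rewrite mulr_ge0 ?subr_ge0// ltW// c0.
rewrite /g -mulrBl normrM [X in _ * X]gtr0_norm ?invr_gt0// [leRHS]mulrAC.
apply: ler_wpM2r; first by rewrite invr_ge0 ltW.
have k1 := kappa_box bal; have k2 := kappa_box bbe.
have [yx|xy] := orP (le_total (kappa a be * a) (kappa a al * a)); first exact: (key _ _ k1 k2 yx).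
by rewrite distrC [X in _ <= _ * X]distrC; exact: (key _ _ k2 k1 xy).
Qed.

Lemma M_le_B al : in_box al -> M <= B.
Proof.
move=> [/andP[h1 h2] _ _]; rewrite /B mulrDr mulr1 lerDl mulr_ge0 ?(ltW H0)//.
by rewrite (le_trans _ h2)// (le_trans _ h1)// ltW.
Qed.

Lemma par0_box al : in_box al -> eps <= par0 al <= B.
Proof. by move=> bal; have [/andP[-> h] _ _] := bal; exact: le_trans h (M_le_B bal). Qed.

Lemma admittance_box n al : (0 < n)%N -> in_box al -> eps <= admittance n a al <= B.
Proof.
move=> n0 bal; have [_ /andP[h1 h2] _] := bal; have /andP[g0 g1] := slope_bounds n0 bal.
have e0 := eps0; have p1 : 0 <= par1 al by lra.
rewrite /admittance -/(g n al); apply/andP; split.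
  by apply: le_trans h1 _; rewrite mulrDr mulr1 lerDl mulr_ge0.
by apply: ler_pM => //; [rewrite addr_ge0|rewrite lerD2l].
Qed.

(* The combination of the admittances of index 1 and [n] that eliminates [par1 z]: the slope
   in [kappa] is bounded below for index 1 and is O(1/n) for index [n]. *)
Lemma kappa_gap n z w : (0 < n)%N -> 2 * (1 + H) * L / c <= n%:R -> in_box z -> in_box w ->
  kappa a w * a <= kappa a z * a ->
  eps * c / 2 * (kappa a z * a - kappa a w * a) <=
    (1 + H) * (`|admittance 1 a z - admittance 1 a w| + `|admittance n a z - admittance n a w|).
Proof.
move=> n0 hn bz bw wz; pose d := kappa a z * a - kappa a w * a.
have d0 : 0 <= d by rewrite subr_ge0.
have i1 : (0 < 1)%N by [].
have [/andP[a0 a1] /andP[b0 b1]] := (slope_bounds i1 bz, slope_bounds i1 bw).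
have [/andP[a2 a3] /andP[b2 b3]] := (slope_bounds n0 bz, slope_bounds n0 bw).
have h0 := H0; have cc := c0; have ll := L0.
have lo : c * d <= g 1 z - g 1 w.
  have /andP[w0 _] := kappa_box bw; have /andP[_ zr] := kappa_box bz.
  rewrite /g !divr1; apply: (hlog_lower i1 rho01 _ zr).
  by rewrite w0 wz.
have n00 : 0 < n%:R :> R by rewrite ltr0n.
(* Here the threshold on n is spent: (1 + H) L / n <= c / 2, so index n takes away at most half of
   the slope [c] of index 1. *)
have up : (1 + H) * (g n z - g n w) <= c / 2 * d.
  have := slope_lip n0 bz bw; rewrite (ger0_norm d0) -/d => up.
  have up1 : g n z - g n w <= L / n%:R * d by apply: le_trans (ler_norm _) up.
  have h1 : 0 <= 1 + H by lra.
  apply: le_trans (ler_wpM2l h1 up1) _; rewrite mulrA; apply: ler_wpM2r => //.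
  rewrite mulrA ler_pdivrMr//; move: hn; rewrite ler_pdivrMr//.
  lra.
have [_ /andP[p1 _] _] := bw.
have id : (admittance 1 a z - admittance 1 a w) * (1 + g n z) - (admittance n a z - admittance n a w) * (1 + g 1 z)
  = par1 w * ((g 1 z - g 1 w) * (1 + g n w) - (1 + g 1 w) * (g n z - g n w)).
  by rewrite /admittance -!/(g _ _); ring.
have num : c / 2 * d <= (g 1 z - g 1 w) * (1 + g n w) - (1 + g 1 w) * (g n z - g n w).
  have cd : 0 <= c * d by rewrite mulr_ge0// ltW.
  have t1 : c * d <= (g 1 z - g 1 w) * (1 + g n w).
    rewrite -[leLHS]mulr1; apply: ler_pM => //; lra.
  have t2 : (1 + g 1 w) * (g n z - g n w) <= c / 2 * d.
    have [neg|pos] := orP (le_total (g n z - g n w) 0).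
      apply: (@le_trans _ _ 0); last by rewrite mulr_ge0// divr_ge0// ltW.
      by apply: mulr_ge0_le0 => //; lra.
    apply: le_trans up; apply: ler_wpM2r => //; lra.
  lra.
have e0 := eps0.
have n00' : 0 <= c / 2 * d by rewrite mulr_ge0// divr_ge0// ltW.
have t3 : eps * (c / 2 * d) <= par1 w * ((g 1 z - g 1 w) * (1 + g n w) - (1 + g 1 w) * (g n z - g n w)).
  by apply: ler_pM => //; exact: ltW.
rewrite -/d; have -> : eps * c / 2 * d = eps * (c / 2 * d) by ring.
apply: le_trans t3 _; rewrite -id [leRHS]mulrDr.
apply: le_trans (ler_norm _) _; apply: le_trans (ler_normB _ _) _.
apply: lerD; rewrite normrM mulrC; apply: ler_wpM2r => //; rewrite ger0_norm; lra.
Qed.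

Variables (al be : @param R) (s : R).
Hypothesis bal : in_box al.
Hypothesis bbe : in_box be.
Hypothesis dist_le : forall m : nat,
  `|dn_eigenvalue m.+1 a al - dn_eigenvalue m.+1 a be| / Num.sqrt (1 + m.+1%:R ^+ 2) <= s.

Lemma s_ge0 : 0 <= s.
Proof. by apply: le_trans (dist_le 0); rewrite divr_ge0 ?sqrtr_ge0. Qed.

Let red n al := reduced_eigenvalue (par0 al) (admittance n a al) (a ^+ (2 * n)).

(** Dividing the eigenvalue by n compensates the Sobolev weight, as the square root of 1 + n^2 is at
    most 2 n. The bound is uniform in n. *)
Lemma reduced_dist n : (0 < n)%N -> `|red n al - red n be| <= 2 * s.
Proof.
case: n => // m _; have := dist_le m; set n := m.+1; have n0 : 0 < n%:R :> R by rewrite ltr0n.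
have n1 : 1 <= n%:R :> R by rewrite ler1n.
have E z : dn_eigenvalue n a z = n%:R * red n z by rewrite /dn_eigenvalue -mulrA.
rewrite !E -mulrBr normrM gtr0_norm// => h.
have q0 : 0 < Num.sqrt (1 + n%:R ^+ 2) :> R by rewrite sqrtr_gt0 ltr_wpDr ?sqr_ge0.
move: h; rewrite ler_pdivrMr// => h.
have q2 : Num.sqrt (1 + n%:R ^+ 2) <= 2 * n%:R :> R.
  rewrite -(@ler_pXn2r _ 2)// ?nnegrE ?(ltW q0) ?mulr_ge0 ?(ltW n0)//.
  by rewrite sqr_sqrtr ?addr_ge0 ?sqr_ge0//; move: (n%:R) n1 => r r1; nra.
rewrite -(ler_pM2l n0) (le_trans h)//.
have -> : n%:R * (2 * s) = s * (2 * n%:R) by ring.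
by apply: ler_wpM2l => //; exact: s_ge0.
Qed.

Lemma q_itv n : (0 < n)%N -> 0 < a ^+ (2 * n) < 1.
Proof.
move=> n0; have /andP[a0 a1] := a01.
rewrite exprn_gt0//= exprn_ilt1// ?ltW//.
by rewrite muln_eq0 negb_or /= -lt0n.
Qed.

(** The reduced eigenvalues differ from [par0] by O(q) and from each other by at most 2 s for every
    n; letting q = a^(2n) tend to 0 leaves 2 s. *)
Lemma par0_dist : `|par0 al - par0 be| <= 2 * s.
Proof.
have /andP[a0 a1] := a01.
pose K := 2 * B ^+ 2 / eps.
have K0 : 0 <= K by rewrite /K divr_ge0 ?(ltW eps0)// mulr_ge0 ?sqr_ge0.
apply/ler_addgt0Pr => e e0.
have : \forall n \near \oo, `|0 - a ^+ n| <= e / (2 * K + 1).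
  have cv : (fun n => a ^+ n) @ \oo --> (0 : R) by apply: cvg_expr; rewrite gtr0_norm.
  move/cvgrPdist_le: cv; apply; rewrite divr_gt0// ltr_wpDl// mulr_ge0//.
move=> [n0 _ /(_ (2 * n0.+1)%N)]; rewrite sub0r normrN ger0_norm ?exprn_ge0 ?(ltW a0)// => hq.
have {}hq : a ^+ (2 * n0.+1) <= e / (2 * K + 1) by apply: hq => /=; rewrite (leq_trans (leqnSn n0))// leq_pmull.
have n1 : (0 < n0.+1)%N by [].
have qi := q_itv n1.
have r1 := reduced_eigenvalue_near eps0 qi (par0_box bal) (admittance_box n1 bal).
have r2 := reduced_eigenvalue_near eps0 qi (par0_box bbe) (admittance_box n1 bbe).
have r3 := reduced_dist n1.
rewrite -/K -/(red _ al) in r1; rewrite -/K -/(red _ be) in r2.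
have hK : a ^+ (2 * n0.+1) * K * 2 <= e.
  have d0 : 0 < 2 * K + 1 by rewrite ltr_wpDl// mulr_ge0.
  move: hq; rewrite ler_pdivlMr// => hq; apply: le_trans hq.
  have /andP[/ltW q0 _] := qi; rewrite -mulrA; apply: ler_wpM2l => //.
  by rewrite mulrC lerDl.
have -> : par0 al - par0 be = (red n0.+1 al - red n0.+1 be) - (red n0.+1 al - par0 al) + (red n0.+1 be - par0 be) by ring.
apply: le_trans (ler_normD _ _) _.
have := ler_normB (red n0.+1 al - red n0.+1 be) (red n0.+1 al - par0 al).
move: (`|_ - _ - _|) (`|red _ be - _|) (`|red _ al - par0 _|) r1 r2 r3 hK => x y z.
lra.
Qed.

(** The constant of [reduced_eigenvalue_lip] with [B] as upper bound, after inserting 2 s for the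
    distance of the reduced eigenvalues and 2 s for that of [par0]. *)
Let KF n := 9 * B ^+ 2 / (4 * a ^+ (2 * n) * eps ^+ 2) * (2 + 6 * B ^+ 2 / eps ^+ 2 * 2).

Lemma admittance_dist n : (0 < n)%N -> `|admittance n a al - admittance n a be| <= KF n * s.
Proof.
move=> n0; have qi := q_itv n0; have /andP[q0 _] := qi.
have := reduced_eigenvalue_lip eps0 qi (par0_box bal) (par0_box bbe)
  (admittance_box n0 bal) (admittance_box n0 bbe).
move=> /le_trans; apply; rewrite /KF -[leRHS]mulrA; apply: ler_wpM2l.
  apply: divr_ge0; apply: mulr_ge0; rewrite ?sqr_ge0//.
  by apply: mulr_ge0 => //; exact: ltW.
rewrite [leRHS]mulrDl; apply: lerD; first exact: reduced_dist.
rewrite -[leRHS]mulrA; apply: ler_wpM2l; last exact: par0_dist.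
by apply: divr_ge0; [apply: mulr_ge0 => //; exact: sqr_ge0|exact: sqr_ge0].
Qed.

Lemma kappa_dist n : (0 < n)%N -> 2 * (1 + H) * L / c <= n%:R ->
  `|kappa a al * a - kappa a be * a| <= (1 + H) * (KF 1 + KF n) * (2 / (eps * c)) * s.
Proof.
move=> n0 hn.
have ec : 0 < eps * c by rewrite mulr_gt0 ?c0.
have key z w : in_box z -> in_box w -> kappa a w * a <= kappa a z * a ->
    `|admittance 1 a z - admittance 1 a w| <= KF 1 * s ->
    `|admittance n a z - admittance n a w| <= KF n * s ->
    `|kappa a z * a - kappa a w * a| <= (1 + H) * (KF 1 + KF n) * (2 / (eps * c)) * s.
  move=> bz bw wz f1 fn; have hd := kappa_gap n0 hn bz bw wz.
  rewrite ger0_norm ?subr_ge0//; move: hd; set d := kappa a z * a - _ => hd.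
  have -> : d = (2 / (eps * c)) * (eps * c / 2 * d).
    by field; rewrite !gt_eqF ?c0.
  have -> : (1 + H) * (KF 1 + KF n) * (2 / (eps * c)) * s = (2 / (eps * c)) * ((1 + H) * (KF 1 * s + KF n * s)) by ring.
  apply: ler_wpM2l; first by rewrite divr_ge0// ltW.
  apply: le_trans hd _; apply: ler_wpM2l; first by rewrite addr_ge0// ltW// H0.
  exact: lerD.
have f1 := admittance_dist (isT : (0 < 1)%N); have fn := admittance_dist n0.
have [yx|xy] := orP (le_total (kappa a be * a) (kappa a al * a)); first exact: key.
by rewrite distrC; apply: key => //; rewrite distrC.
Qed.

Let KX n := (1 + H) * (KF 1 + KF n) * (2 / (eps * c)).

(** The admittance of index 1 is par1 (1 + g 1): the error in g 1 is governed by that in kappa, and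
    the factor 1 + g 1 is at least 1. *)
Lemma par1_dist n : (0 < n)%N -> 2 * (1 + H) * L / c <= n%:R ->
  `|par1 al - par1 be| <= (KF 1 + M * L * KX n) * s.
Proof.
move=> n0 hn; have f1 := admittance_dist (isT : (0 < 1)%N); have kd := kappa_dist n0 hn.
have i1 : (0 < 1)%N by [].
have gl := slope_lip i1 bal bbe; have /andP[g0 _] := slope_bounds i1 bal.
have [_ /andP[p1 p2] _] := bbe; have e0 := eps0; have ll := L0.
have E : (par1 al - par1 be) * (1 + g 1 al) = (admittance 1 a al - admittance 1 a be) - par1 be * (g 1 al - g 1 be).
  by rewrite /admittance -!/(g _ _); ring.
apply: (@le_trans _ _ (`|par1 al - par1 be| * (1 + g 1 al))).
  by apply: ler_peMr; rewrite ?normr_ge0// lerDl.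
rewrite -[X in _ * X]ger0_norm; last by lra.
rewrite -normrM E; apply: le_trans (ler_normB _ _) _; rewrite mulrDl; apply: lerD => //.
rewrite normrM ger0_norm; last by lra.
have -> : M * L * KX n * s = M * (L * (KX n * s)) by ring.
apply: ler_pM => //; first by lra.
apply: le_trans gl _; rewrite divr1; apply: ler_wpM2l; first exact: ltW.
exact: kd.
Qed.

Let K1 n := KF 1 + M * L * KX n.

Lemma par2_dist n : (0 < n)%N -> 2 * (1 + H) * L / c <= n%:R ->
  `|par2 al - par2 be| <= (K1 n + (M + N * a) * KX n) / (a * (1 - rho)) * s.
Proof.
move=> n0 hn; have p1d := par1_dist n0 hn; have kd := kappa_dist n0 hn.
have /andP[a0 a1] := a01; have /andP[r0 r1] := rho01; have e0 := eps0.
have [_ /andP[l1 l2] /andP[l3 l4]] := bal; have [_ /andP[m1 m2] /andP[m3 m4]] := bbe.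
(* The definition of kappa solved for [par2], in a form that stays valid when [par2] is 0; the
   factor 1 - kappa a is at least 1 - rho. *)
have rel z : in_box z -> par2 z * a * (1 - kappa a z * a) = kappa a z * a * par1 z.
  move=> bz; have [_ p1 p2] := in_box_pos bz; rewrite /kappa; field.
  by rewrite gt_eqF// ltr_wpDr// mulr_ge0// ltW.
have Ea := rel _ bal; have Eb := rel _ bbe.
have /andP[x0 x1] := kappa_box bal; have /andP[y0 y1] := kappa_box bbe.
move: kd; set x := kappa a al * a in Ea x0 x1 *; set y := kappa a be * a in Eb y0 y1 * => kd.
have E : (par2 al - par2 be) * (a * (1 - x)) = x * (par1 al - par1 be) + (par1 be + par2 be * a) * (x - y).
  transitivity (par2 al * a * (1 - x) - par2 be * a * (1 - y) + par2 be * a * (x - y)); first by ring.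
  by rewrite Ea Eb; ring.
have ar : 0 < a * (1 - rho) by rewrite mulr_gt0// subr_gt0.
rewrite mulrAC ler_pdivlMr//.
apply: (@le_trans _ _ (`|par2 al - par2 be| * (a * (1 - x)))).
  by apply: ler_wpM2l => //; apply: ler_wpM2l; [exact: ltW|lra].
have ax : 0 <= a * (1 - x) by rewrite mulr_ge0 ?ltW// subr_gt0; lra.
rewrite -[X in _ * X]ger0_norm// -normrM E; apply: le_trans (ler_normD _ _) _.
rewrite [leRHS]mulrDl; apply: lerD.
  rewrite normrM ger0_norm//; apply: le_trans p1d.
  by rewrite -[leRHS]mul1r; apply: ler_wpM2r => //; lra.
have pa : 0 <= par2 be * a by rewrite mulr_ge0// ltW.
have pb : par2 be * a <= N * a by apply: ler_wpM2r => //; exact: ltW.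
rewrite normrM ger0_norm; last by lra.
rewrite -mulrA; apply: ler_pM => //; lra.
Qed.

End stability.

(** * The stability constant and the conclusion *)

Lemma stability (R : realType) (a eps M N : R) : 0 < a < 1 -> 0 < eps -> 0 <= N ->
  exists2 K : R, 0 < K & forall (al be : @param R) (s : R), in_box eps M N al -> in_box eps M N be ->
    (forall m, `|dn_eigenvalue m.+1 a al - dn_eigenvalue m.+1 a be| / Num.sqrt (1 + m.+1%:R ^+ 2) <= s) ->
    `|par0 al - par0 be| + `|par1 al - par1 be| + `|par2 al - par2 be| <= K * s.
Proof.
move=> a01 eps0 N0.
pose rho := N * a / (eps + N * a).
(* The threshold of [kappa_gap] with [H], [L] and [c] expanded; [n] is an integer above it. *)
pose r := 2 * (1 + ((1 - rho) ^+ 2)^-1) * (3 / (1 - rho) ^+ 3) / ((1 - rho) ^+ 2 / 3).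
pose n := (Num.bound `|r|).+1.
have hn : r <= n%:R.
  apply: le_trans (ler_norm r) _; apply: le_trans (ltW (archi_boundP (normr_ge0 r))) _.
  by rewrite ler_nat.
(* The witnesses are the constants of [par1_dist] and [par2_dist], found by unification before the
   parameters and [s] are introduced, hence independent of them. *)
have E : exists K1 K2 : R, forall (al be : @param R) (s : R), in_box eps M N al -> in_box eps M N be ->
    (forall m, `|dn_eigenvalue m.+1 a al - dn_eigenvalue m.+1 a be| / Num.sqrt (1 + m.+1%:R ^+ 2) <= s) ->
    `|par1 al - par1 be| <= K1 * s /\ `|par2 al - par2 be| <= K2 * s.
  eexists; eexists; move=> al be s bal bbe h; split.
    exact: (par1_dist a01 eps0 N0 bal bbe h (isT : (0 < n)%N) hn).
  exact: (par2_dist a01 eps0 N0 bal bbe h (isT : (0 < n)%N) hn).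
have [K1 [K2 h12]] := E.
(* The absolute value and the summand 1 make the constant positive whatever the signs of the
   witnesses. *)
exists (`|2 + K1 + K2| + 1) => [|al be s bal bbe h]; first by rewrite ltr_wpDl.
have [h1 h2] := h12 al be s bal bbe h.
have h0 := par0_dist a01 eps0 N0 bal bbe h.
have s0 : 0 <= s := s_ge0 h.
apply: le_trans (_ : (2 + K1 + K2) * s <= _).
  by rewrite [leRHS]mulrDl; apply: lerD => //; rewrite [leRHS]mulrDl; exact: lerD.
by apply: ler_wpM2r => //; apply: le_trans (ler_norm _) _; rewrite lerDl.
Qed.

(** The class is a set of functions, so membership only provides some parameters in the box with the
    same conductivity. Radius a recovers [par0], and the radii 0 and a / 2 determine [par1] and
    [par2]. *)
Lemma conductivity_inj (R : realType) (a : R) (al be : @param R) : 0 < a < 1 ->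
  conductivity a al = conductivity a be -> al = be.
Proof.
move=> /andP[a0 a1] E.
have rad (t : R) : 0 <= t -> Defs.radius (t, 0) = t.
  by move=> t0; rewrite /Defs.radius /= expr0n/= addr0 sqrtr_sqr ger0_norm.
have ev t : 0 <= t -> (if t < a then par1 al + par2 al * (a - t) else par0 al) =
    (if t < a then par1 be + par2 be * (a - t) else par0 be).
  by move=> t0; have := congr1 (fun f => f (t, 0)) E; rewrite /conductivity rad.
have := ev a (ltW a0); rewrite ltxx => e0.
have := ev 0 (lexx 0); rewrite a0 subr0 => e1.
have := ev (a / 2) (divr_ge0 (ltW a0) (ler0n _ _)).
have -> : a / 2 < a by lra.
move=> e2; case: al be E ev e0 e1 e2 => p0 p1 p2 [q0 q1 q2] /= _ _ -> e1 e2.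
have h : p2 * a = q2 * a by lra.
have e22 : p2 = q2 by apply: (mulIf _ h); rewrite gt_eqF.
by move: e1; rewrite e22 => /addIr ->.
Qed.

Theorem theorem1p1 (R : realType) (a eps0 M N : R) :
  0 < a < 1 -> 0 < eps0 -> 0 < M -> 0 <= N ->
  exists2 C : R, 0 < C &
    forall al be : @param R,
      conductivity_class a eps0 M N (conductivity a al) ->
      conductivity_class a eps0 M N (conductivity a be) ->
      ((C * (`|par0 al - par0 be| + `|par1 al - par1 be|
             + `|par2 al - par2 be|))%:E
       <= star_dist (DN (conductivity a al)) (DN (conductivity a be)))%E.
Proof.
move=> a01 e0 M0 N0; have [K K0 hK] := stability M a01 e0 N0.
exists K^-1; first by rewrite invr_gt0.
move=> al be [al' bal /(conductivity_inj a01) <-] [be' bbe /(conductivity_inj a01) <-] {al be}.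
have [p0 p1 p2] := in_box_pos e0 bal; have [q0 q1 q2] := in_box_pos e0 bbe.
have lb m := star_dist_ge m a01 p0 p1 p2 q0 q1 q2.
(* The distance is an extended real: the value +oo satisfies the claim at once, and -oo is excluded
   by the lower bound at index 1. *)
case: (star_dist _ _) lb => [s| |] lb.
- by rewrite lee_fin ler_pdivrMl//; apply: hK => // m; have := lb m; rewrite lee_fin.
- exact: leey.
- by have := lb 0%N; rewrite leeNy_eq.
Qed.
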